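(* Let $n,m\ge 1$, let $N\ge 0$ be an integer, let $a,b,c,d,g,h,e_1,\dots,e_n,f_1,\dots,f_m,x_1,\dots,x_n,y_1,\dots,y_m$ be complex parameters and let $\lambda=qa^2/(bcd)$. Write $E=e_1\cdots e_n$ and $F=f_1\cdots f_m$. Then \begin{align*} &\sum_{\substack{0\le|\boldsymbol k|\le N\\ k_1,\dots,k_n\ge0}}\Bigg(\prod_{1\le r<s\le n}\frac{\theta(q^{k_r-k_s}x_r/x_s;p)}{\theta(x_r/x_s;p)}\prod_{r,s=1}^n\frac{(e_sx_r/x_s;q,p)_{k_r}}{(qx_r/x_s;q,p)_{k_r}}\\ &\quad\times\frac{\theta(aq^{2|\boldsymbol k|};p)}{\theta(a;p)}\frac{(a,b,c,d;q,p)_{|\boldsymbol k|}}{(aq^{N+1},aq/b,aq/c,aq/d;q,p)_{|\boldsymbol k|}}\cdot\frac{(F,\,\lambda aq^{1+N}/(EF),\,q^{-N};q,p)_{|\boldsymbol k|}}{(aq/E,\,aq/F,\,EFq^{-N}/\lambda;q,p)_{|\boldsymbol k|}}\\ &\quad\times\prod_{r=1}^n\frac{(gx_r/E;q,p)_{k_r}(gx_r;q,p)_{|\boldsymbol k|}}{(gx_r;q,p)_{k_r}(gx_r/e_r;q,p)_{|\boldsymbol k|}}\cdot q^{\sum_{r=1}^n rk_r}\Bigg)\\ &=\frac{(aq,\,aq/(EF),\,\lambda q/E,\,\lambda q/F;q,p)_N}{(aq/E,\,aq/F,\,\lambda q,\,\lambda q/(EF);q,p)_N}\\ &\quad\times\sum_{\substack{0\le|\boldsymbol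 j|\le N\\ j_1,\dots,j_m\ge0}}\Bigg(\prod_{1\le r<s\le m}\frac{\theta(q^{j_r-j_s}y_r/y_s;p)}{\theta(y_r/y_s;p)}\prod_{r,s=1}^m\frac{(f_sy_r/y_s;q,p)_{j_r}}{(qy_r/y_s;q,p)_{j_r}}\\ &\qquad\times\frac{\theta(\lambda q^{2|\boldsymbol j|};p)}{\theta(\lambda;p)}\frac{(\lambda,\lambda b/a,\lambda c/a,\lambda d/a;q,p)_{|\boldsymbol j|}}{(\lambda q^{N+1},aq/b,aq/c,aq/d;q,p)_{|\boldsymbol j|}}\cdot\frac{(E,\,\lambda aq^{1+N}/(EF),\,q^{-N};q,p)_{|\boldsymbol j|}}{(\lambda q/E,\,\lambda q/F,\,EFq^{-N}/a;q,p)_{|\boldsymbol j|}}\\ &\qquad\times\prod_{r=1}^m\frac{(hy_r/F;q,p)_{j_r}(hy_r;q,p)_{|\boldsymbol j|}}{(hy_r;q,p)_{j_r}(hy_r/f_r;q,p)_{|\boldsymbol j|}}\cdot q^{\sum_{r=1}^m rj_r}\Bigg). \end{align*}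
   Context: Let $q,p$ be complex numbers with $q\neq 0$ and $|p|<1$. For $a\ne 0$ put $\theta(a;p)=\prod_{j\ge 0}(1-ap^j)(1-p^{j+1}/a)$. For an integer $k\ge 0$ the $q,p$-shifted factorial is $(a;q,p)_k=\prod_{j=0}^{k-1}\theta(aq^j;p)$ (empty product $=1$). Write $(a_1,\dots,a_m;q,p)_k=(a_1;q,p)_k\cdots(a_m;q,p)_k$. For a tuple $\boldsymbol k=(k_1,\dots,k_n)$, $|\boldsymbol k|=k_1+\cdots+k_n$. All parameters are nonzero and generic in the sense that no denominators in the formula vanish. *)

(* Defs.v *)
From HB Require Import structures.
From mathcomp Require Import all_boot all_order all_algebra.
From mathcomp Require Import all_classical all_reals all_analysis.
From mathcomp Require Import complex.
Set Implicit Arguments.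
Unset Strict Implicit.
Unset Printing Implicit Defensive.
Import Order.TTheory GRing.Theory Num.Theory.
Import numFieldNormedType.Exports.
Local Open Scope ring_scope.

(* The infinite product is the limit of its partial products; [R[i]^o] carries
   the topology of the complex modulus.  The values at a = 0 or at p with
   modulus at least 1 are irrelevant. *)
Definition theta (R : realType) (a p : R[i]) : R[i] :=
  limn (fun M : nat =>
    \prod_(0 <= j < M) ((1 - a * p ^+ j) * (1 - p ^+ j.+1 / a)) : R[i]^o).

(* (a; q, p)_k *)
Definition qpoch (R : realType) (a q p : R[i]) (k : nat) : R[i] :=
  \prod_(0 <= j < k) theta (a * q ^+ j) p.

(* (a_1, ..., a_m; q, p)_k *)
Definition qpochs (R : realType) (s : seq R[i]) (q p : R[i]) (k : nat) : R[i] :=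
  \prod_(a <- s) qpoch a q p k.

(* Since |k| <= N forces k_r <= N for every r, the tuples of nonnegative
   integers with |k| <= N are exactly the [k : multi n N] with [mweight k <= N]. *)
Notation multi n N := {ffun 'I_n -> 'I_N.+1} (only parsing).

Definition mweight (n N : nat) (k : multi n N) : nat := (\sum_(r < n) k r)%N.

(* Main.v *)
Require Import Defs.
From HB Require Import structures.
From mathcomp Require Import all_boot all_order all_algebra.
From mathcomp Require Import all_classical all_reals all_analysis.
From mathcomp Require Import complex.
From mathcomp Require Import ring lra zify.
Set Implicit Arguments.
Unset Strict Implicit.
Unset Printing Implicit Defensive.
Import Order.TTheory GRing.Theory Num.Theory.
Import numFieldNormedType.Exports.
Local Open Scope ring_scope.

(** The sums are collapsed to one dimension and then compared.  For fixed
    |k| = K every factor of the left-hand summand depends on K alone, except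
    for those that make up an A_n elliptic Jackson sum.  That sum
    ([jacksonA_sum]) evaluates to q^K (E)_K / (q)_K times a product over r that
    is inverse to the remaining g-dependent factors.  Hence the left-hand side
    is a very-well-poised series over K in which n, x and e enter only through
    E; the right-hand side collapses in the same way ([multisum_collapse]).
    The two series are the two sides of the elliptic Bailey transformation
    ([elliptic_bailey]).

    Both ingredients are algebraic consequences of a few properties of theta,
    collected in [theta_like]: the inversion formula, the fact that quotients
    of zeros are zeros, and the three-term relation of Weierstrass.  The
    three-term relation implies the partial fraction identity
    [partial_fractions].  For the Jackson sum one inserts a partial fraction
    expansion of 1, shifts the summation index and recognises a second partial
    fraction sum, which gives a recursion in K with g replaced by g q.  For the
    Bailey transformation one proves the Frenkel-Turaev summation
    ([frenkel_turaev]) by induction on the length and uses it twice: once to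
    expand the coefficients with base a in coefficients with base lambda, once
    to evaluate the inner sums after exchanging the summations.

    The three-term relation itself comes from theta series.  By the Jacobi
    triple product ([triple_product]) theta(xy) theta(x/y) is, up to a
    constant, a double series over (m, n); splitting it according to the parity
    of m + n separates the variables and gives
      theta(xy) theta(x/y) = A(x) B(y) - (x/y) B(x) A(y)
    ([theta_rank_two]).  These are two-by-two determinants, and the three-term
    relation is the Pluecker relation between them.

    The algebraic arguments divide by some thetas that are not among the
    denominators of the identity.  This is repaired by continuity: scaling a
    parameter by a real factor slightly larger than 1 moves it off the zeros of
    theta ([theta_nudge_neq0]), and both sides are continuous in the parameters
    where the denominators do not vanish. *)

(** * Partial fractions for theta functions *)

(** The pairs [z, w] := th (z / w) * th (z * w / P) behave like the two-by-two
    minors of a matrix with two rows, except that exchanging z and w costs the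
    factor - z / w; [th_weierstrass] is the Pluecker relation between four
    points. *)
Record theta_like (K : fieldType) (th : K -> K) : Prop := ThetaLike {
  th1 : th 1 = 0;
  thV : forall x, x != 0 -> th x^-1 = - (th x / x);
  th_div_eq0 : forall x y, x != 0 -> y != 0 ->
    th x = 0 -> th y = 0 -> th (x / y) = 0;
  th_weierstrass : forall P x y u v,
    P != 0 -> x != 0 -> y != 0 -> u != 0 -> v != 0 ->
    th (x / y) * th (x * y / P) * (th (u / v) * th (u * v / P)) =
    th (u / y) * th (u * y / P) * (th (x / v) * th (x * v / P))
    - u / v * (th (v / y) * th (v * y / P) * (th (x / u) * th (x * u / P))) }.

Lemma big_in_setT (R : Type) (idx : R) (op : R -> R -> R) (I : finType)
    (F : I -> R) : \big[op/idx]_(i in [set: I]%SET) F i = \big[op/idx]_i F i.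
Proof. by apply: eq_bigl => i; rewrite inE. Qed.

Section PartialFractions.
Variables (K : fieldType) (th : K -> K).
Hypothesis thL : theta_like th.

Lemma th_swap (x y : K) : x != 0 -> y != 0 -> th (x / y) = - (x / y) * th (y / x).
Proof.
move=> x0 y0; rewrite -[x / y]invf_div thL.(thV) ?mulf_neq0 ?invr_eq0 //.
by rewrite invf_div mulrC mulNr.
Qed.

(** By u v = w w' the arguments u / w and u / w' are inverse to v / w' and v / w,
    so that inversion turns one term into the negative of the other. *)
Lemma th_partial_fractions2 (u v w w' : K) :
  u != 0 -> v != 0 -> w != 0 -> w' != 0 -> th (u / v) != 0 -> u * v = w * w' ->
  th (u / w) * th (u / w') / th (u / v) + th (v / w) * th (v / w') / th (v / u) = 0.
Proof.
move=> u0 v0 w0 w'0 uv E.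
have -> : u / w = w' / v by apply/eqP; rewrite eqr_div // E mulrC.
have -> : u / w' = w / v by apply/eqP; rewrite eqr_div // E.
rewrite (@th_swap w' v) // (@th_swap w v) // (@th_swap v u) //.
have -> : w' = u * v / w by rewrite E mulrC mulKf.
field.
by rewrite oppr_eq0 u0 v0 w0 uv.
Qed.

(** Induction on the number of poles.  The three-term relation writes the thetas
    of two of the zeros as a combination of products that vanish at a pole z_i
    and at a pole z_j respectively.  In each of the two resulting sums a pole
    cancels, together with a zero. *)
Lemma partial_fractions (I : finType) (A : {set I}) (z : I -> K) (W : seq K) :
  size W = #|A| -> (forall i, z i != 0) -> {in W, forall w, w != 0} ->
  {in A &, forall i j, i != j -> th (z i / z j) != 0} ->
  \prod_(i in A) z i = \prod_(w <- W) w ->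
  \sum_(i in A) (\prod_(w <- W) th (z i / w)
                 / \prod_(j in A | j != i) th (z i / z j)) = 0.
Proof.
move=> sW z0; move: {2}(size W) (erefl (size W)) => n.
elim: n W A sW => [|n IH] [|w W] A sW //= sn W0 zA zW.
  by move/esym/eqP: sW; rewrite cards_eq0 => /eqP ->; rewrite big_set0.
case: W IH sn sW W0 zW => [|w' W] IH sn sW W0 zW.
  move/esym/eqP/cards1P: sW => [i Ai]; move: zW.
  rewrite Ai !big_set1 big_seq1 => ->; rewrite big_seq1 divff ?thL.(th1) ?mul0r //.
  by rewrite W0 // inE.
have w0 : w != 0 by apply: W0; rewrite inE eqxx.
have w'0 : w' != 0 by apply: W0; rewrite !inE eqxx orbT.
case: W IH sn sW W0 zW => [|w'' W] IH sn sW W0 zW.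
  move/esym/eqP/cards2P: sW => [i [j [ij Ai]]]; move: zW.
  have s2 F : \sum_(k in A) F k = F i + F j :> K.
    by rewrite Ai big_setU1 ?inE //= big_set1.
  have ji : j != i by rewrite eq_sym.
  have iA : i \in A by rewrite Ai !inE eqxx.
  have jA : j \in A by rewrite Ai !inE eqxx orbT.
  have p2 : \prod_(k in A) z k = z i * z j.
    by rewrite Ai big_setU1 ?inE //= big_set1.
  rewrite s2 p2 !big_cons !big_nil !mulr1 => zW.
  have -> : \prod_(k in A | k != i) th (z i / z k) = th (z i / z j).
    rewrite (big_pred1 j) // => k /=; rewrite Ai !inE.
    by case: (eqVneq k i) => [->|] //=; rewrite ?andbF ?andbT ?(negbTE ij).
  have -> : \prod_(k in A | k != j) th (z j / z k) = th (z j / z i).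
    rewrite (big_pred1 i) // => k /=; rewrite Ai !inE.
    by case: (eqVneq k j) => [->|] //=; rewrite ?andbF ?andbT ?orbF ?(negbTE ji).
  by apply: th_partial_fractions2 => //; apply: zA.
set P := w * w'.
have P0 : P != 0 by rewrite mulf_neq0.
(* Such a pair exists among any three poles: if the thetas vanished for (i, j)
   and (i, k), their arguments would have the quotient z_j / z_k, at which the
   theta would vanish too. *)
have [i [j [iA jA ij tij]]] : exists i j,
    [/\ i \in A, j \in A, i != j & th (z i * z j / P) != 0].
  have : (2 < #|A|)%N by rewrite -sW.
  case/card_gt2P => i [j [k [[iA jA kA] [ij jk ki]]]].
  case: (eqVneq (th (z i * z j / P)) 0) => [ij0|]; last by exists i, j.
  case: (eqVneq (th (z i * z k / P)) 0) => [ik0|ik0]; last first.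
    by exists i, k; split=> //; rewrite eq_sym.
  have := zA _ _ jA kA jk.
  have -> : z j / z k = (z i * z j / P) / (z i * z k / P).
    by field; rewrite P0 !z0.
  by rewrite thL.(th_div_eq0) ?eqxx // ?mulf_neq0 ?invr_eq0.
(* The reduced sums: one pole and one zero have been cancelled against each
   other. *)
have red k : k \in A -> \sum_(l in A)
    (th (z l / z k) * th (z l * z k / P) * \prod_(v <- w'' :: W) th (z l / v)
     / \prod_(m in A | m != l) th (z l / z m)) = 0.
  move=> kA; rewrite (bigD1 k) //= divff // thL.(th1) !mul0r add0r.
  have cA : size (P / z k :: w'' :: W) = #|A :\ k|.
    by move: sW; rewrite (cardsD1 k) kA add1n => -[].
  have W0' : {in P / z k :: w'' :: W, forall v, v != 0}.
    move=> v; rewrite inE => /orP[/eqP ->|vW]; first by rewrite mulf_neq0 ?invr_eq0.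
    by apply: W0; rewrite !inE; move: vW; rewrite inE => ->; rewrite !orbT.
  have zA' : {in A :\ k &, forall i j, i != j -> th (z i / z j) != 0}.
    by move=> a b /setD1P[_ aA] /setD1P[_ bA]; apply: zA.
  have zW' : \prod_(i in A :\ k) z i = \prod_(v <- P / z k :: w'' :: W) v.
    apply: (mulfI (z0 k)); rewrite -big_setD1 // zW !big_cons.
    by rewrite /P; field; rewrite z0.
  have sn2 : size (P / z k :: w'' :: W) = n by case: sn.
  rewrite -[RHS](IH _ _ cA sn2 W0' zA' zW'); apply: eq_big => l.
    by rewrite !inE andbC.
  case/andP=> lA lk; rewrite [in RHS]big_cons.
  rewrite (bigD1 k) /=; last by rewrite kA eq_sym.
  have -> : \prod_(m in A :\ k | m != l) th (z l / z m)
          = \prod_(m in A | (m != l) && (m != k)) th (z l / z m).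
    by apply: eq_bigl => m; rewrite !inE -!andbA; do !bool_congr.
  rewrite (eq_bigl (fun m => [&& m \in A, m != l & m != k])); last first.
    by move=> m; rewrite andbA.
  have tlk : th (z l / z k) != 0 by exact: zA.
  have -> : z l / (P / z k) = z l * z k / P by field; rewrite P0 z0.
  rewrite -!mulrA [(th _ * _)^-1]invfM !(mulrCA _ (th (z l / z k))^-1) mulKf //.
(* A product of two thetas with fixed product of zeros lies in the span of any
   two such products whose zeros differ. *)
have expand l : th (z l / w) * th (z l / w') * (th (z i / z j) * th (z i * z j / P))
   = th (z i / w) * th (z i / w') * (th (z l / z j) * th (z l * z j / P))
     - z i / z j * (th (z j / w) * th (z j / w')) * (th (z l / z i) * th (z l * z i / P)).
  have Pw x : th (x / w') = th (x * w / P).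
    by congr th; rewrite /P; field; rewrite w0 w'0.
  by rewrite !Pw thL.(th_weierstrass) // !mulrA.
have tij' : th (z i / z j) * th (z i * z j / P) != 0 by rewrite mulf_neq0 // zA.
apply: (mulIf tij'); rewrite mul0r mulr_suml.
transitivity (th (z i / w) * th (z i / w') * (\sum_(l in A)
    (th (z l / z j) * th (z l * z j / P) * \prod_(v <- w'' :: W) th (z l / v)
     / \prod_(m in A | m != l) th (z l / z m)))
  - z i / z j * (th (z j / w) * th (z j / w')) * (\sum_(l in A)
    (th (z l / z i) * th (z l * z i / P) * \prod_(v <- w'' :: W) th (z l / v)
     / \prod_(m in A | m != l) th (z l / z m)))); last first.
  by rewrite !red // !mulr0 subr0.
rewrite !mulr_sumr -sumrB; apply: eq_bigr => l _.
rewrite 2!big_cons; move: (expand l).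
set X := \prod_(v <- w'' :: W) _; set Y := \prod_(m in A | _) _.
move: (th (z l / w)) (th (z l / w')) => a b E.
rewrite (_ : a * (b * X) / Y * _ =
   (a * b * (th (z i / z j) * th (z i * z j / P))) * (X / Y)); last by ring.
by rewrite E; ring.
Qed.

Lemma th_swap_neq0 (x y : K) :
  x != 0 -> y != 0 -> th (y / x) != 0 -> th (x / y) != 0.
Proof.
by move=> x0 y0 h; rewrite th_swap // mulf_neq0 // oppr_eq0 mulf_neq0 ?invr_eq0.
Qed.

(** The shape in which the identity is used: the points x_r q^(k_r) are poles on
    an equal footing and t is a further pole. *)
Lemma partial_fractions_extra_pole n (y : 'I_n -> K) (t : K) (W : seq K) :
  size W = n.+1 -> (forall i, y i != 0) -> t != 0 -> {in W, forall w, w != 0} ->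
  (forall i j, i != j -> th (y i / y j) != 0) ->
  (forall i, th (y i / t) != 0) ->
  (\prod_i y i) * t = \prod_(w <- W) w ->
  \sum_i (\prod_(w <- W) th (y i / w)
          / ((\prod_(j | j != i) th (y i / y j)) * th (y i / t))) =
  - (\prod_(w <- W) th (t / w) / \prod_j th (t / y j)).
Proof.
move=> sW y0 t0 W0 yy yt yW.
pose z (i : 'I_n.+1) := if unlift ord0 i is Some j then y j else t.
have z_lift j : z (lift ord0 j) = y j by rewrite /z liftK.
have z_ord0 : z ord0 = t by rewrite /z unlift_none.
have z0 i : z i != 0 by rewrite /z; case: unliftP.
have ty i : th (t / y i) != 0 by apply: th_swap_neq0.
have := @partial_fractions 'I_n.+1 [set: _]%SET z W.
rewrite cardsT card_ord sW => /(_ erefl z0 W0).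
have zz : {in [set: 'I_n.+1]%SET &, forall i j, i != j -> th (z i / z j) != 0}.
  move=> i j _ _; case: (unliftP ord0 i) => [i'|] ->;
    case: (unliftP ord0 j) => [j'|] ->; rewrite ?z_lift ?z_ord0 ?eqxx //.
  by rewrite (inj_eq lift_inj); apply: yy.
have zW : \prod_(i in [set: 'I_n.+1]%SET) z i = \prod_(w <- W) w.
  rewrite big_in_setT big_ord_recl z_ord0 mulrC -yW; congr (_ * _).
  by apply: eq_bigr => i _; rewrite z_lift.
move=> /(_ zz zW).
rewrite big_in_setT big_ord_recl z_ord0 => /eqP.
rewrite addrC addr_eq0 => /eqP E.
rewrite (_ : \sum_i _ = \sum_(i < n) (\prod_(w <- W) th (z (lift ord0 i) / w) /
  \prod_(j in [set: 'I_n.+1]%SET | j != lift ord0 i) th (z (lift ord0 i) / z j))).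
  rewrite E; congr (- (_ / _)).
  rewrite big_mkcond /= big_ord_recl /= !inE /= mul1r.
  by apply: eq_bigr => i _; rewrite inE z_lift.
apply: eq_bigr => i _; rewrite z_lift; congr (_ / _).
rewrite [RHS]big_mkcond /= big_ord_recl /= inE z_ord0 mulrC; congr (_ * _).
rewrite big_mkcond; apply: eq_bigr => j _.
by rewrite inE /= z_lift (inj_eq lift_inj).
Qed.

End PartialFractions.

(** * The elliptic Jackson sum of type A *)

Section Poch.
Variables (K : fieldType) (th : K -> K) (q : K).

Definition poch (a : K) (k : nat) : K := \prod_(0 <= j < k) th (a * q ^+ j).

Lemma poch0 a : poch a 0 = 1. Proof. by rewrite /poch big_nil. Qed.

Lemma poch_recr a k : poch a k.+1 = poch a k * th (a * q ^+ k).
Proof. by rewrite /poch big_nat_recr. Qed.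

Lemma pochD a j k : poch a (j + k) = poch a j * poch (a * q ^+ j) k.
Proof.
elim: k => [|k IH]; first by rewrite addn0 poch0 mulr1.
by rewrite addnS !poch_recr IH -!mulrA exprD.
Qed.

Lemma poch_recl a k : poch a k.+1 = th a * poch (a * q) k.
Proof. by rewrite -add1n pochD poch_recr poch0 expr0 expr1 mulr1 mul1r. Qed.

Lemma poch_neq0P a k :
  reflect (forall j, (j < k)%N -> th (a * q ^+ j) != 0) (poch a k != 0).
Proof.
apply: (iffP idP) => [h j jk|h]; last first.
  by rewrite /poch prodf_seq_neq0; apply/allP => j; rewrite mem_index_iota => /h.
by move: h; rewrite /poch prodf_seq_neq0 => /allP/(_ j); rewrite mem_index_iota; apply.
Qed.

End Poch.

Lemma prod_update (K : fieldType) (I : finType) (i : I) (c : K) (F G : I -> K) :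
  (forall r, r != i -> F r = G r) -> F i = G i * c -> \prod_r F r = \prod_r G r * c.
Proof.
move=> FG Fi; rewrite (bigD1 i) //= [in RHS](bigD1 i) //= Fi mulrAC.
by congr (_ * _ * _); apply: eq_bigr.
Qed.

Section JacksonA.
Variables (K : fieldType) (th : K -> K) (q : K).
Hypothesis thL : theta_like th.
Hypothesis q0 : q != 0.
Variables (n : nat) (e x : 'I_n -> K).
Hypotheses (e0 : forall r, e r != 0) (x0 : forall r, x r != 0).
Let E := \prod_r e r.
Local Notation pch := (poch th q).

(** The ratio of elliptic Vandermonde products of the points x_r q^(k_r) and x_r. *)
Definition vdm (k : 'I_n -> nat) : K :=
  \prod_(r < n) \prod_(s < n | (r < s)%N)
     (th (q ^ ((k r)%:Z - (k s)%:Z) * x r / x s) / th (x r / x s)).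

Definition jacksonA_term (g : K) (k : 'I_n -> nat) : K :=
  vdm k
  * (\prod_(r < n) \prod_(s < n)
       (pch (e s * x r / x s) (k r) / pch (q * x r / x s) (k r)))
  * (\prod_(r < n) (pch (g * x r / E) (k r) / pch (g * x r) (k r)))
  * q ^+ (\sum_(r < n) r.+1 * k r)%N.

Definition incr (i : 'I_n) (k : 'I_n -> nat) (s : 'I_n) : nat := (k s + (s == i))%N.

Let z (k : 'I_n -> nat) r := x r * q ^+ k r.

Lemma pole_neq0 k r : z k r != 0. Proof. by rewrite mulf_neq0 ?expf_neq0. Qed.

Lemma pole_incr i k r : z (incr i k) r = if r == i then q * z k r else z k r.
Proof.
by rewrite /z /incr; case: eqP => _; rewrite ?addn0 // addn1 exprS mulrCA.
Qed.

Lemma vdmE k : vdm k = \prod_(r < n) \prod_(s < n | (r < s)%N)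
     (th (z k r / z k s) / th (x r / x s)).
Proof.
apply: eq_bigr => r _; apply: eq_bigr => s _; congr (th _ / _).
by rewrite /z expfzDr // -exprnP -exprnN; field; rewrite !x0 expf_neq0.
Qed.

(** Only the pairs that contain i change.  Those in which i is the larger index
    are inverted, which costs a factor q^-1 each. *)
Lemma vdm_incr i k : (forall s, s != i -> th (z k i / z k s) != 0) ->
  vdm (incr i k) = vdm k * (q ^- i * \prod_(s | s != i)
     (th (q * z k i / z k s) / th (z k i / z k s))).
Proof.
move=> zz.
pose rat s := th (q * z k i / z k s) / th (z k i / z k s).
have swap a b : th (z k a / z k b) = - (z k a / z k b) * th (z k b / z k a).
  by apply: th_swap; rewrite ?pole_neq0.
have step (r s : 'I_n) : (r < s)%N ->
    th (z (incr i k) r / z (incr i k) s) / th (x r / x s) =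
    (th (z k r / z k s) / th (x r / x s)) *
    ((if r == i then rat s else 1) * (if s == i then q^-1 * rat r else 1)).
  move=> rs; rewrite !pole_incr.
  case: (eqVneq r i) => [ri|ri]; case: (eqVneq s i) => [si|si]; last by rewrite !mulr1.
  - by move: rs; rewrite ri si ltnn.
  - have h : th (z k r / z k s) != 0 by rewrite ri zz.
    by rewrite mulr1 [RHS]mulrAC; congr (_ / _); rewrite /rat -ri [RHS]mulrC divfK.
  - have h : th (z k i / z k r) != 0 by rewrite zz.
    rewrite mul1r [RHS]mulrAC; congr (_ / _); rewrite si.
    have qz : q * z k i != 0 by rewrite mulf_neq0 ?pole_neq0.
    rewrite [in LHS](th_swap thL) ?pole_neq0 // (swap r i) /rat.
    by field; rewrite !pole_neq0 q0 h.
have -> : vdm (incr i k) = vdm k * (\prod_(r < n) \prod_(s < n | (r < s)%N)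
    ((if r == i then rat s else 1) * (if s == i then q^-1 * rat r else 1))).
  rewrite !vdmE -big_split; apply: eq_bigr => r _ /=.
  by rewrite -big_split; apply: eq_bigr => s rs; rewrite step.
congr (_ * _).
rewrite (eq_bigr _ (fun r _ => big_split _ _ _ _ _)) /=.
rewrite big_split /= (bigD1 i) //= [X in _ * X * _]big1 => [|r ri]; last first.
  by rewrite big1 // => s _; rewrite (negbTE ri).
rewrite mulr1; under eq_bigr do rewrite eqxx.
have -> : \prod_(r < n) \prod_(s < n | (r < s)%N) (if s == i then q^-1 * rat r else 1)
    = q ^- i * \prod_(r < n | (r < i)%N) rat r.
  transitivity (\prod_(r < n | (r < i)%N) (q^-1 * rat r)).
    rewrite [RHS]big_mkcond; apply: eq_bigr => r _.
    case: ifP => ri; last first.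
      rewrite big1 // => s rs; case: eqP => // si.
      by move: rs; rewrite si ri.
    rewrite (bigD1 i) //= eqxx big1 ?mulr1 // => s /andP[_ /negbTE -> //].
  rewrite big_split /= prodr_const; congr (_ * _).
  rewrite -exprVn; congr (_ ^+ _).
  have : #|[set r : 'I_n | (r < i)%N]| = i.
    rewrite -sum1_card.
    under eq_bigl do rewrite inE.
    by rewrite (big_ord_narrow (ltnW (ltn_ord i))) sum1_card card_ord.
  by rewrite cardsE.
rewrite mulrCA; congr (_ * _).
rewrite [RHS](bigID (fun s : 'I_n => (i < s)%N)) /=; congr (_ * _).
  by apply: eq_bigl => s; rewrite -val_eqE /=; case: ltngtP.
by apply: eq_bigl => s; rewrite -val_eqE /= -leqNgt; case: ltngtP.
Qed.

Lemma jacksonA_term_incr g i k : (forall s, s != i -> th (z k i / z k s) != 0) ->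
  jacksonA_term g (incr i k) = jacksonA_term g k *
  (q * (\prod_(s | s != i) (th (q * z k i / z k s) / th (z k i / z k s)))
     * (\prod_s (th (e s * z k i / x s) / th (q * z k i / x s)))
     * (th (g * z k i / E) / th (g * z k i))).
Proof.
move=> zz; rewrite /jacksonA_term vdm_incr //.
have -> : \prod_(r < n) \prod_(s < n) (pch (e s * x r / x s) (incr i k r)
  / pch (q * x r / x s) (incr i k r))
   = \prod_(r < n) \prod_(s < n) (pch (e s * x r / x s) (k r) / pch (q * x r / x s) (k r))
    * \prod_s (th (e s * z k i / x s) / th (q * z k i / x s)).
  apply: (@prod_update _ _ i) => [r /negbTE ri|]; first by rewrite /incr ri addn0.
  rewrite -big_split; apply: eq_bigr => s _; rewrite /incr eqxx addn1 !poch_recr /=.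
  by rewrite invfM mulrACA; congr (_ * (th _ / th _)); rewrite /z; ring.
have -> : \prod_(r < n) (pch (g * x r / E) (incr i k r) / pch (g * x r) (incr i k r))
   = \prod_(r < n) (pch (g * x r / E) (k r) / pch (g * x r) (k r))
    * (th (g * z k i / E) / th (g * z k i)).
  apply: (@prod_update _ _ i) => [r /negbTE ri|]; first by rewrite /incr ri addn0.
  rewrite /incr eqxx addn1 !poch_recr /= invfM mulrACA.
  by congr (_ * (th _ / th _)); rewrite /z; ring.
have -> : (\sum_(r < n) r.+1 * incr i k r = (\sum_(r < n) r.+1 * k r) + i.+1)%N.
  under eq_bigr do rewrite /incr mulnDr.
  rewrite big_split /=; congr (_ + _)%N.
  by rewrite (bigD1 i) //= eqxx muln1 big1 ?addn0 // => r /negbTE ->; rewrite muln0.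
rewrite exprD exprS.
set V := vdm k; set A := \prod_(_ < n) \prod_(_ < n) _; set B := \prod_(_ < n) _.
set C := \prod_(_ < n | _) _; set D := \prod_(_ < n) _.
have qi : q ^+ i != 0 by rewrite expf_neq0.
by move: qi (th _ / th _); move: (q ^+ i) => Q qi X; field.
Qed.

(** The contribution of the pole x_i q^(k_i) to a partial fraction expansion of
    1.  The expansion has the additional pole E / g, and the points x_s and
    E q^m / g are its zeros.  The zeros x_s make the weight vanish when
    k_i = 0, so that each weighted term is the increment at i of some tuple. *)
Definition pf_weight (g : K) (m : nat) (k : 'I_n -> nat) (i : 'I_n) : K :=
  - ((th (z k i / (E / g * q ^+ m)) * \prod_s th (z k i / x s))
     / ((\prod_(s | s != i) th (z k i / z k s)) * th (z k i / (E / g)))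
     * (\prod_s th (E / g / z k s)) / (th (q ^- m) * \prod_s th (E / g / x s))).

Lemma big_map_ord (F : K -> K) (h : 'I_n -> K) :
  \prod_(w <- [seq h s | s <- index_enum 'I_n]) F w = \prod_s F (h s).
Proof. by rewrite big_map. Qed.

Lemma size_map_ord (h : 'I_n -> K) : size [seq h s | s <- index_enum 'I_n] = n.
Proof. by rewrite size_map /index_enum -enumT size_enum_ord. Qed.

Lemma prod_e_neq0 : E != 0. Proof. by apply/prodf_neq0. Qed.

Lemma prod_pole k : \prod_s z k s = \prod_s x s * q ^+ (\sum_s k s)%N.
Proof. by rewrite big_split /= prodrXr. Qed.

Lemma sum_pf_weight g k : g != 0 -> let m := (\sum_s k s)%N in
  th (q ^- m) != 0 -> (forall s, th (E / g / x s) != 0) ->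
  (forall i j, i != j -> th (z k i / z k j) != 0) ->
  (forall i, th (z k i / (E / g)) != 0) ->
  \sum_i pf_weight g m k i = 1.
Proof.
move=> g0 m tm tx zz zt.
have t0 : E / g != 0 by rewrite mulf_neq0 ?invr_eq0 ?prod_e_neq0.
have tz s : th (E / g / z k s) != 0 by apply: th_swap_neq0; rewrite ?pole_neq0.
pose W := E / g * q ^+ m :: [seq x s | s <- index_enum 'I_n].
have prodW (F : K -> K) : \prod_(w <- W) F w = F (E / g * q ^+ m) * \prod_s F (x s).
  by rewrite big_cons big_map_ord.
have W0 : {in W, forall w, w != 0}.
  move=> w; rewrite inE => /orP[/eqP ->|/mapP[s _ ->]] //.
  by rewrite mulf_neq0 ?expf_neq0.
have H : \prod_s z k s * (E / g) = \prod_(w <- W) w.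
  by rewrite prodW prod_pole -/m; ring.
have sW : size W = n.+1 by rewrite /= size_map_ord.
have {H} := partial_fractions_extra_pole thL sW (pole_neq0 k) t0 W0 zz zt H.
rewrite prodW => H.
rewrite /pf_weight sumrN; apply/eqP; rewrite -[X in _ == X]opprK eqr_opp.
rewrite -mulr_suml -mulr_suml (eq_bigr (fun i => \prod_(w <- W) th (z k i / w)
  / ((\prod_(s | s != i) th (z k i / z k s)) * th (z k i / (E / g))))); last first.
  by move=> i _; rewrite prodW.
rewrite H; apply/eqP.
have -> : th (E / g / (E / g * q ^+ m)) = th (q ^- m) by congr th; rewrite invfM mulVKf.
have px : \prod_s th (E / g / x s) != 0 by apply/prodf_neq0.
have pz : \prod_s th (E / g / z k s) != 0 by apply/prodf_neq0.
by field; rewrite tm px pz.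
Qed.

(** Both ratios come from th a * (a q; q)_k = (a; q)_k * th (a q^k). *)
Lemma jacksonA_term_shift g k :
  jacksonA_term (g * q) k * \prod_s (th (g * x s / E) / th (g * x s))
  = jacksonA_term g k * \prod_s (th (g * z k s / E) / th (g * z k s)).
Proof.
rewrite /jacksonA_term -!mulrA !(mulrC (q ^+ _)) ![in LHS]mulrA ![in RHS]mulrA.
congr (_ * _); rewrite -![in LHS]mulrA -![in RHS]mulrA; congr (_ * (_ * _)).
rewrite -!big_split; apply: eq_bigr => r _ /=.
have shift a : th a * pch (a * q) (k r) = pch a (k r) * th (a * q ^+ k r).
  by rewrite -poch_recl poch_recr.
rewrite [LHS]mulrC !mulf_div /z.
have -> : g * q * x r / E = g * x r / E * q by ring.
have -> : g * q * x r = g * x r * q by ring.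
rewrite !shift; congr (_ * th _ / (_ * th _)); ring.
Qed.

(** The weight cancels the factors that the increment at i has introduced at
    the points q x_i q^(k_i).  What is left depends on i like the terms of a
    second partial fraction identity, with poles x_i q^(k_i) and 1 / g and with
    zeros x_s / e_s and E q^m / g; the pole 1 / g yields the right-hand side. *)
Lemma jacksonA_step g k : g != 0 -> let m := (\sum_s k s)%N in
  th (q ^+ m.+1) != 0 -> (forall s, th (g * x s) != 0) ->
  (forall s, th (g * x s / E) != 0) ->
  (forall i j, i != j -> th (z k i / z k j) != 0) ->
  (forall i j, i != j -> th (q * z k i / z k j) != 0) ->
  (forall i j, th (q * z k i / x j) != 0) ->
  (forall i, th (g * (q * z k i) / E) != 0) ->
  (forall i, th (g * z k i) != 0) ->
  \sum_i jacksonA_term g (incr i k) * pf_weight g m.+1 (incr i k) i =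
  jacksonA_term (g * q) k
   * (q * th (E * q ^+ m) / th (q ^+ m.+1) * \prod_s (th (g * x s / e s) / th (g * x s))).
Proof.
move=> g0 m tq tg tgx zz qzz qzx tqz tgz.
have E0 := prod_e_neq0; have z0 := pole_neq0 k.
have qm0 : q ^+ m != 0 by rewrite expf_neq0.
have qm1 : q ^+ m.+1 != 0 by rewrite expf_neq0.
have t0 : E / g != 0 by rewrite mulf_neq0 ?invr_eq0.
have tqV : th (q ^- m.+1) = - (th (q ^+ m.+1) / q ^+ m.+1) by rewrite thL.(thV).
have tqV0 : th (q ^- m.+1) != 0.
  by rewrite tqV oppr_eq0 mulf_neq0 ?invr_eq0.
have Eg a : a / (E / g) = g * a / E by field; rewrite E0 g0.
have tgx' s : th (E / g / x s) != 0.
  by apply: th_swap_neq0; rewrite // Eg.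
have px : \prod_s th (E / g / x s) != 0 by apply/prodf_neq0.
pose B := - (\prod_s th (E / g / z k s)) / (th (q ^- m.+1) * \prod_s th (E / g / x s)).
pose W := E / g * q ^+ m :: [seq x s / e s | s <- index_enum 'I_n].
have prodW (F : K -> K) :
    \prod_(w <- W) F w = F (E / g * q ^+ m) * \prod_s F (x s / e s).
  by rewrite big_cons big_map_ord.
have pointwise i : jacksonA_term g (incr i k) * pf_weight g m.+1 (incr i k) i
  = jacksonA_term g k * B * (\prod_(w <- W) th (z k i / w)
     / ((\prod_(s | s != i) th (z k i / z k s)) * th (z k i / g^-1))).
  rewrite jacksonA_term_incr => [|s si]; last by rewrite zz // eq_sym.
  rewrite /pf_weight pole_incr eqxx prodW /B.
  rewrite (bigD1 (P := xpredT) (F := fun s => th (E / g / z (incr i k) s)) i) //=.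
  rewrite (bigD1 (P := xpredT) (F := fun s => th (E / g / z k s)) i) //=.
  rewrite pole_incr eqxx.
  have -> : \prod_(s | s != i) th (q * z k i / z (incr i k) s)
         = \prod_(s | s != i) th (q * z k i / z k s).
    by apply: eq_bigr => s /negbTE si; rewrite pole_incr si.
  have -> : \prod_(s | s != i) th (E / g / z (incr i k) s)
         = \prod_(s | s != i) th (E / g / z k s).
    by apply: eq_bigr => s /negbTE si; rewrite pole_incr si.
  have -> : \prod_s th (z k i / (x s / e s)) = \prod_s th (e s * z k i / x s).
    by apply: eq_bigr => s _; congr th; field; rewrite x0 e0.
  have -> : q * z k i / (E / g * q ^+ m.+1) = z k i / (E / g * q ^+ m).
    by rewrite exprS; field; rewrite q0 qm0 E0 g0.
  rewrite !big_split /= !prodfV invrK (mulrC (z k i) g).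
  have -> : th (E / g / (q * z k i)) = - (E / g / (q * z k i)) * th (g * (q * z k i) / E).
    by rewrite -Eg; apply: th_swap; last by rewrite mulf_neq0.
  have -> : th (g * z k i / E) = - (z k i / (E / g)) * th (E / g / z k i).
    by rewrite -Eg; apply: th_swap.
  rewrite !Eg.
  have pz : \prod_(s | s != i) th (z k i / z k s) != 0.
    by apply/prodf_neq0 => s si; rewrite zz // eq_sym.
  have pqz : \prod_(s | s != i) th (q * z k i / z k s) != 0.
    by apply/prodf_neq0 => s si; rewrite qzz // eq_sym.
  have pqx : \prod_s th (q * z k i / x s) != 0 by apply/prodf_neq0.
  move: pz pqz pqx (tqz i) (tgz i) (z0 i) px tqV0.
  move: (\prod_(s | s != i) th (z k i / z k s)) => V.
  move: (\prod_(s | s != i) th (q * z k i / z k s)) => U.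
  move: (\prod_s th (q * z k i / x s)) => X.
  move: (th (g * (q * z k i) / E)) (th (g * z k i)) => f b.
  move: (\prod_s th (E / g / x s)) (th (q ^- m.+1)) (z k i) => Tx D y V0 U0 X0 f0 b0
    y0 Tx0 D0.
  by field; rewrite V0 U0 X0 f0 b0 y0 Tx0 D0 q0 g0 E0.
rewrite (eq_bigr _ (fun i _ => pointwise i)) -mulr_sumr.
have W0 : {in W, forall w, w != 0}.
  move=> w; rewrite inE => /orP[/eqP ->|/mapP[s _ ->]].
    by rewrite mulf_neq0 ?expf_neq0.
  by rewrite mulf_neq0 ?invr_eq0.
have sW : size W = n.+1 by rewrite /= size_map_ord.
have gV : g^-1 != 0 by rewrite invr_eq0.
have zg i : th (z k i / g^-1) != 0 by rewrite invrK mulrC.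
have zW : \prod_s z k s * g^-1 = \prod_(w <- W) w.
  by rewrite prodW prod_pole -/m big_split /= prodfV -/E; field; rewrite E0 g0.
rewrite (partial_fractions_extra_pole thL sW z0 gV W0 zz zg zW) prodW.
have gx0 : \prod_s (th (g * x s / E) / th (g * x s)) != 0.
  by apply/prodf_neq0 => s _; rewrite mulf_neq0 ?invr_eq0.
apply: (mulIf gx0); rewrite [RHS]mulrAC jacksonA_term_shift -!(mulrA (jacksonA_term _ _)).
congr (_ * _); rewrite /B.
have -> : th (g^-1 / (E / g * q ^+ m)) = - (th (E * q ^+ m) / (E * q ^+ m)).
  by rewrite -thL.(thV) ?mulf_neq0 //; congr th; field; rewrite E0 g0 qm0.
rewrite tqV exprS.
have swaps : \prod_s th (E / g / z k s) * \prod_s th (g^-1 / (x s / e s))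
    * (\prod_s th (g * x s / E) * \prod_s th (g * z k s))
  = E * (\prod_s th (g * z k s / E) * \prod_s th (g * x s / e s))
    * (\prod_s th (g^-1 / z k s) * \prod_s th (E / g / x s)).
  rewrite /E -!big_split; apply: eq_bigr => s _ /=; rewrite -/E.
  have sw a b : a != 0 -> b != 0 -> th (a / b) = - (a / b) * th (b / a).
    exact: th_swap.
  rewrite (sw (E / g) (z k s)) // (sw g^-1 (x s / e s)) ?mulf_neq0 ?invr_eq0 //.
  rewrite (sw g^-1 (z k s)) // (sw (E / g) (x s)) // !Eg invrK.
  rewrite (mulrC (x s / e s) g) (mulrC (z k s) g) (mulrA g (x s) (e s)^-1).
  by field; rewrite ?E0 ?g0 ?z0 ?x0 ?e0.
have nz (F : 'I_n -> K) : (forall s, F s != 0) -> \prod_s F s != 0.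
  by move=> h; apply/prodf_neq0.
have gz0 := nz _ tgz; have gz1 := nz _ tg.
have gVz0 : \prod_s th (g^-1 / z k s) != 0.
  by apply: nz => s; apply: th_swap_neq0; rewrite ?z0 // invrK mulrC.
have {}gx0 := nz _ tgx.
rewrite !big_split /= !prodfV.
set a := \prod_s th (E / g / z k s) in swaps *.
set b := \prod_s th (g^-1 / (x s / e s)) in swaps *.
set c := \prod_s th (g * z k s / E) in swaps *.
set d := \prod_s th (g * x s / e s) in swaps *.
move: swaps gz0 gz1 gVz0 gx0 px tq qm0.
rewrite exprS.
move: (\prod_s th (g * x s / E)) (\prod_s th (g * z k s)) (\prod_s th (g * x s))
  (\prod_s th (g^-1 / z k s)) (\prod_s th (E / g / x s)) (th (q * q ^+ m))
  (th (E * q ^+ m)) => u v w r y Tq TE.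
move: (q ^+ m) => Q sw v0 w0 r0 u0 y0 Tq0 Q0.
transitivity ((a * b * (u * v)) / (E * v * w * r * y * Tq) * q * TE).
  by field; rewrite oppr_eq0 E0 v0 w0 r0 y0 Tq0 q0 Q0.
by rewrite sw; field; rewrite E0 v0 w0 r0 y0 Tq0.
Qed.

Lemma vdm0 : (forall i j, i != j -> th (x i / x j) != 0) -> vdm (fun=> 0%N) = 1.
Proof.
move=> xx; rewrite vdmE big1 // => r _; rewrite big1 // => s rs.
by rewrite /z !expr0 !mulr1 divff // xx // -val_eqE neq_ltn /= rs.
Qed.

(** A quotient of two points is q^j x_i / x_j with j at most m, after an inversion
    if needed. *)
Lemma th_pole_neq0 m k : (\sum_s k s <= m)%N ->
  (forall r s j, r != s -> (j <= m)%N -> th (q ^+ j * x r / x s) != 0) ->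
  forall i j, i != j -> th (z k i / z k j) != 0.
Proof.
move=> km hx i j ij.
have kle r : (k r <= m)%N.
  by apply: leq_trans km; rewrite (bigD1 r) //= leq_addr.
wlog lt : i j ij / (k j <= k i)%N => [H|].
  case: (leqP (k j) (k i)) => [|/ltnW] h; first exact: H.
  by apply: th_swap_neq0; rewrite ?pole_neq0 // H // eq_sym.
rewrite (_ : z k i / z k j = q ^+ (k i - k j) * x i / x j).
  by apply: hx => //; apply: leq_trans (leq_subr _ _) (kle i).
by rewrite /z -{1}(subnK lt) exprD; field; rewrite x0 expf_neq0.
Qed.

(** Tuples of weight m + 1 with a positive entry at i are the increments of the
    tuples of weight m. *)
Lemma sum_incr (N m : nat) (F : ('I_n -> nat) -> K) i : (m < N)%N ->
  (forall k k', k =1 k' -> F k = F k') -> (forall k, k i = 0%N -> F k = 0) ->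
  \sum_(k : {ffun 'I_n -> 'I_N.+1} | (\sum_s k s == m.+1)%N) F (fun s => k s)
  = \sum_(k : {ffun 'I_n -> 'I_N.+1} | (\sum_s k s == m)%N) F (incr i (fun s => k s)).
Proof.
move=> mN Fe F0.
rewrite (bigID (fun k : {ffun 'I_n -> 'I_N.+1} => (0 < k i)%N)) /= addrC big1 ?add0r;
  last first.
  by move=> k /andP[_]; rewrite lt0n negbK => /eqP; apply: F0.
have kle m' (k : {ffun 'I_n -> 'I_N.+1}) r : (\sum_s k s == m')%N -> (k r <= m')%N.
  by move/eqP <-; rewrite (bigD1 r) //= leq_addr.
pose up (k : {ffun 'I_n -> 'I_N.+1}) : {ffun 'I_n -> 'I_N.+1} :=
  [ffun s => inord (incr i (fun s => k s) s)].
pose dn (k : {ffun 'I_n -> 'I_N.+1}) : {ffun 'I_n -> 'I_N.+1} :=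
  [ffun s => inord (k s - (s == i))%N].
have dnE (k : {ffun 'I_n -> 'I_N.+1}) s : dn k s = (k s - (s == i))%N :> nat.
  by rewrite ffunE inordK // ltnS (leq_trans (leq_subr _ _)) // -ltnS.
have upE (k : {ffun 'I_n -> 'I_N.+1}) s : (\sum_s k s == m)%N ->
    up k s = incr i (fun s => k s) s :> nat.
  move=> km; rewrite ffunE inordK // /incr ltnS.
  by rewrite (leq_trans (leq_add (kle _ _ s km) (leq_b1 _))) // addn1.
have incr_sum (k : 'I_n -> nat) : (\sum_s incr i k s = (\sum_s k s).+1)%N.
  rewrite big_split /= -addn1; congr (_ + _)%N.
  by rewrite (bigD1 i) //= eqxx big1 // => s /negbTE ->.
have incr_dn (k : {ffun 'I_n -> 'I_N.+1}) : (0 < k i)%N ->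
    incr i (fun s => dn k s) =1 (fun s => k s).
  move=> ki s; rewrite /incr dnE; case: eqP => [->|_]; last by rewrite subn0 addn0.
  by rewrite subn1 addn1 prednK.
rewrite [RHS](reindex_onto dn up) /=; last first.
  move=> k km; apply/ffunP => s; apply/ord_inj; rewrite dnE.
  by rewrite upE // /incr addnK.
apply: eq_big => [k|k /andP[km ki]]; last by apply: Fe => s; rewrite incr_dn.
apply/andP/andP => [[km ki]|[km /eqP dk]].
  have dm : (\sum_s dn k s == m)%N.
    by rewrite -eqSS -incr_sum (eq_bigr _ (fun s _ => incr_dn k ki s)).
  split=> //; apply/eqP/ffunP => s; apply/ord_inj.
  by rewrite upE // incr_dn.
have ke s : k s = incr i (fun s => dn k s) s :> nat by rewrite -upE // dk.
split; last by rewrite ke /incr eqxx addn1.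
by rewrite (eq_bigr _ (fun s _ => ke s)) incr_sum.
Qed.

Lemma eq_jacksonA_term g k k' : k =1 k' -> jacksonA_term g k = jacksonA_term g k'.
Proof.
move=> kk; rewrite /jacksonA_term /vdm; congr (_ * _ * _ * _ ^+ _).
- by apply: eq_bigr => r _; apply: eq_bigr => s _; rewrite !kk.
- by apply: eq_bigr => r _; apply: eq_bigr => s _; rewrite !kk.
- by apply: eq_bigr => r _; rewrite !kk.
- by apply: eq_bigr => r _; rewrite !kk.
Qed.

Lemma eq_pf_weight g m k k' i : k =1 k' -> pf_weight g m k i = pf_weight g m k' i.
Proof.
move=> kk; have zk r : z k r = z k' r by rewrite /z kk.
rewrite /pf_weight zk; congr (- (_ * _ / (_ * _) * _ / _)).
  by apply: eq_bigr => r _; rewrite zk.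
by apply: eq_bigr => r _; rewrite zk.
Qed.

Lemma pf_weight0 g m k i : k i = 0%N -> pf_weight g m k i = 0.
Proof.
move=> ki; rewrite /pf_weight [\prod_s th (z k i / x s)](bigD1 i) //=.
by rewrite /z ki expr0 mulr1 divff // thL.(th1) mul0r mulr0 !mul0r oppr0.
Qed.

(** Rosengren's A_n Jackson summation.  Every term is multiplied by the sum of
    its weights, which is 1; the terms are then regrouped by the tuple they are
    an increment of, and [jacksonA_step] leads to the sum of weight m with g q
    in place of g. *)
Lemma jacksonA_sum_generic (N m : nat) (g : K) : (m <= N)%N -> g != 0 ->
  (forall j, (0 < j <= m)%N -> th (q ^+ j) != 0) ->
  (forall r s j, r != s -> (j <= m)%N -> th (q ^+ j * x r / x s) != 0) ->
  (forall r j, (j < m)%N -> th (g * x r * q ^+ j) != 0) ->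
  (forall r j, (j <= m)%N -> th (g * x r / E * q ^+ j) != 0) ->
  \sum_(k : {ffun 'I_n -> 'I_N.+1} | (\sum_s k s == m)%N) jacksonA_term g (fun s => k s)
  = q ^+ m * (pch E m / pch q m) * \prod_r (pch (g * x r / e r) m / pch (g * x r) m).
Proof.
elim: m g => [|m IH] g mN g0 hq hx hg hgE.
  rewrite (big_pred1 [ffun=> ord0]); last first.
    move=> k; rewrite sum_nat_eq0; apply/forallP/eqP => [h|-> i]; last by rewrite ffunE.
    by apply/ffunP => i; rewrite ffunE; apply/val_inj/eqP/h.
  rewrite (@eq_jacksonA_term _ _ (fun=> 0%N)) => [|s]; last by rewrite ffunE.
  rewrite /jacksonA_term vdm0 => [|i j ij]; last first.
    by have := hx i j 0%N ij isT; rewrite expr0 mul1r.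
  rewrite !big1 ?poch0 ?divr1 ?expr0 ?mulr1 // => r _; rewrite ?muln0 ?poch0 ?divr1 //.
  by rewrite big1 // => s _; rewrite !poch0 divr1.
have E0 := prod_e_neq0.
have Eg a : a / (E / g) = g * a / E by field; rewrite E0 g0.
have kle m' (k : 'I_n -> nat) r : (\sum_s k s)%N = m' -> (k r <= m')%N.
  by move=> <-; rewrite (bigD1 r) //= leq_addr.
have q1 : th (q ^+ m.+1) != 0 by rewrite hq ?leqnn.
have hgz (k : 'I_n -> nat) r : (k r <= m.+1)%N -> th (g * z k r / E) != 0.
  by move=> /(hgE r); rewrite /z mulrA mulrAC.
have hgx r : th (g * x r / E) != 0 by have := hgE r 0%N isT; rewrite expr0 mulr1.
have hgEx s : th (E / g / x s) != 0.
  by apply: th_swap_neq0; rewrite ?Eg ?mulf_neq0 ?invr_eq0.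
transitivity (\sum_i \sum_(k : {ffun 'I_n -> 'I_N.+1} | (\sum_s k s == m)%N)
   jacksonA_term g (incr i (fun s => k s)) * pf_weight g m.+1 (incr i (fun s => k s)) i).
  transitivity (\sum_i \sum_(k : {ffun 'I_n -> 'I_N.+1} | (\sum_s k s == m.+1)%N)
     jacksonA_term g (fun s => k s) * pf_weight g m.+1 (fun s => k s) i).
    rewrite exchange_big; apply: eq_bigr => k /eqP km /=.
    rewrite -mulr_sumr -[in X in _ = _ * X]km sum_pf_weight ?mulr1 //.
    - by rewrite km thL.(thV) ?expf_neq0 // oppr_eq0 mulf_neq0 ?invr_eq0 ?expf_neq0.
    - by apply: (th_pole_neq0 (m := m.+1)) => //; rewrite km.
    - by move=> i; rewrite Eg; apply: hgz; exact: kle _ (fun s => k s) i km.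
  apply: eq_bigr => i _.
  apply: (@sum_incr N m (fun k => jacksonA_term g k * pf_weight g m.+1 k i)) => //.
    by move=> k k' kk; rewrite (eq_jacksonA_term g kk) (eq_pf_weight g m.+1 i kk).
  by move=> k ki; rewrite pf_weight0 ?mulr0.
rewrite exchange_big /=.
transitivity (\sum_(k : {ffun 'I_n -> 'I_N.+1} | (\sum_s k s == m)%N)
  jacksonA_term (g * q) (fun s => k s) *
  (q * th (E * q ^+ m) / th (q ^+ m.+1) * \prod_s (th (g * x s / e s) / th (g * x s)))).
  apply: eq_bigr => k /eqP km.
  have km1 i : (\sum_s incr i (fun s => k s) s)%N = m.+1.
    rewrite big_split /= km -addn1; congr (_ + _)%N.
    by rewrite (bigD1 i) //= eqxx big1 // => s /negbTE ->.
  have zi i s : s != i -> z (incr i (fun s => k s)) s = z (fun s => k s) s.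
    by move=> /negbTE si; rewrite pole_incr si.
  have zii i : z (incr i (fun s => k s)) i = q * z (fun s => k s) i.
    by rewrite pole_incr eqxx.
  have := @jacksonA_step g (fun s => k s) g0; rewrite /= km; apply=> //.
  - by move=> s; have := hg s 0%N isT; rewrite expr0 mulr1.
  - by apply: (th_pole_neq0 (m := m.+1)) => //; rewrite km.
  - move=> i j ij; rewrite -zii -(zi i j) 1?[j == _]eq_sym //.
    by apply: (th_pole_neq0 (m := m.+1)) => //; rewrite km1.
  - move=> i j; rewrite -zii /z.
    have := kle _ _ i (km1 i); case: (eqVneq i j) => [<-|ij] ki.
      rewrite mulrC mulKf // hq // ki andbT.
      by rewrite /incr eqxx addn1.
    by have := hx i j _ ij ki; rewrite (mulrC (q ^+ _)).
  - by move=> i; rewrite -zii; apply: hgz; exact: kle (km1 i).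
  - by move=> i; rewrite /z mulrA; apply: hg; rewrite ltnS;
    exact: kle _ (fun s => k s) i km.
rewrite -mulr_suml IH ?mulf_neq0 //; first last.
- by move=> r j jm; have := hgE r j.+1 jm; rewrite exprS; congr (th _ != 0); ring.
- by move=> r j jm; have := hg r j.+1 jm; rewrite exprS; congr (th _ != 0); ring.
- by move=> r s j rs jm; apply: hx => //; apply: leqW.
- by move=> j /andP[j0 jm]; apply: hq; rewrite j0 leqW.
- exact: ltnW.
rewrite exprS !poch_recr.
have -> : \prod_r (pch (g * x r / e r) m.+1 / pch (g * x r) m.+1) =
   \prod_r (pch (g * q * x r / e r) m / pch (g * q * x r) m)
   * \prod_r (th (g * x r / e r) / th (g * x r)).
  rewrite -big_split; apply: eq_bigr => r _ /=; rewrite !poch_recl mulf_div.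
  by rewrite ![pch _ _ * th _]mulrC; congr (_ * pch _ _ / (_ * pch _ _)); ring.
rewrite invfM; ring.
Qed.

End JacksonA.

(** * The Frenkel-Turaev summation *)

Section FrenkelTuraev.
Variables (K : fieldType) (th : K -> K) (q : K).
Hypothesis thL : theta_like th.
Hypothesis q0 : q != 0.
Local Notation pch := (poch th q).

(** The very-well-poised summand is split into the part [wp_base], independent of
    the length of the series, and the part [ft_factor].  For v = q^(n+1) the
    latter is
      (a q^(n+1) / s, q^-n; q)_k / (s q^-n, a q^(n+1); q)_k,
    which vanishes for k > n. *)
Definition wp_base (a b c d : K) (k : nat) : K :=
  th (a * q ^+ (2 * k)) / th a * (pch a k * pch b k * pch c k * pch d k)
  / (pch q k * pch (a * q / b) k * pch (a * q / c) k * pch (a * q / d) k) * q ^+ k.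

Definition ft_factor (a s v : K) (k : nat) : K :=
  pch (a * v / s) k * pch (q / v) k / (pch (s * q / v) k * pch (a * v) k).

(** The three-term relation for the points q^(k+1), 1, v and v / s, with
    P = 1 / a.  The factors th (q^(k+1)) and th (a q^(k+1)) on the right are those
    that [wp_base_shift] absorbs. *)
Lemma ft_factor_diff a s v k : a != 0 -> s != 0 -> v != 0 ->
  pch (s / v) k.+2 != 0 -> pch (a * v) k.+2 != 0 ->
  ft_factor a s (v * q) k.+1 - ft_factor a s v k.+1 =
  - (th (q ^+ k.+1) * th (a * q ^+ k.+1) * th s * th (a * v ^+ 2 / s))
  / (v * th (s / v) * th (s * q / v) * th (a * v) * th (a * v * q))
  * ft_factor (a * q ^+ 2) (s * q) v k.
Proof.
move=> a0 s0 v0; rewrite /ft_factor.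
set Q := q ^+ k.+1; have Q0 : Q != 0 by rewrite expf_neq0.
have -> : q / (v * q) = v^-1 by field; rewrite q0 v0.
have -> : s * q / (v * q) = s / v by field; rewrite q0 v0.
have -> : a * q ^+ 2 * v / (s * q) = a * v / s * q by field; rewrite s0 q0.
have -> : a * q ^+ 2 * v = a * v * q * q by ring.
have -> : s * q * q / v = s * q / v * q by ring.
have -> : a * (v * q) / s = a * v / s * q by ring.
have -> : a * (v * q) = a * v * q by ring.
have svq : s / v * q = s * q / v by ring.
have QE : Q = q * q ^+ k by rewrite /Q exprS.
rewrite [pch (s / v) k.+2]poch_recl svq [pch (s * q / v) k.+1]poch_recr.
rewrite [pch (a * v) k.+2]poch_recl [pch (a * v * q) k.+1]poch_recr.
have -> : s * q / v * q ^+ k = s / v * Q by rewrite QE; ring.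
have -> : a * v * q * q ^+ k = a * v * Q by rewrite QE; ring.
rewrite !mulf_eq0 !negb_or => /andP[sv0 /andP[svk svQ]] /andP[av0 /andP[avk avQ]].
have svD : pch (s * q / v) k * th (s / v * Q) = th (s * q / v) * pch (s * q / v * q) k.
  by rewrite -poch_recl poch_recr QE; congr (_ * th _); ring.
have avD : pch (a * v * q) k * th (a * v * Q) = th (a * v * q) * pch (a * v * q * q) k.
  by rewrite -poch_recl poch_recr QE; congr (_ * th _); ring.
have : pch (s * q / v) k * th (s / v * Q) != 0 by rewrite mulf_neq0.
have : pch (a * v * q) k * th (a * v * Q) != 0 by rewrite mulf_neq0.
rewrite svD avD !mulf_eq0 !negb_or => /andP[avq0 avD0] /andP[svq0 svD0].
rewrite [pch (a * v / s * q) k.+1]poch_recr [pch v^-1 k.+1]poch_recl.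
rewrite [pch (a * v / s) k.+1]poch_recl [pch (q / v) k.+1]poch_recr.
rewrite [pch (s / v) k.+1]poch_recl svq.
rewrite [pch (a * v) k.+1]poch_recl.
have -> : a * v / s * q * q ^+ k = a * v * Q / s by rewrite QE; ring.
have -> : q / v * q ^+ k = Q / v by rewrite QE; ring.
rewrite [v^-1 * q]mulrC.
have -> : pch (s * q / v) k = th (s * q / v) * pch (s * q / v * q) k / th (s / v * Q).
  by rewrite -svD mulfK.
have -> : pch (a * v * q) k = th (a * v * q) * pch (a * v * q * q) k / th (a * v * Q).
  by rewrite -avD mulfK.
have Va : a^-1 != 0 by rewrite invr_eq0.
have vs0 : v / s != 0 by rewrite mulf_neq0 ?invr_eq0.
have W := thL.(th_weierstrass) Va Q0 (oner_neq0 _) v0 vs0.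
move: W; rewrite !divr1 !mulr1 !invrK.
have -> : v / (v / s) = s by field; rewrite v0 s0.
have -> : v * (v / s) * a = a * v ^+ 2 / s by ring.
have -> : v * a = a * v by ring.
have -> : Q / (v / s) = s / v * Q by field; rewrite v0 s0.
have -> : Q * (v / s) * a = a * v * Q / s by ring.
have -> : v / s * a = a * v / s by ring.
have -> : Q * v * a = a * v * Q by ring.
have -> : Q * a = a * Q by ring.
rewrite (th_swap thL v0 s0) [th v^-1]thL.(thV) //.
move: sv0 svQ av0 avQ avq0 avD0 svq0 svD0.
move: (th (s / v)) (th (s / v * Q)) (th (a * v)) (th (a * v * Q)) (th (a * v * q))
 (pch (a * v * q * q) k) (th (s * q / v)) (pch (s * q / v * q) k)
 (pch (a * v / s * q) k) (pch (q / v) k) (th (a * v * Q / s)) (th (a * v / s))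
 (th (Q / v)) (th v) (th s) (th (a * v ^+ 2 / s)) (th Q) (th (a * Q)).
move=> X1 X2 X3 X4 X5 X6 X7 X8 Y1 Y2 Y3 Y4 Y5 Y6 Y7 Y8 Y9 Y10 h1 h2 h3 h4 h5 h6 h7 h8 W.
transitivity (- (Y6 * X3 * (X2 * Y3) - s * (- (v / s) * X1 * Y4 * (Y5 * X4))) *
   (Y1 * Y2 / (v * X1 * X3 * X5 * X6 * X7 * X8))).
  by field; rewrite h1 h2 h3 h4 h5 h6 h7 h8 v0 s0.
by rewrite -W; field; rewrite h1 h3 h5 h6 h7 h8 v0.
Qed.

Lemma wp_base_shift a b c d k : th a != 0 -> th (a * q ^+ 2) != 0 ->
  b != 0 -> c != 0 -> d != 0 -> pch q k.+1 != 0 ->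
  pch (a * q / b) k.+1 != 0 -> pch (a * q / c) k.+1 != 0 ->
  pch (a * q / d) k.+1 != 0 ->
  wp_base a b c d k.+1 * (th (q ^+ k.+1) * th (a * q ^+ k.+1)) =
  q * th (a * q) * th (a * q ^+ 2) * (th b * th c * th d)
  / (th (a * q / b) * th (a * q / c) * th (a * q / d))
  * wp_base (a * q ^+ 2) (b * q) (c * q) (d * q) k.
Proof.
move=> ta ta2 b0 c0 d0; rewrite /wp_base.
have sh x : x != 0 -> a * q ^+ 2 * q / (x * q) = a * q / x * q.
  by move=> x0; field; rewrite x0 q0.
rewrite !sh //.
have -> : a * q ^+ 2 * q ^+ (2 * k) = a * q ^+ (2 * k.+1).
  by rewrite -mulrA -exprD; congr (_ * _ ^+ _); lia.
have pa : pch a k.+1 * th (a * q ^+ k.+1) = th a * (th (a * q) * pch (a * q ^+ 2) k).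
  by rewrite -poch_recr !poch_recl; congr (_ * (_ * poch _ _ _ _)); ring.
have -> : pch q k.+1 = pch q k * th (q ^+ k.+1) by rewrite poch_recr -exprS.
rewrite ![pch (a * q / _) k.+1]poch_recl [pch b k.+1]poch_recl
  [pch c k.+1]poch_recl [pch d k.+1]poch_recl.
rewrite !mulf_eq0 !negb_or => /andP[q1 q2] /andP[b1 b2] /andP[c1 c2] /andP[d1 d2].
move: pa q1 q2 b1 b2 c1 c2 d1 d2 ta ta2.
move: (pch a k.+1) (th (a * q ^+ k.+1)) (pch (a * q ^+ 2) k) (th (q ^+ k.+1))
  (pch q k) (th (a * q / b)) (pch (a * q / b * q) k) (th (a * q / c))
  (pch (a * q / c * q) k) (th (a * q / d)) (pch (a * q / d * q) k)
  (pch (b * q) k) (pch (c * q) k) (pch (d * q) k) (th b) (th c) (th d)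
  (th (a * q ^+ (2 * k.+1))).
move: (th a) (th (a * q ^+ 2)) (th (a * q)) => A1 A2 A3.
move=> X1 X2 X3 X4 X5 X6 X7 X8 X9 Y1 Y2 Y3 Y4 Y5 Y6 Y7 Y8 Y9 pa
  q1 q2 b1 b2 c1 c2 d1 d2 ta ta2; rewrite exprS.
transitivity (X1 * X2 * (Y9 / A1 * (Y6 * Y3 * (Y7 * Y4) * (Y8 * Y5))
   / (X5 * (X6 * X7) * (X8 * X9) * (Y1 * Y2)) * (q * q ^+ k))).
  by field; rewrite q1 q2 b1 b2 c1 c2 d1 d2 ta.
by rewrite pa; field; rewrite q1 b1 b2 c1 c2 d1 d2 ta ta2.
Qed.

(** The three-term relation for the points A, A / b, c d and d, with P = c d. *)
Lemma weierstrass_balanced A b c d s :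
  A != 0 -> b != 0 -> c != 0 -> d != 0 -> s != 0 -> s * A = b * c * d ->
  th A * th (A / (b * c)) * (th (A / (b * d)) * th (A / (c * d))) =
  th (A / b) * th (A / c) * (th (A / d) * th s^-1)
  + (th b * th c * (th d * th (A / s))) / s.
Proof.
move=> A0 b0 c0 d0 s0 sA.
have P0 : c * d != 0 by rewrite mulf_neq0.
have y0 : A / b != 0 by rewrite mulf_neq0 ?invr_eq0.
have := thL.(th_weierstrass) P0 A0 y0 P0 d0.
have -> : A / (A / b) = b by field; rewrite A0 b0.
have sE : s = b * c * d / A by rewrite -sA mulfK.
have -> : A * (A / b) / (c * d) = A / s by rewrite sE; field; rewrite A0 b0 c0 d0.
have -> : c * d / d = c by field.
have -> : c * d * d / (c * d) = d by field; rewrite c0 d0.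
have -> : c * d / (A / b) = s by rewrite sE; field; rewrite A0 b0.
have -> : c * d * (A / b) / (c * d) = A / b by field; rewrite b0 c0 d0.
have -> : A * d / (c * d) = A / c by field; rewrite c0 d0.
have -> : d * (A / b) / (c * d) = A / (b * c) by field; rewrite b0 c0 d0.
have -> : A * (c * d) / (c * d) = A by field; rewrite c0 d0.
have -> : d / (A / b) = (b * d) / A by field; rewrite A0 b0.
rewrite (th_swap thL (mulf_neq0 b0 d0) A0) thL.(thV) //.
move: (th (A / s)) (th (A / (b * d))) (th (A / (b * c))) (th (A / (c * d))) (th s)
  => X1 X2 X3 X4 S W.
rewrite (_ : th b * th c * (th d * X1) = th b * X1 * (th c * th d)); last by ring.
by rewrite W sE; field; rewrite A0 b0 c0 d0.
Qed.

Definition ft_product n a b c d s : K :=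
  pch (a * q) n * pch (a * q / (b * c)) n * pch (a * q / (b * d)) n
  * pch (a * q / (c * d)) n
  / (pch (a * q / b) n * pch (a * q / c) n * pch (a * q / d) n * pch (q / s) n).

(** Induction on n.  The increase of the sum from n to n + 1 is a multiple of the
    sum of length n for the parameters a q^2, b q, c q, d q, by
    [ft_factor_diff] and [wp_base_shift].  The products satisfy the same
    recursion by [weierstrass_balanced]. *)
Theorem frenkel_turaev n a b c d s :
  a != 0 -> b != 0 -> c != 0 -> d != 0 -> s != 0 -> s * a = b * c * d ->
  pch q n != 0 -> (forall i, (i <= 2 * n)%N -> th (a * q ^+ i) != 0) ->
  pch (a * q / b) n != 0 -> pch (a * q / c) n != 0 -> pch (a * q / d) n != 0 ->
  (forall i, (i <= n)%N -> th (s * q ^+ i) != 0) ->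
  (forall i, (i <= n)%N -> th (s / q ^+ i) != 0) ->
  \sum_(0 <= k < n.+1) wp_base a b c d k * ft_factor a s (q ^+ n.+1) k
  = ft_product n a b c d s.
Proof.
elim: n a b c d s => [|n IH] a b c d s a0 b0 c0 d0 s0 sa qn an bn cn dn sn snV.
  rewrite big_nat1 /wp_base /ft_factor /ft_product !poch0 muln0 !expr0 !mulr1 divr1.
  have ta : th a != 0 by rewrite -[a]mulr1 -(expr0 q) an.
  by rewrite divff ?divr1 ?mulr1.
set v := q ^+ n.+1; have v0 : v != 0 by rewrite expf_neq0.
have qv : q ^+ n.+2 = v * q by rewrite exprSr.
rewrite qv.
(* The summand of index n + 1 in the shorter sum vanishes, so both sums may be
   taken over the same range and subtracted term by term. *)
pose F k := wp_base a b c d k * (ft_factor a s (v * q) k - ft_factor a s v k).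
have -> : \sum_(0 <= k < n.+2) wp_base a b c d k * ft_factor a s (v * q) k =
    \sum_(0 <= k < n.+1) wp_base a b c d k * ft_factor a s v k
    + \sum_(0 <= k < n.+1) F k.+1.
  have -> : \sum_(0 <= k < n.+1) wp_base a b c d k * ft_factor a s v k =
            \sum_(0 <= k < n.+2) wp_base a b c d k * ft_factor a s v k.
    rewrite [RHS]big_nat_recr //= {3}/ft_factor [pch (q / v) _]poch_recr.
    have -> : q / v * q ^+ n = 1 by rewrite /v exprS; field; rewrite q0 expf_neq0.
    by rewrite thL.(th1) mulr0 mulr0 mul0r mulr0 addr0.
  have -> : \sum_(0 <= k < n.+1) F k.+1 = \sum_(0 <= k < n.+2) F k.
    rewrite [RHS]big_nat_recl //= /F /ft_factor !poch0 subrr mulr0 add0r //.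
  by rewrite -big_split; apply: eq_bigr => k _ /=; rewrite /F; ring.
have nle x k : (k <= n.+1)%N -> pch x n.+1 != 0 -> pch x k != 0.
  move=> kn /poch_neq0P h; apply/poch_neq0P => j jk.
  by apply: h; apply: leq_trans kn.
have ta : th a != 0 by rewrite -[a]mulr1 -(expr0 q) an.
have ta2 : th (a * q ^+ 2) != 0 by apply: an; rewrite mulnS.
have ta1 : th (a * q) != 0 by rewrite -[q]expr1 an // mulnS.
pose kappa := - (th s * th (a * v ^+ 2 / s))
    / (v * th (s / v) * th (s * q / v) * th (a * v) * th (a * v * q))
  * (q * th (a * q) * th (a * q ^+ 2) * (th b * th c * th d)
  / (th (a * q / b) * th (a * q / c) * th (a * q / d))).
have sv k : (k <= n.+1)%N -> pch (s / v) k.+1 != 0.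
  move=> kn; apply/poch_neq0P => j jk.
  rewrite (_ : s / v * q ^+ j = s / q ^+ (n.+1 - j)); first by apply: snV;
    rewrite leq_subr.
  have jn : (j <= n.+1)%N by apply: leq_trans kn; rewrite -ltnS.
  by rewrite /v -{1}(subnK jn) exprD; field; rewrite !expf_neq0.
have FE k : (k < n.+1)%N -> F k.+1 = kappa *
   (wp_base (a * q ^+ 2) (b * q) (c * q) (d * q) k * ft_factor (a * q ^+ 2) (s * q) v k).
  move=> kn; rewrite /F ft_factor_diff //; first last.
  - apply/poch_neq0P => j jk; rewrite -mulrA -exprD; apply: an; clear -jk kn; lia.
  - exact: sv.
  transitivity (- (th s * th (a * v ^+ 2 / s))
      / (v * th (s / v) * th (s * q / v) * th (a * v) * th (a * v * q))
    * ft_factor (a * q ^+ 2) (s * q) v k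
    * (wp_base a b c d k.+1 * (th (q ^+ k.+1) * th (a * q ^+ k.+1)))).
    by ring.
  rewrite wp_base_shift //; try by apply: nle; rewrite // ltnW.
  by rewrite /kappa; ring.
have -> : \sum_(0 <= k < n.+1) F k.+1 =
   kappa * ft_product n (a * q ^+ 2) (b * q) (c * q) (d * q) (s * q).
  have sh x : x != 0 -> a * q ^+ 2 * q / (x * q) = a * q / x * q.
    by move=> x0; field; rewrite x0 q0.
  have shn x : x != 0 -> pch (a * q / x) n.+1 != 0 ->
      pch (a * q ^+ 2 * q / (x * q)) n != 0.
    by move=> x0; rewrite sh // poch_recl mulf_eq0 negb_or => /andP[].
  rewrite -IH ?mulf_neq0 ?expf_neq0 ?shn //.
  - by rewrite mulr_sumr; apply: eq_big_nat => k /andP[_ kn]; apply: FE.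
  - rewrite (_ : s * q * (a * q ^+ 2) = s * a * q ^+ 3); last by ring.
    by rewrite sa; ring.
  - exact: nle (leqnSn n) qn.
  - by move=> i i2; rewrite -mulrA -exprD; apply: an; clear -i2; lia.
  - by move=> i i2; rewrite -mulrA -exprS; apply: sn.
  - case=> [|i] i2; first by rewrite expr0 divr1 -[q]expr1 sn.
    rewrite (_ : s * q / q ^+ i.+1 = s / q ^+ i); first by apply: snV;
      exact: leqW (ltnW i2).
    by rewrite exprS; field; rewrite q0 expf_neq0.
rewrite IH //; first last.
- by move=> i i2; apply: snV; apply: leqW.
- by move=> i i2; apply: sn; apply: leqW.
- exact: nle (leqnSn n) dn.
- exact: nle (leqnSn n) cn.
- exact: nle (leqnSn n) bn.
- by move=> i i2; apply: an; clear -i2; lia.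
- exact: nle (leqnSn n) qn.
rewrite /ft_product.
have sh x : x != 0 -> a * q ^+ 2 * q / (x * q) = a * q / x * q.
  by move=> x0; field; rewrite x0 q0.
have sh2 x y : x != 0 -> y != 0 -> a * q ^+ 2 * q / (x * q * (y * q)) = a * q / (x * y).
  by move=> x0 y0; field; rewrite x0 y0 q0.
rewrite !sh // !sh2 //.
have -> : q / (s * q) = s^-1 by field; rewrite q0 s0.
(* Every factorial is expressed through its value at n. *)
have recr x : pch (a * q / x) n.+1 = pch (a * q / x) n * th (a * v / x).
  by rewrite poch_recr; congr (_ * th _); rewrite /v exprS; ring.
have arec : th (a * q) * th (a * q ^+ 2) * pch (a * q ^+ 2 * q) n =
            pch (a * q) n * th (a * v) * th (a * v * q).
  have -> : a * v * q = a * q * q ^+ n.+1 by rewrite /v; ring.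
  have -> : a * v = a * q * q ^+ n by rewrite /v exprS; ring.
  rewrite -!poch_recr !poch_recl mulrA.
  by congr (_ * th _ * poch _ _ _ _); ring.
have brec x : th (a * q / x) * pch (a * q / x * q) n = pch (a * q / x) n * th (a * v / x).
  by rewrite -recr poch_recl.
(* The factorials (q / s)_n and (1 / s)_n differ by their end factors, of
   which th (q^n / s) is inverted. *)
have srec : th s^-1 * pch (q / s) n = - pch s^-1 n * (v / (q * s)) * th (s * q / v).
  have := poch_recr th q s^-1 n; rewrite poch_recl.
  have -> : s^-1 * q = q / s by ring.
  have qn0 : q ^+ n != 0 by rewrite expf_neq0.
  have -> : s^-1 * q ^+ n = q ^+ n / s by ring.
  rewrite (th_swap thL) // => ->.
  have -> : s / q ^+ n = s * q / v by rewrite /v exprS; field; rewrite q0 qn0.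
  have -> : q ^+ n / s = v / (q * s) by rewrite /v exprS; field; rewrite q0 s0.
  by ring.
have ar : pch (a * q) n.+1 = pch (a * q) n * th (a * v).
  by rewrite poch_recr /v exprS mulrA.
have s1 : pch (q / s) n.+1 = pch (q / s) n * th (v / s).
  by rewrite poch_recr /v exprS; congr (_ * th _); ring.
have W : th (a * v) * th (a * v / (b * c)) * (th (a * v / (b * d)) * th (a * v / (c * d)))
  = th (a * v / b) * th (a * v / c) * (th (a * v / d) * th (v / s))
  + th b * th c * (th d * th (a * v ^+ 2 / s)) / (s / v).
  have := @weierstrass_balanced (a * v) b c d (s / v).
  rewrite !mulf_neq0 ?invr_eq0 //.
  have -> : a * v / (s / v) = a * v ^+ 2 / s by field; rewrite s0 v0.
  rewrite [(s / v)^-1]invf_div.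
  by apply=> //; rewrite -sa; field.
move: bn cn dn; rewrite ![pch (a * q / _) n.+1]recr ar s1 !mulf_eq0 !negb_or.
move=> /andP[b1 b2] /andP[c1 c2] /andP[d1 d2].
have ts : th s != 0 by rewrite -[s]mulr1 -(expr0 q) sn.
have tsv : th (s / v) != 0 by rewrite snV.
have tvs : th (v / s) != 0 by apply: th_swap_neq0.
have tsqv : th (s * q / v) != 0.
  by rewrite (_ : s * q / v = s / q ^+ n);
    [exact: snV | rewrite /v exprS; field; rewrite q0 expf_neq0].
have tav : th (a * v) != 0 by apply: an; clear; lia.
have tavq : th (a * v * q) != 0 by rewrite -mulrA -exprSr; apply: an; clear; lia.
have Sg : pch (q / s) n != 0.
  apply/poch_neq0P => j jn; rewrite (_ : q / s * q ^+ j = q ^+ j.+1 / s);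
    last by rewrite exprS; ring.
  by apply: th_swap_neq0; rewrite ?expf_neq0 // snV //; exact: leqW jn.
have {}arec : pch (a * q ^+ 2 * q) n =
    pch (a * q) n * th (a * v) * th (a * v * q) / (th (a * q) * th (a * q ^+ 2)).
  by rewrite -arec [RHS]mulrC mulKf // mulf_neq0.
have nz x : x != 0 -> pch (a * q / x) n != 0 -> th (a * v / x) != 0 ->
    th (a * q / x) != 0 /\ pch (a * q / x * q) n = pch (a * q / x) n * th (a * v / x)
      / th (a * q / x).
  move=> x0 h1 h2; have : th (a * q / x)
    * pch (a * q / x * q) n != 0 by rewrite brec mulf_neq0.
  by rewrite mulf_eq0 negb_or => /andP[h3 h4]; split=> //; rewrite -brec [RHS]mulrC mulKf.
have [b3 ->] := nz _ b0 b1 b2.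
have [c3 ->] := nz _ c0 c1 c2.
have [d3 ->] := nz _ d0 d1 d2.
have -> : pch s^-1 n = th s * pch (q / s) n * q / (v * th (s * q / v)).
  apply: (mulfI (x := - (v / (q * s)) * th (s * q / v))).
    by rewrite mulf_neq0 // oppr_eq0 !mulf_neq0 ?invr_eq0 ?mulf_neq0.
  transitivity (- pch s^-1 n * (v / (q * s)) * th (s * q / v)); first by ring.
  by rewrite -srec thL.(thV) //; field; rewrite q0 s0 v0 tsqv.
rewrite arec /kappa.
have svv : th (s / v) = - (s / v) * th (v / s) by apply: th_swap.
rewrite svv.
move: W b1 b2 b3 c1 c2 c3 d1 d2 d3 ta ta1 ta2 ts tvs tsqv tav tavq Sg.
move: (th (a * v / b)) (th (a * v / c)) (th (a * v / d)) (th (a * v / (b * c)))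
  (th (a * v / (b * d))) (th (a * v / (c * d))) (th (a * v ^+ 2 / s)) (th (v / s))
  (th (a * q / b)) (th (a * q / c)) (th (a * q / d)) (pch (a * q / b) n)
  (pch (a * q / c) n) (pch (a * q / d) n) (pch (a * q / (b * c)) n)
  (pch (a * q / (b * d)) n) (pch (a * q / (c * d)) n) (pch (q / s) n)
  (pch (a * q) n) (th (s * q / v)) (th (a * v * q)) (th (a * v))
  (th (a * q ^+ 2)) (th (a * q)).
move: (th a) (th b) (th c) (th d) (th s) => ta tb tc td ts.
move=> X1 X2 X3 X4 X5 X6 X7 X8 Y1 Y2 Y3 Y4 Y5 Y6 Y7 Y8 Y9 Z1 Z2 Z3 Z4 Z5 Z6 Z7 W.
move=> b1 b2 b3 c1 c2 c3 d1 d2 d3 h1 h2 h3 h4 h5 h6 h7 h8 h9.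
pose C := Z2 * Y7 * Y8 * Y9 / (Y4 * Y5 * Y6 * Z1).
transitivity (C * (X1 * X2 * (X3 * X8) + tb * tc * (td * X7) / (s / v))
  / (X1 * X2 * X3 * X8)); last first.
  rewrite -W /C. by field; rewrite ?oppr_eq0 ?b1 ?b2 ?b3 ?c1 ?c2 ?c3 ?d1 ?d2 ?d3 ?h1
    ?h2 ?h3 ?h4 ?h5 ?h6 ?h7 ?h8 ?h9 ?s0 ?v0 ?q0.
rewrite mulrDr mulrDl; congr (_ + _).
  rewrite /C. by field; rewrite ?oppr_eq0 ?b1 ?b2 ?b3 ?c1 ?c2 ?c3 ?d1 ?d2 ?d3 ?h1 ?h2
    ?h3 ?h4 ?h5 ?h6 ?h7 ?h8 ?h9 ?s0 ?v0 ?q0.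
rewrite /C.
by field; rewrite ?oppr_eq0 ?b1 ?b2 ?b3 ?c1 ?c2 ?c3 ?d1 ?d2 ?d3 ?h1 ?h2 ?h3 ?h4 ?h5
  ?h6 ?h7 ?h8 ?h9 ?s0 ?v0 ?q0.
Qed.

End FrenkelTuraev.

(** * The elliptic Bailey transformation *)

Section Bailey.
Variables (K : fieldType) (th : K -> K) (q : K).
Hypothesis thL : theta_like th.
Hypothesis q0 : q != 0.
Local Notation pch := (poch th q).

(** The power of -1 and q that appears when a terminating factorial is read
    backwards, see [poch_rev]. *)
Definition rev_factor (n j : nat) : K := \prod_(0 <= i < j) - (q ^+ (n - i))^-1.

Lemma rev_factor_neq0 n j : rev_factor n j != 0.
Proof.
rewrite /rev_factor prodf_seq_neq0; apply/allP => i _.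
by rewrite oppr_eq0 invr_eq0 expf_neq0.
Qed.

Lemma poch_rev c n j : c != 0 -> (j <= n)%N ->
  pch (c / q ^+ n) j * pch (q / c) (n - j) = c ^+ j * rev_factor n j * pch (q / c) n.
Proof.
move=> c0; elim: j => [|j IH] jn.
  by rewrite poch0 subn0 expr0 /rev_factor big_nil !mul1r.
rewrite /rev_factor big_nat_recr //= -/(rev_factor n j).
have <- : pch (c / q ^+ n) j * pch (q / c) (n - j) * (c * - (q ^+ (n - j))^-1) =
   c ^+ j.+1 * (rev_factor n j * - (q ^+ (n - j))^-1) * pch (q / c) n.
  by rewrite IH 1?ltnW // exprS; ring.
have -> : (n - j)%N = (n - j.+1).+1 by rewrite subnSK.
rewrite !poch_recr.
have -> : c / q ^+ n * q ^+ j = c / q ^+ (n - j.+1).+1.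
  have qj : q ^+ j != 0 by rewrite expf_neq0.
  have qk : q ^+ (n - j.+1) != 0 by rewrite expf_neq0.
  rewrite -{1}(subnK jn) exprD !exprS; field; rewrite q0 qj qk //.
have -> : q / c * q ^+ (n - j.+1) = q ^+ (n - j.+1).+1 / c by rewrite exprS; ring.
rewrite [th (c / _)](th_swap thL) ?expf_neq0 //; ring.
Qed.

(** The Frenkel-Turaev sum with base l and parameters l b / a, l c / a, l d / a,
    read from its product side.  The factorials that involve q^-n are reversed,
    after which the coefficients depend on n - j and n + j. *)
Lemma wp_change_of_base n a b c d l :
  a != 0 -> b != 0 -> c != 0 -> d != 0 -> l != 0 ->
  l * (b * c * d) = q * a ^+ 2 ->
  pch q n != 0 -> (forall i, (i <= 2 * n)%N -> th (l * q ^+ i) != 0) ->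
  pch (a * q / b) n != 0 -> pch (a * q / c) n != 0 -> pch (a * q / d) n != 0 ->
  (forall i, (i <= n)%N -> th (l * q / a * q ^+ i) != 0) ->
  (forall i, (i <= n)%N -> th (l * q / a / q ^+ i) != 0) ->
  (pch a n * pch b n * pch c n * pch d n)
   / (pch q n * pch (a * q / b) n * pch (a * q / c) n * pch (a * q / d) n)
  = \sum_(0 <= j < n.+1)
     pch a (n + j) * pch (a / l) (n - j) / (pch q (n - j) * pch (l * q) (n + j))
     * (a / (l * q)) ^+ j * wp_base th q l (l * b / a) (l * c / a) (l * d / a) j.
Proof.
move=> a0 b0 c0 d0 l0 lE qn ln bn cn dn sn snV.
have s0 : l * q / a != 0 by rewrite !mulf_neq0 ?invr_eq0.
have lx x : x != 0 -> l * x / a != 0 by move=> x0; rewrite !mulf_neq0 ?invr_eq0.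
have lq x : x != 0 -> l * q / (l * x / a) = a * q / x.
  by move=> x0; field; rewrite a0 x0 l0.
have sl : l * q / a * l = (l * b / a) * (l * c / a) * (l * d / a).
  transitivity (l ^+ 2 * (l * (b * c * d)) / a ^+ 3); last by field.
  by rewrite lE; field.
have lq2 x y z : x != 0 -> y != 0 -> l * (x * y * z) = q * a ^+ 2 ->
    l * q / ((l * x / a) * (l * y / a)) = z.
  move=> x0 y0 h; transitivity (q * a ^+ 2 / (l * x * y)); first by field;
    rewrite a0 l0 x0 y0.
  by rewrite -h; field; rewrite l0 x0 y0.
have := frenkel_turaev thL q0 l0 (lx _ b0) (lx _ c0) (lx _ d0) s0 sl qn ln.
rewrite !lq // => /(_ bn cn dn sn snV).
rewrite /ft_product !lq //.
rewrite (lq2 b c d) // (lq2 b d c) //; last by rewrite -lE; ring.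
rewrite (lq2 c d b) //; last by rewrite -lE; ring.
have -> : q / (l * q / a) = a / l by field; rewrite a0 l0 q0.
move=> FT.
have an : pch (a / l) n != 0.
  apply/poch_neq0P => j jn; rewrite (_ : a / l * q ^+ j = q ^+ j.+1 / (l * q / a)).
    by apply: th_swap_neq0; rewrite ?expf_neq0 // snV.
  by rewrite exprS; field; rewrite a0 l0 q0.
have lqn k : (k <= 2 * n)%N -> pch (l * q) k != 0.
  move=> kn; apply/poch_neq0P => j jk; rewrite -mulrA -exprS; apply: ln.
  exact: leq_trans kn.
have lqn1 := lqn n (leq_pmull n (ltn0Sn 1)).
have nle x k : (k <= n)%N -> pch x n != 0 -> pch x k != 0.
  move=> kn /poch_neq0P h; apply/poch_neq0P => j jk.
  by apply: h; apply: leq_trans kn.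
transitivity (pch a n * pch (a / l) n / (pch q n * pch (l * q) n)
  * \sum_(0 <= k < n.+1) wp_base th q l (l * b / a) (l * c / a) (l * d / a) k
      * ft_factor th q l (l * q / a) (q ^+ n.+1) k).
  by rewrite FT; field; rewrite qn bn cn dn an lqn1.
rewrite mulr_sumr; apply: eq_big_nat => j /andP[_]; rewrite ltnS => jn.
have qn0 : q ^+ n != 0 by rewrite expf_neq0.
rewrite /ft_factor !pochD.
have -> : l * q ^+ n.+1 / (l * q / a) = a * q ^+ n by rewrite exprS; field;
  rewrite a0 l0 q0.
have -> : q / q ^+ n.+1 = 1 / q ^+ n by rewrite exprS; field; rewrite q0 qn0.
have -> : l * q / a * q / q ^+ n.+1 = l * q / a / q ^+ n by rewrite exprS; field;
  rewrite a0 q0 qn0.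
have -> : l * q ^+ n.+1 = l * q * q ^+ n by rewrite exprS mulrA.
have r1 := poch_rev (oner_neq0 _) jn; have r2 := poch_rev s0 jn.
move: r1 r2; rewrite !divr1 expr1n mul1r.
have -> : q / (l * q / a) = a / l by field; rewrite a0 l0 q0.
have kap := rev_factor_neq0 n j.
have qnj : pch q (n - j) != 0 by apply: nle; rewrite ?leq_subr.
have anj : pch (a / l) (n - j) != 0 by apply: nle; rewrite ?leq_subr.
have lqj : pch (l * q) (n + j) != 0 by apply: lqn; rewrite mul2n -addnn leq_add2l.
move: lqj; rewrite pochD mulf_eq0 negb_or => /andP[_ lqj].
have sj : (l * q / a) ^+ j != 0 by rewrite expf_neq0.
have -> : (a / (l * q)) ^+ j = ((l * q / a) ^+ j)^-1 by rewrite -exprVn invf_div.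
move=> r1 r2.
have -> : pch (1 / q ^+ n) j = rev_factor n j * pch q n / pch q (n - j).
  by rewrite -r1 mulfK.
have -> : pch (l * q / a / q ^+ n) j =
   (l * q / a) ^+ j * rev_factor n j * pch (a / l) n / pch (a / l) (n - j).
  by rewrite -r2 mulfK.
move: ((l * q / a) ^+ j) sj (rev_factor n j) kap => S S0 k k0.
move: qn an anj lqn1 lqj qnj; move: (pch (l * q * q ^+ n) j) (pch q n)
  (pch (a / l) n) (pch (a / l) (n - j)) (pch (l * q) n)
 (pch q (n - j)) => Y1 Y2 Y3 Y4 Y5 Y6 h1 h2 h3 h4 h5 h6.
by field; rewrite h1 h2 h3 h4 h5 h6 S0 k0.
Qed.

Definition bailey_weight (N : nat) (a l E F : K) (k : nat) : K :=
  pch E k * pch F k * pch (l * a * q ^+ N.+1 / (E * F)) k * pch (q ^- N) k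
  / (pch (a * q ^+ N.+1) k * pch (a * q / E) k * pch (a * q / F) k
     * pch (E * F * q ^- N / l) k).

Definition bailey_prefactor (N : nat) (a l E F : K) : K :=
  pch (a * q) N * pch (a * q / (E * F)) N * pch (l * q / E) N * pch (l * q / F) N
  / (pch (a * q / E) N * pch (a * q / F) N * pch (l * q) N * pch (l * q / (E * F)) N).

(** The sum is a Frenkel-Turaev sum of length N - j, with base a q^(2j) and with
    parameters a / l, E q^j and F q^j. *)
Lemma bailey_column N a l E F j : (j <= N)%N ->
  a != 0 -> l != 0 -> E != 0 -> F != 0 ->
  pch q N != 0 ->
  (forall i, (i <= 2 * N)%N -> th (a * q ^+ i) != 0) ->
  (forall i, (i <= 2 * N)%N -> th (l * q ^+ i) != 0) ->
  pch (a * q / E) N != 0 -> pch (a * q / F) N != 0 ->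
  pch (l * q / E) N != 0 -> pch (l * q / F) N != 0 ->
  (forall i, (i <= N)%N -> th (E * F / l * q ^+ i) != 0) ->
  (forall i, (i <= N)%N -> th (E * F / l / q ^+ i) != 0) ->
  pch (E * F * q ^- N / a) N != 0 ->
  \sum_(0 <= i < (N - j).+1)
    th (a * q ^+ (2 * (j + i))) / th a * q ^+ (j + i) * bailey_weight N a l E F (j + i)
    * (pch a (j + i + j) * pch (a / l) i / (pch q i * pch (l * q) (j + i + j))
       * (a / (l * q)) ^+ j)
  = bailey_prefactor N a l E F * bailey_weight N l a E F j.
Proof.
move=> jN a0 l0 E0 F0 qN aN lN aE aF lE lF sN sNV EFa.
have nle x k : (k <= N)%N -> pch x N != 0 -> pch x k != 0.
  move=> kn /poch_neq0P h; apply/poch_neq0P => i ik.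
  by apply: h; apply: leq_trans kn.
have nsuf x : pch x N != 0 -> pch (x * q ^+ j) (N - j) != 0.
  by rewrite -{1}(subnKC jN) pochD mulf_eq0 negb_or => /andP[].
have qj0 : q ^+ j != 0 by rewrite expf_neq0.
have a'0 : a * q ^+ (2 * j) != 0 by rewrite mulf_neq0 ?expf_neq0.
have b'0 : a / l != 0 by rewrite mulf_neq0 ?invr_eq0.
have c'0 : E * q ^+ j != 0 by rewrite mulf_neq0.
have d'0 : F * q ^+ j != 0 by rewrite mulf_neq0.
have s'0 : E * F / l != 0 by rewrite !mulf_neq0 ?invr_eq0.
have sa' : E * F / l * (a * q ^+ (2 * j)) = a / l * (E * q ^+ j) * (F * q ^+ j).
  by rewrite mul2n -addnn exprD; ring.
have q2j : q ^+ (2 * j) = q ^+ j * q ^+ j by rewrite mul2n -addnn exprD.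
have e1 : a * q ^+ (2 * j) * q / (a / l) = l * q ^+ (2 * j).+1.
  by rewrite exprS; field; rewrite a0 l0.
have e2 X : X != 0 -> a * q ^+ (2 * j) * q / (X * q ^+ j) = a * q / X * q ^+ j.
  by move=> X0; rewrite q2j; field; rewrite X0 qj0.
have aN' i : (i <= 2 * (N - j))%N -> th (a * q ^+ (2 * j) * q ^+ i) != 0.
  by move=> iN; rewrite -mulrA -exprD; apply: aN; clear -iN jN; lia.
have lN' : pch (l * q ^+ (2 * j).+1) (N - j) != 0.
  apply/poch_neq0P => i iN; rewrite -mulrA -exprD; apply: lN; clear -iN jN; lia.
have sN' i : (i <= N - j)%N -> th (E * F / l * q ^+ i) != 0.
  by move=> iN; apply: sN; apply: leq_trans iN (leq_subr _ _).
have sNV' i : (i <= N - j)%N -> th (E * F / l / q ^+ i) != 0.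
  by move=> iN; apply: sNV; apply: leq_trans iN (leq_subr _ _).
have := @frenkel_turaev K th q thL q0 (N - j) _ _ _ _ _ a'0 b'0 c'0 d'0 s'0 sa'.
rewrite /ft_product e1 !e2 //.
move/(_ (nle _ _ (leq_subr _ _) qN) aN' lN' (nsuf _ aE) (nsuf _ aF) sN' sNV') => FT.
pose cst := th (a * q ^+ (2 * j)) / th a * q ^+ j * (a / (l * q)) ^+ j
  * (pch a (2 * j) / pch (l * q) (2 * j)) * bailey_weight N a l E F j.
transitivity (cst * \sum_(0 <= k < (N - j).+1)
   wp_base th q (a * q ^+ (2 * j)) (a / l) (E * q ^+ j) (F * q ^+ j) k
   * ft_factor th q (a * q ^+ (2 * j)) (E * F / l) (q ^+ (N - j).+1) k).
  rewrite mulr_sumr; apply: eq_big_nat => i /andP[_]; rewrite ltnS => iN.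
  rewrite /wp_base e1 !e2 // /ft_factor /cst /bailey_weight.
  have -> : (j + i + j = 2 * j + i)%N by clear; lia.
  have qnj : q ^+ (N - j) != 0 by rewrite expf_neq0.
  have qN' : q ^+ N = q ^+ (N - j) * q ^+ j by rewrite -exprD subnK.
  have -> : a * q ^+ (2 * j) * q ^+ (N - j).+1 / (E * F / l) =
     l * a * q ^+ N.+1 / (E * F) * q ^+ j.
    by rewrite q2j !exprS qN'; field; rewrite l0 E0 F0.
  have -> : q / q ^+ (N - j).+1 = q ^- N * q ^+ j.
    by rewrite exprS qN'; field; rewrite qj0 q0 qnj.
  have -> : E * F / l * q / q ^+ (N - j).+1 = E * F * q ^- N / l * q ^+ j.
    by rewrite exprS qN'; field; rewrite qj0 q0 qnj l0.
  have -> : a * q ^+ (2 * j) * q ^+ (N - j).+1 = a * q ^+ N.+1 * q ^+ j.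
    by rewrite q2j !exprS qN'; ring.
  have -> : l * q ^+ (2 * j).+1 = l * q * q ^+ (2 * j) by rewrite exprS mulrA.
  have -> : a * q ^+ (2 * j) * q ^+ (2 * i) = a * q ^+ (2 * (j + i)).
    by rewrite -mulrA -exprD mulnDr.
  rewrite !pochD exprD !invfM.
  have ta : th (a * q ^+ (2 * j)) != 0 by apply: aN; rewrite leq_mul2l.
  by rewrite -[LHS]mul1r -(divff ta); ring.
rewrite {}FT /cst.
have aNj : th (a * q ^+ (2 * j)) * pch a (2 * j) * pch (a * q ^+ (2 * j) * q) (N - j)
    = th a * (pch (a * q) N * pch (a * q ^+ N.+1) j).
  have -> : a * q ^+ N.+1 = a * q * q ^+ N by rewrite exprS mulrA.
  rewrite -pochD mulrAC -!poch_recl mulrC -pochD.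
  by congr (poch _ _ _ _); clear -jN; lia.
have lNj : pch (l * q) (2 * j) * pch (l * q ^+ (2 * j).+1) (N - j)
    = pch (l * q) N * pch (l * q ^+ N.+1) j.
  by rewrite !exprS !mulrA -!pochD; congr (poch _ _ _ _); clear -jN; lia.
have split_at x : pch x N = pch x j * pch (x * q ^+ j) (N - j).
  by rewrite -pochD subnKC.
have ta : th a != 0 by rewrite -[a]mulr1 -(expr0 q) aN.
rewrite /bailey_prefactor /bailey_weight.
have -> : a * q ^+ (2 * j) * q / (a / l * (E * q ^+ j)) = l * q / E * q ^+ j.
  by rewrite q2j; field; rewrite a0 l0 E0 qj0.
have -> : a * q ^+ (2 * j) * q / (a / l * (F * q ^+ j)) = l * q / F * q ^+ j.
  by rewrite q2j; field; rewrite a0 l0 F0 qj0.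
have -> : a * q ^+ (2 * j) * q / (E * q ^+ j * (F * q ^+ j)) = a * q / (E * F).
  by rewrite q2j; field; rewrite E0 F0 qj0.
have inv x : x != 0 -> q / (E * F / x) = x * q / (E * F).
  by move=> x0; field; rewrite E0 F0 x0.
have qNN : q ^+ N != 0 by rewrite expf_neq0.
have EFx x : x != 0 -> E * F * q ^- N / x = E * F / x / q ^+ N.
  by move=> x0; field; rewrite qNN x0.
have kap := rev_factor_neq0 N j.
have r1 := poch_rev s'0 jN.
have EFa0 : E * F / a != 0 by rewrite !mulf_neq0 ?invr_eq0.
have r2 := poch_rev EFa0 jN.
move: r1 r2; rewrite !inv // !EFx //.
have Pl : pch (l * q / (E * F)) N != 0.
  apply/poch_neq0P => i iN.
  rewrite (_ : l * q / (E * F) * q ^+ i = q ^+ i.+1 / (E * F / l)).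
    by apply: th_swap_neq0; rewrite ?expf_neq0 // sNV.
  by rewrite exprS; field; rewrite E0 F0 l0.
have pa : pch (E * F / a / q ^+ N) j != 0 by rewrite -EFx // nle.
move=> r1 r2.
have : pch (E * F / l / q ^+ N) j * pch (l * q / (E * F)) (N - j) != 0.
  by rewrite r1 !mulf_neq0 // expf_neq0.
rewrite mulf_eq0 negb_or => /andP[pl0 plN].
have -> : pch (a * q / (E * F)) (N - j) =
   (E * F / a) ^+ j * rev_factor N j * pch (a * q / (E * F)) N
     / pch (E * F / a / q ^+ N) j.
  by rewrite -r2 [RHS]mulrC mulKf.
have {r1} -> : pch (l * q / (E * F)) (N - j) =
   (E * F / l) ^+ j * rev_factor N j * pch (l * q / (E * F)) N
     / pch (E * F / l / q ^+ N) j.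
  by rewrite -r1 [RHS]mulrC mulKf.
have lqn k : (k <= 2 * N)%N -> pch (l * q) k != 0.
  move=> kn; apply/poch_neq0P => i ik; rewrite -mulrA -exprS; apply: lN.
  exact: leq_trans kn.
have : pch (l * q) N * pch (l * q ^+ N.+1) j != 0.
  by rewrite exprS mulrA -pochD lqn // mul2n -addnn leq_add2l.
rewrite -lNj mulf_eq0 negb_or => /andP[l1 l2].
have : pch (l * q) N * pch (l * q ^+ N.+1) j != 0 by rewrite -lNj mulf_neq0.
rewrite mulf_eq0 negb_or => /andP[l3 l4].
have a4 : pch (a * q ^+ N.+1) j != 0.
  apply/poch_neq0P => i ij; rewrite -mulrA -exprD; apply: aN; clear -ij jN; lia.
have nz2 x : pch x N != 0 -> pch x j != 0 /\ pch (x * q ^+ j) (N - j) != 0.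
  by rewrite split_at mulf_eq0 negb_or => /andP.
have [[aE1 aE2] [aF1 aF2]] := (nz2 _ aE, nz2 _ aF).
have [[lE1 lE2] [lF1 lF2]] := (nz2 _ lE, nz2 _ lF).
rewrite (mulrC a l) [pch (a * q / E) N]split_at [pch (a * q / F) N]split_at.
rewrite [pch (l * q / E) N]split_at [pch (l * q / F) N]split_at.
rewrite !expr_div_n !exprMn.
have aj0 : a ^+ j != 0 by rewrite expf_neq0.
have lj0 : l ^+ j != 0 by rewrite expf_neq0.
have Ej0 : E ^+ j != 0 by rewrite expf_neq0.
have Fj0 : F ^+ j != 0 by rewrite expf_neq0.
move: aj0 lj0 Ej0 Fj0 qj0 kap Pl plN l1 l2 l3 l4 a4 aE1 aE2 aF1 aF2 lE1 lE2 lF1 lF2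
  ta pl0 pa.
move: aNj lNj.
move: (pch (a * q / E) j) (pch (a * q / F) j) (pch (l * q / E) j) (pch (l * q / F) j)
 (pch (a * q / E * q ^+ j) (N - j)) (pch (a * q / F * q ^+ j) (N - j))
 (pch (l * q / E * q ^+ j) (N - j)) (pch (l * q / F * q ^+ j) (N - j))
 (pch (l * q ^+ (2 * j).+1) (N - j)) (pch (a * q ^+ (2 * j) * q) (N - j))
 (pch (E * F / l / q ^+ N) j) (pch (E * F / a / q ^+ N) j) (pch (a * q / (E * F)) N)
 (pch (l * q / (E * F)) N) (pch (l * a * q ^+ N.+1 / (E * F)) j)
 (pch (l * q ^+ N.+1) j) (pch (a * q ^+ N.+1) j) (pch (q ^- N) j)
 (pch (l * q) N) (pch (a * q) N).
move: (th (a * q ^+ (2 * j))) (th a) (pch a (2 * j)) (pch (l * q) (2 * j)) (pch E j)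
  (pch F j)
  (rev_factor N j).
move: (a ^+ j) (l ^+ j) (E ^+ j) (F ^+ j) (q ^+ j).
move=> aj lj Ej Fj qj x0 x1 x2 x3 x4 x5 k y1 y2 y3 y4 y5 y6 y7 y8 y9 z1 z2 z3 z4 z5
  z6 z7 z8 z9 w1 w2.
move=> aNj lNj h1 h2 h3 h4 h5 h6 h7 h8 h9 g1 g2 g3 g4 g5 g6 g7 g8 f1 f2 f3 f4 f5 f6 f7.
transitivity ((x0 * x2 * z1) / (x3 * y9)
  * (x4 * x5 * z6 * z9 * y7 * y8 * lj * (Ej * Fj) * z4
    / (x1 * z8 * y1 * y2 * y5 * y6 * z3 * z5 * (Ej * Fj) * lj))).
  by field; rewrite ?h1 ?h2 ?h3 ?h4 ?h5 ?h6 ?h7 ?h8 ?h9 ?g1 ?g2 ?g3 ?g4 ?g5 ?g6 ?g7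
    ?g8 ?f1 ?f2 ?f3 ?f4 ?f5 ?f6 ?f7.
rewrite aNj lNj.
by field; rewrite ?h1 ?h2 ?h3 ?h4 ?h5 ?h6 ?h7 ?h8 ?h9 ?g1 ?g2 ?g3 ?g4 ?g5 ?g6 ?g7 ?g8
  ?f1 ?f2 ?f3 ?f4 ?f5 ?f6 ?f7.
Qed.

(** The part with parameters b, c, d is expanded by [wp_change_of_base]; after the
    summations are exchanged the inner sums are given by [bailey_column]. *)
Theorem elliptic_bailey_generic N a b c d l E F :
  a != 0 -> b != 0 -> c != 0 -> d != 0 -> l != 0 -> E != 0 -> F != 0 ->
  l * (b * c * d) = q * a ^+ 2 -> pch q N != 0 ->
  pch (a * q / b) N != 0 -> pch (a * q / c) N != 0 -> pch (a * q / d) N != 0 ->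
  (forall i, (i <= 2 * N)%N -> th (a * q ^+ i) != 0) ->
  (forall i, (i <= 2 * N)%N -> th (l * q ^+ i) != 0) ->
  pch (a * q / E) N != 0 -> pch (a * q / F) N != 0 ->
  pch (l * q / E) N != 0 -> pch (l * q / F) N != 0 ->
  (forall i, (i <= N)%N -> th (l * q / a * q ^+ i) != 0) ->
  (forall i, (i <= N)%N -> th (l * q / a / q ^+ i) != 0) ->
  (forall i, (i <= N)%N -> th (E * F / l * q ^+ i) != 0) ->
  (forall i, (i <= N)%N -> th (E * F / l / q ^+ i) != 0) ->
  pch (E * F * q ^- N / a) N != 0 ->
  \sum_(0 <= k < N.+1) wp_base th q a b c d k * bailey_weight N a l E F k
  = bailey_prefactor N a l E F *
    \sum_(0 <= j < N.+1) wp_base th q l (l * b / a) (l * c / a) (l * d / a) j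
       * bailey_weight N l a E F j.
Proof.
move=> a0 b0 c0 d0 l0 E0 F0 lE qN bN cN dN aN lN aE aF lEN lF sN sNV tN tNV EFa.
have nle x k : (k <= N)%N -> pch x N != 0 -> pch x k != 0.
  move=> kn /poch_neq0P h; apply/poch_neq0P => i ik.
  by apply: h; apply: leq_trans kn.
pose A k := th (a * q ^+ (2 * k)) / th a * q ^+ k * bailey_weight N a l E F k.
pose M k j := pch a (k + j) * pch (a / l) (k - j) / (pch q (k - j) * pch (l * q) (k + j))
     * (a / (l * q)) ^+ j.
pose V j := wp_base th q l (l * b / a) (l * c / a) (l * d / a) j.
transitivity (\sum_(0 <= k < N.+1) \sum_(0 <= j < N.+1 | (j <= k)%N) A k * M k j * V j).
  apply: eq_big_nat => k /andP[_]; rewrite ltnS => kN.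
  transitivity (A k * \sum_(0 <= j < k.+1) M k j * V j).
    have le2 i : (i <= 2 * k)%N -> (i <= 2 * N)%N.
      by move=> ik; apply: leq_trans ik _; rewrite leq_mul2l.
    have lN' i : (i <= 2 * k)%N -> th (l * q ^+ i) != 0 by move=> /le2/lN.
    have sN' i : (i <= k)%N -> th (l * q / a * q ^+ i) != 0.
      by move=> ik; apply: sN; apply: leq_trans kN.
    have sNV' i : (i <= k)%N -> th (l * q / a / q ^+ i) != 0.
      by move=> ik; apply: sNV; apply: leq_trans kN.
    have := wp_change_of_base a0 b0 c0 d0 l0 lE (nle _ _ kN qN) lN' (nle _ _ kN bN)
      (nle _ _ kN cN) (nle _ _ kN dN) sN' sNV'.
    rewrite -/(M k) => <-.
    by rewrite /wp_base /A; ring.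
  rewrite mulr_sumr (big_nat_widen _ _ N.+1) //.
  by apply: eq_big => [j|j _]; rewrite ?ltnS ?mulrA.
rewrite (exchange_big_dep_nat xpredT) //= mulr_sumr.
apply: eq_big_nat => j /andP[_]; rewrite ltnS => jN.
have E1 := bailey_column jN a0 l0 E0 F0 qN aN lN aE aF lEN lF tN tNV EFa.
transitivity (V j * \sum_(0 <= i < (N - j).+1) A (j + i) * M (j + i) j).
  transitivity (\sum_(j <= k < N.+1) A k * M k j * V j).
    by rewrite [RHS](big_nat_widenl _ 0) //; apply: eq_bigl => k; rewrite andTb.
  rewrite -{1}[j]add0n big_addn subSn // mulr_sumr; apply: eq_bigr => i _.
  by rewrite (addnC i j); ring.
rewrite mulrCA -E1; congr (_ * _).
by apply: eq_bigr => i _; rewrite /A /M addKn.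
Qed.

End Bailey.

Local Open Scope classical_set_scope.

(** * Complex sequences and infinite products *)

Section ComplexSequences.
Variable R : realType.
Local Notation C := R[i].

(** The norm of R[i] takes its values in R[i]; [cmod] is the same norm with
    values in R, which allows the use of real analysis. *)
Definition cmod (z : C) : R := complex.Re `|z|.

Lemma normE (z : C) : `|z| = (cmod z)%:C%C.
Proof. by rewrite /cmod normc_def. Qed.

Lemma cmod_ge0 z : 0 <= cmod z.
Proof. rewrite -lecR -normE; exact: normr_ge0. Qed.

Lemma cmodM x y : cmod (x * y) = cmod x * cmod y.
Proof. by apply: (@complexI R); rewrite rmorphM /= -!normE normrM. Qed.

Lemma cmod1 : cmod 1 = 1.
Proof. by apply: (@complexI R); rewrite -normE normr1. Qed.

Lemma cmod0 : cmod 0 = 0.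
Proof. by apply: (@complexI R); rewrite -normE normr0. Qed.

Lemma cmod_eq0 z : (cmod z == 0) = (z == 0).
Proof.
by rewrite -[RHS]normr_eq0 normE -[X in _ = (_ == X)](rmorph0 (real_complex R))
  (inj_eq (@complexI R)).
Qed.

Lemma cmodX x n : cmod (x ^+ n) = cmod x ^+ n.
Proof. by elim: n => [|n IH]; rewrite ?expr0 ?cmod1 // !exprS cmodM IH. Qed.

Lemma cmodV x : cmod x^-1 = (cmod x)^-1.
Proof. by apply: (@complexI R); rewrite fmorphV /= -!normE normfV. Qed.

Lemma cmodN x : cmod (- x) = cmod x.
Proof. by rewrite /cmod normrN. Qed.

Lemma cmodB x y : cmod (x - y) = cmod (y - x).
Proof. by rewrite -cmodN opprB. Qed.

Lemma cmodD x y : cmod (x + y) <= cmod x + cmod y.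
Proof. by rewrite -lecR rmorphD /= -!normE ler_normD. Qed.

Lemma cmod_sum (I : Type) (s : seq I) (P : pred I) (F : I -> C) :
  cmod (\sum_(i <- s | P i) F i) <= \sum_(i <- s | P i) cmod (F i).
Proof.
elim/big_ind2: _ => [|x a y b xa yb|i _]; rewrite ?cmod0 //.
by apply: le_trans (cmodD _ _) _; apply: lerD.
Qed.

Lemma cmod_prod (I : Type) (s : seq I) (P : pred I) (F : I -> C) :
  cmod (\prod_(i <- s | P i) F i) = \prod_(i <- s | P i) cmod (F i).
Proof. by elim/big_ind2: _ => [|x a y b <- <-|//]; rewrite ?cmod1 // cmodM. Qed.

Lemma cmod_real (x : R) : cmod x%:C%C = `|x|.
Proof. by apply: (@complexI R); rewrite -normE normc_def /= expr0n addr0 sqrtr_sqr. Qed.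

Lemma cmod_ge_Re z : `|complex.Re z| <= cmod z.
Proof. by rewrite -lecR -normE normc_ge_Re. Qed.

Lemma cmod_ge_Im z : `|complex.Im z| <= cmod z.
Proof.
have := cmod_ge_Re (z * - 'i%C); rewrite cmodM cmodN.
have -> : cmod 'i%C = 1.
  by apply: (@complexI R); rewrite -normE normc_def /= expr0n add0r expr1n sqrtr1.
by rewrite mulr1; case: z => x y /=;
  rewrite !(mulr0, mul0r, oppr0, mulrN, mulr1, sub0r, opprK).
Qed.

Lemma ccvgP (u : nat -> C) (l : C) :
  (u @ \oo --> (l : C^o)) <-> ((fun n => cmod (u n - l)) @ \oo --> (0 : R)).
Proof.
split=> h.
  apply/(@cvgrPdist_lt R R^o nat \oo eventually_filter _ 0) => e e0.
  have {}h := (@cvgrPdist_lt C C^o nat \oo eventually_filter u l).1 h.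
  have := h (e%:C)%C; rewrite ltcR => /(_ e0) [N _ hN]; exists N => // n /hN /=.
  by rewrite sub0r normrN normE ltcR cmodB ger0_norm ?cmod_ge0.
have {}h := (@cvgrPdist_lt R R^o nat \oo eventually_filter _ 0).1 h.
apply/(@cvgrPdist_lt C C^o nat \oo eventually_filter u l) => e e0.
move: e0; rewrite ltcE /= => /andP[/eqP Ie Re0].
have [N _ hN] := h _ Re0; exists N => // n /hN /=.
rewrite sub0r normrN ger0_norm ?cmod_ge0 // => hn.
by rewrite normE ltcE /= Ie eqxx cmodB.
Qed.

Lemma ccvg_le_near (u : nat -> C) (l : C) (e : nat -> R) :
  (\forall n \near \oo, cmod (u n - l) <= e n) -> e @ \oo --> (0 : R) ->
  u @ \oo --> (l : C^o).
Proof.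
move=> ule e0; apply/ccvgP; apply: (@squeeze_cvgr _ _ _ _ (fun=> 0) e) => //.
- by near=> n; rewrite cmod_ge0 /=; near: n.
- exact: cvg_cst.
Unshelve. all: end_near. Qed.

Lemma ccvg_le (u : nat -> C) (l : C) (e : nat -> R) :
  (forall n, cmod (u n - l) <= e n) -> e @ \oo --> (0 : R) -> u @ \oo --> (l : C^o).
Proof. by move=> ule; apply: ccvg_le_near; exists 0%N => // n _; apply: ule. Qed.

Lemma ccvg_unique (u : nat -> C) (l l' : C) :
  u @ \oo --> (l : C^o) -> u @ \oo --> (l' : C^o) -> l = l'.
Proof. exact: (@cvg_unique C^o (@norm_hausdorff C C^o) (u @ \oo)). Qed.

Lemma ccvgM (u v : nat -> C) (a b : C) : u @ \oo --> (a : C^o) ->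
  v @ \oo --> (b : C^o) -> (fun n => u n * v n) @ \oo --> (a * b : C^o).
Proof. exact: cvgM. Qed.

Lemma ccvgD (u v : nat -> C) (a b : C) : u @ \oo --> (a : C^o) ->
  v @ \oo --> (b : C^o) -> (fun n => u n + v n) @ \oo --> (a + b : C^o).
Proof. exact: (@cvgD C C^o nat \oo eventually_filter u v a b). Qed.

Lemma ccvg_cst (a : C) : (fun=> a : C) @ \oo --> (a : C^o).
Proof. exact: (@cvg_cst C^o a nat \oo eventually_filter). Qed.

Lemma ccvgN (u : nat -> C) (a : C) : u @ \oo --> (a : C^o) ->
  (fun n => - u n) @ \oo --> (- a : C^o).
Proof. exact: (@cvgN C C^o nat \oo eventually_filter u a). Qed.

Lemma ccvgB (u v : nat -> C) (a b : C) : u @ \oo --> (a : C^o) ->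
  v @ \oo --> (b : C^o) -> (fun n => u n - v n) @ \oo --> (a - b : C^o).
Proof. by move=> h h'; exact: ccvgD h (ccvgN h'). Qed.

Lemma ccvgV (u : nat -> C) (a : C) : a != 0 -> u @ \oo --> (a : C^o) ->
  (fun n => (u n)^-1) @ \oo --> (a^-1 : C^o).
Proof. exact: cvgV. Qed.

Lemma ccvgX (u : nat -> C) (a : C) k : u @ \oo --> (a : C^o) ->
  (fun n => u n ^+ k) @ \oo --> (a ^+ k : C^o).
Proof.
move=> ua; elim: k => [|k IH]; first exact: (@ccvg_cst 1).
rewrite exprS (_ : (fun n => _) = (fun n => u n * u n ^+ k)); first exact: ccvgM ua IH.
by apply/funext => n; rewrite exprS.
Qed.

Lemma ccvg_neq0 (u : nat -> C) (a : C) : a != 0 -> u @ \oo --> (a : C^o) ->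
  \forall n \near \oo, u n != 0.
Proof. by move=> a0 h; apply: (@cvgr_neq0 C C^o nat \oo eventually_filter u a h). Qed.

Lemma ccvg_bounded (u : nat -> C) (l : C) : u @ \oo --> (l : C^o) ->
  exists2 A : R, 0 <= A & forall n, cmod (u n) <= A.
Proof.
move=> /ccvgP hu.
have [N _ hN] := (@cvgrPdist_lt R R^o nat \oo eventually_filter _ 0).1 hu 1 ltr01.
exists (1 + cmod l + \sum_(0 <= j < N) cmod (u j)).
  by rewrite !addr_ge0 ?cmod_ge0 //; apply: sumr_ge0 => j _; apply: cmod_ge0.
move=> n; case: (ltnP n N) => nN.
  rewrite (bigD1_seq n) ?mem_index_iota ?iota_uniq //= addrCA lerDl !addr_ge0
    ?cmod_ge0 //.
  by apply: sumr_ge0 => j _; apply: cmod_ge0.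
have /= := hN n nN; rewrite sub0r normrN ger0_norm ?cmod_ge0 // => /ltW h.
apply: (@le_trans _ _ (1 + cmod l)); last first.
  by rewrite lerDl; apply: sumr_ge0 => j _; apply: cmod_ge0.
by rewrite -[u n](subrK l); apply: le_trans (cmodD _ _) _; rewrite lerD2r.
Qed.

Lemma ccvg_subseq (phi : nat -> nat) (u : nat -> C) (l : C) :
  (forall n, (n <= phi n)%N) -> u @ \oo --> (l : C^o) ->
  (fun n => u (phi n)) @ \oo --> (l : C^o).
Proof.
move=> hphi /ccvgP hu; apply/ccvgP.
apply/(@cvgrPdist_lt R R^o nat \oo eventually_filter _ 0) => e e0.
have [N _ hN] := (@cvgrPdist_lt R R^o nat \oo eventually_filter _ 0).1 hu e e0.
by exists N => // n /= Nn; apply: (hN (phi n)); apply: leq_trans (hphi n).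
Qed.

Lemma ccvg_cmod_le_from (u : nat -> C) (l : C) (c : R) N0 : u @ \oo --> (l : C^o) ->
  (forall n, (N0 <= n)%N -> cmod (u n) <= c) -> cmod l <= c.
Proof.
move=> /ccvgP hu uc; rewrite leNgt; apply/negP => lc.
have e0 : 0 < cmod l - c by rewrite subr_gt0.
have [N _ hN] := (@cvgrPdist_lt R R^o nat \oo eventually_filter _ 0).1 hu _ e0.
have /= := hN (maxn N N0) (leq_maxl N N0).
rewrite sub0r normrN ger0_norm ?cmod_ge0 // => h.
have : cmod l <= cmod (u (maxn N N0) - l) + cmod (u (maxn N N0)).
  by rewrite cmodB; apply: le_trans (cmodD _ _); rewrite subrK.
by have := uc _ (leq_maxr N N0); move: h; lra.
Qed.

Lemma ccvg_cmod_le (u : nat -> C) (l : C) (c : R) : u @ \oo --> (l : C^o) ->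
  (forall n, cmod (u n) <= c) -> cmod l <= c.
Proof. by move=> ul uc; apply: (ccvg_cmod_le_from (N0 := 0) ul) => n _. Qed.

Lemma geo_cvg0 (B r : R) : 0 <= r < 1 -> (fun n => B * r ^+ n) @ \oo --> (0 : R).
Proof. by move=> /andP[r0 r1]; apply: cvg_geometric; rewrite ger0_norm. Qed.

Lemma geo_sum_le (r : R) n : 0 <= r < 1 -> \sum_(0 <= j < n) r ^+ j <= (1 - r)^-1.
Proof.
move=> /andP[r0 r1]; have r1' : 0 < 1 - r by rewrite subr_gt0.
rewrite -[leRHS]mul1r ler_pdivlMr //.
suff -> : (\sum_(0 <= j < n) r ^+ j) * (1 - r) = 1 - r ^+ n by rewrite gerBl exprn_ge0.
elim: n => [|n IH]; first by rewrite big_nil mul0r expr0 subrr.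
by rewrite big_nat_recr //= mulrDl IH exprS; ring.
Qed.

Lemma geo_series_cvg (z : nat -> C) (B r : R) : 0 <= r < 1 ->
  (forall n, cmod (z n) <= B * r ^+ n) ->
  exists l : C, (fun n => \sum_(0 <= j < n) z j) @ \oo --> (l : C^o).
Proof.
move=> r01 zB.
have realcase (x : nat -> R) : (forall n, `|x n| <= B * r ^+ n) ->
    exists l : R, (fun n => \sum_(0 <= j < n) x j) @ \oo --> l.
  move=> xB; suff h : cvgn (series x).
    by exists (limn (series x)).
  apply: normed_cvg; apply: (@series_le_cvg _ _ (geometric B r)) => //.
  - by move=> n; exact: normr_ge0.
  - by move=> n; exact: le_trans (normr_ge0 _) (xB n).
  - by apply: is_cvg_geometric_series; case/andP: r01 => r0 r1; rewrite ger0_norm.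
have [n|a ha] := realcase (fun n => complex.Re (z n)).
  exact: le_trans (cmod_ge_Re _) (zB n).
have [n|b hb] := realcase (fun n => complex.Im (z n)).
  exact: le_trans (cmod_ge_Im _) (zB n).
exists (a +i* b)%C.
apply: (@ccvg_le _ _ (fun n => `|\sum_(0 <= j < n) complex.Re (z j) - a| +
                               `|\sum_(0 <= j < n) complex.Im (z j) - b|)).
  move=> n.
  have -> : \sum_(0 <= j < n) z j = ((\sum_(0 <= j < n) complex.Re (z j)) +i*
       (\sum_(0 <= j < n) complex.Im (z j)))%C.
    elim: n => [|n IH]; first by rewrite !big_nil.
    by rewrite !big_nat_recr //= IH; case: (z n).
  move: (\sum_(0 <= j < n) complex.Re (z j)) (\sum_(0 <= j < n) complex.Im (z j)) => x y.
  have -> : (x +i* y)%C - (a +i* b)%C = (x - a)%:C%C + 'i%C * (y - b)%:C%C.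
    by apply/eqP; rewrite eq_complex /=; apply/andP; split; apply/eqP; ring.
  apply: le_trans (cmodD _ _) _; rewrite cmodM !cmod_real.
  have -> : cmod 'i%C = 1.
    by apply: (@complexI R); rewrite -normE normc_def /= expr0n add0r expr1n sqrtr1.
  by rewrite mul1r.
have abs0 (x : nat -> R) (l : R) : x @ \oo --> l
  -> (fun n => `|x n - l|) @ \oo --> (0 : R).
  by move=> /subr_cvg0 h; apply/norm_cvg0P.
by rewrite -[X in _ --> X](addr0 0); apply: cvgD; apply: abs0.
Qed.

Lemma prod1D_le_exp (b : nat -> R) n : (forall j, 0 <= b j) ->
  \prod_(0 <= j < n) (1 + b j) <= expR (\sum_(0 <= j < n) b j).
Proof.
move=> b0; elim: n => [|n IH]; first by rewrite !big_nil expR0.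
rewrite !big_nat_recr //= expRD; apply: ler_pM => //; last exact: expR_ge1Dx.
  by apply: prodr_ge0 => j _; rewrite addr_ge0.
by rewrite addr_ge0.
Qed.

Lemma geo_prod_le (b : nat -> R) (B r : R) n : 0 <= r < 1 -> 0 <= B ->
  (forall j, 0 <= b j) -> (forall j, b j <= B * r ^+ j) ->
  \prod_(0 <= j < n) (1 + b j) <= expR (B / (1 - r)).
Proof.
move=> r01 B0 b0 bB; apply: le_trans (prod1D_le_exp _ b0) _; rewrite ler_expR.
apply: (@le_trans _ _ (\sum_(0 <= j < n) B * r ^+ j)).
  by apply: ler_sum => j _; apply: bB.
by rewrite -mulr_sumr; apply: ler_wpM2l => //; apply: geo_sum_le.
Qed.

Lemma cmod1D (z : C) : cmod (1 + z) <= 1 + cmod z.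
Proof. by apply: le_trans (cmodD _ _) _; rewrite cmod1. Qed.

Lemma geo_prod_bound (z : nat -> C) (B r : R) n : 0 <= r < 1 -> 0 <= B ->
  (forall j, cmod (z j) <= B * r ^+ j) ->
  cmod (\prod_(0 <= j < n) (1 + z j)) <= expR (B / (1 - r)).
Proof.
move=> r01 B0 zB; rewrite cmod_prod.
apply: le_trans (geo_prod_le n r01 B0 (fun j => cmod_ge0 (z j)) zB).
by apply: ler_prod => j _; rewrite cmod_ge0 cmod1D.
Qed.

(** A telescoping estimate: replacing the factors one at a time costs at most the
    bound on the other factors times the difference. *)
Lemma geo_prod_dist (z w : nat -> C) (B D r : R) n : 0 <= r < 1 -> 0 <= B -> 0 <= D ->
  (forall j, cmod (z j) <= B * r ^+ j) -> (forall j, cmod (w j) <= B * r ^+ j) ->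
  (forall j, cmod (z j - w j) <= D * r ^+ j) ->
  cmod (\prod_(0 <= j < n) (1 + z j) - \prod_(0 <= j < n) (1 + w j))
   <= expR (B / (1 - r)) * (D / (1 - r)).
Proof.
move=> r01 B0 D0 zB wB zwD.
pose K := expR (B / (1 - r)).
have K1 : 0 <= K by apply: expR_ge0.
suff h : cmod (\prod_(0 <= j < n) (1 + z j) - \prod_(0 <= j < n) (1 + w j))
   <= (\prod_(0 <= j < n) (1 + B * r ^+ j)) * \sum_(0 <= j < n) D * r ^+ j.
  apply: le_trans h _; apply: ler_pM.
  - apply: prodr_ge0 => j _; rewrite addr_ge0 // mulr_ge0 // exprn_ge0 //.
    by case/andP: r01.
  - by apply: sumr_ge0 => j _; rewrite mulr_ge0 // exprn_ge0 //; case/andP: r01.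
  - apply: geo_prod_le => // j; rewrite mulr_ge0 // exprn_ge0 //.
    by case/andP: r01.
  - by rewrite -mulr_sumr; apply: ler_wpM2l => //; apply: geo_sum_le.
have rj j : 0 <= r ^+ j by rewrite exprn_ge0 //; case/andP: r01.
elim: n => [|n IH]; first by rewrite !big_nil subrr cmod0 mulr0.
rewrite !big_nat_recr //=.
set Z := \prod_(0 <= j < n) (1 + z j) in IH *.
set W := \prod_(0 <= j < n) (1 + w j) in IH *.
set P := \prod_(0 <= j < n) (1 + B * r ^+ j) in IH *.
set S := \sum_(0 <= j < n) D * r ^+ j in IH *.
have P1 : cmod W <= P.
  rewrite /W cmod_prod; apply: ler_prod => j _; rewrite cmod_ge0 /=.
  by apply: le_trans (cmod1D _) _; rewrite lerD2l.
have P0 : 0 <= P by apply: le_trans (cmod_ge0 _) P1.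
have S0 : 0 <= S by apply: sumr_ge0 => j _; rewrite mulr_ge0.
rewrite (_ : Z * (1 + z n) - W * (1 + w n) = (Z - W) * (1 + z n) + W * (z n - w n));
  last by ring.
apply: le_trans (cmodD _ _) _; rewrite !cmodM.
apply: (@le_trans _ _ (P * S * (1 + B * r ^+ n) + P * (D * r ^+ n))).
  apply: lerD; apply: ler_pM; rewrite ?cmod_ge0 //.
  by apply: le_trans (cmod1D _) _; rewrite lerD2l.
rewrite [leRHS]mulrDr [X in _ <= X + _]mulrAC; apply: lerD => //.
by rewrite ler_wpM2r ?mulr_ge0 // ler_peMr // lerDl mulr_ge0.
Qed.

(** The increments of the partial products P_n are P_n z_n, and the P_n are
    bounded, so that convergence reduces to that of a series. *)
Lemma geo_prod_cvg (z : nat -> C) (B r : R) : 0 <= r < 1 -> 0 <= B ->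
  (forall j, cmod (z j) <= B * r ^+ j) ->
  exists l : C, (fun n => \prod_(0 <= j < n) (1 + z j)) @ \oo --> (l : C^o).
Proof.
move=> r01 B0 zB.
pose P n := \prod_(0 <= j < n) (1 + z j).
have [|l hl] := @geo_series_cvg (fun n => P n * z n) (expR (B / (1 - r)) * B) r r01.
  move=> n; rewrite cmodM -mulrA; apply: ler_pM; rewrite ?cmod_ge0 //.
  exact: geo_prod_bound.
exists (1 + l).
have -> : (fun n => \prod_(0 <= j < n) (1 + z j)) =
  (fun n => 1 + \sum_(0 <= j < n) P j * z j).
  apply/funext; elim=> [|n IH]; first by rewrite !big_nil addr0.
  by rewrite !big_nat_recr //= addrA -IH /P; ring.
exact: ccvgD (@ccvg_cst 1) hl.
Qed.

(** The product of the inverse factors converges as well, and the two limits are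
    inverse to each other. *)
Lemma geo_prod_cvg_neq0 (z : nat -> C) (B r : R) (l : C) : 0 <= r < 1 -> 0 <= B ->
  (forall j, cmod (z j) <= B * r ^+ j) -> (forall j, 1 + z j != 0) ->
  (fun n => \prod_(0 <= j < n) (1 + z j)) @ \oo --> (l : C^o) -> l != 0.
Proof.
move=> r01 B0 zB z0 hl.
pose w j := - z j / (1 + z j).
have wE j : 1 + w j = (1 + z j)^-1 by rewrite /w; field.
(* The inverses of the factors are bounded: all but finitely many factors have
   modulus at least 1 / 2, and none of them vanishes. *)
have [D D0 hD] : exists2 D : R, 0 <= D & forall j, (cmod (1 + z j))^-1 <= D.
  have [N _ hN] := (@cvgrPdist_lt R R^o nat \oo eventually_filter _ 0).1
    (geo_cvg0 B r01) 2^-1 ltac:(by rewrite invr_gt0).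
  exists (2 + \sum_(0 <= j < N) (cmod (1 + z j))^-1).
    by rewrite addr_ge0 //; apply: sumr_ge0 => j _; rewrite invr_ge0 cmod_ge0.
  move=> j; case: (ltnP j N) => jN.
    rewrite (bigD1_seq j) ?mem_index_iota ?iota_uniq //= addrCA lerDl addr_ge0 //.
    by apply: sumr_ge0 => i _; rewrite invr_ge0 cmod_ge0.
  apply: (@le_trans _ _ 2); last first.
    by rewrite lerDl; apply: sumr_ge0 => i _; rewrite invr_ge0 cmod_ge0.
  have /= := hN j jN; rewrite sub0r normrN => hj.
  have zj : cmod (z j) <= 2^-1.
    by apply: le_trans (zB j) (le_trans (ler_norm _) (ltW hj)).
  have h1 : 2^-1 <= cmod (1 + z j).
    have := cmodD (1 + z j) (- z j); rewrite addrK cmod1 cmodN => h.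
    have : 1 - cmod (z j) <= cmod (1 + z j) by rewrite lerBlDr.
    by apply: le_trans; lra.
  rewrite -[leRHS]invrK lef_pV2 // posrE ?invr_gt0 //.
  by apply: lt_le_trans h1; rewrite invr_gt0.
have [|l' hl'] := @geo_prod_cvg w (D * B) r r01 (mulr_ge0 D0 B0).
  move=> j; rewrite /w cmodM cmodN cmodV mulrC -mulrA.
  by apply: ler_pM; rewrite ?invr_ge0 ?cmod_ge0.
have : l * l' = 1.
  apply: (ccvg_unique (ccvgM hl hl')).
  have -> : (fun n => \prod_(0 <= j < n) (1 + z j) * \prod_(0 <= j < n) (1 + w j))
    = fun=> 1.
    apply/funext => n; rewrite -big_split big1 // => j _ /=.
    by rewrite wE divff.
  exact: ccvg_cst.
by apply: contra_eq_neq => ->; rewrite mul0r eq_sym oner_neq0.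
Qed.

End ComplexSequences.

(** * The theta function: convergence, zeros, continuity *)

Section Theta.
Variable R : realType.
Local Notation C := R[i].

Variable p : C.
Hypothesis p_lt1 : `|p| < 1.

Let r := cmod p.

Lemma cmodp_lt1 : 0 <= r < 1.
Proof. by rewrite cmod_ge0 -ltcR -normE. Qed.

Definition theta_partial (a : C) (n : nat) : C :=
  \prod_(0 <= j < n) ((1 - a * p ^+ j) * (1 - p ^+ j.+1 / a)).

(** The factors of the theta product are 1 + [theta_eps a j].  The quotient a / a
    keeps this true at a = 0. *)
Definition theta_eps (a : C) (j : nat) : C :=
  - (a * p ^+ j) - p ^+ j.+1 / a + (a / a) * p ^+ (2 * j).+1.

Lemma theta_partialE a n : theta_partial a n = \prod_(0 <= j < n) (1 + theta_eps a j).
Proof.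
apply: eq_bigr => j _; rewrite /theta_eps.
have -> : p ^+ (2 * j).+1 = p ^+ j * p ^+ j.+1 by rewrite -exprD; congr (_ ^+ _); lia.
by ring.
Qed.

Lemma cmod_div_le1 (a : C) : cmod (a / a) <= 1.
Proof.
have [->|a0] := eqVneq a 0; first by rewrite mul0r cmod0.
by rewrite divff // cmod1.
Qed.

Lemma cmodp_exp_le i j : (j <= i)%N -> r ^+ i <= r ^+ j.
Proof.
move=> ij; have /andP[r0 r1] := cmodp_lt1.
by apply: ler_wiXn2l => //; apply: ltW.
Qed.

Lemma theta_eps_le a (A B : R) j : cmod a <= A -> cmod a^-1 <= B ->
  cmod (theta_eps a j) <= (A + B + 1) * r ^+ j.
Proof.
move=> aA aB; rewrite /theta_eps !mulrDl.
have r0 n : 0 <= r ^+ n by rewrite exprn_ge0 // cmod_ge0.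
apply: le_trans (cmodD _ _) _; apply: lerD.
  apply: le_trans (cmodD _ _) _; rewrite !cmodN !cmodM !cmodX; apply: lerD.
    by apply: ler_wpM2r.
  rewrite mulrC; apply: ler_pM; rewrite ?cmod_ge0 ?r0 //.
  exact: cmodp_exp_le.
rewrite cmodM cmodX; apply: ler_pM; rewrite ?cmod_ge0 ?r0 ?cmod_div_le1 //.
by apply: cmodp_exp_le; lia.
Qed.

Lemma theta_cvg a : theta_partial a @ \oo --> (theta a p : C^o).
Proof.
have B0 : 0 <= cmod a + cmod a^-1 + 1 by rewrite !addr_ge0 ?cmod_ge0.
have [l hl] := geo_prod_cvg cmodp_lt1 B0 (fun j => theta_eps_le j (lexx _) (lexx _)).
have hl' : theta_partial a @ \oo --> (l : C^o).
  suff -> : theta_partial a = (fun n => \prod_(0 <= j < n) (1 + theta_eps a j)) by [].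
  by apply/funext => n; rewrite theta_partialE.
suff -> : theta a p = l by [].
exact: (@cvg_lim C^o (@norm_hausdorff C C^o) nat \oo eventually_filter
  (theta_partial a) l hl').
Qed.

Lemma theta_neq0 a : (forall j, a * p ^+ j != 1) -> (forall j, p ^+ j.+1 / a != 1) ->
  theta a p != 0.
Proof.
move=> h1 h2.
have B0 : 0 <= cmod a + cmod a^-1 + 1 by rewrite !addr_ge0 ?cmod_ge0.
apply: (geo_prod_cvg_neq0 cmodp_lt1 B0 (fun j => theta_eps_le j (lexx _) (lexx _))).
  move=> j; have := theta_partialE a j.+1; rewrite /theta_partial.
  have -> : 1 + theta_eps a j = (1 - a * p ^+ j) * (1 - p ^+ j.+1 / a).
    rewrite /theta_eps.
    have -> : p ^+ (2 * j).+1 = p ^+ j * p ^+ j.+1 by rewrite -exprD; congr (_ ^+ _); lia.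
    by ring.
  by rewrite mulf_neq0 // subr_eq0 eq_sym.
have := @theta_cvg a.
suff -> : theta_partial a = (fun n => \prod_(0 <= j < n) (1 + theta_eps a j)) by [].
by apply/funext => n; rewrite theta_partialE.
Qed.

Lemma theta_eq0_factor a j : (1 - a * p ^+ j) * (1 - p ^+ j.+1 / a) = 0 -> theta a p = 0.
Proof.
move=> h; apply: (ccvg_unique (@theta_cvg a)).
apply: (@cvg_near_cst nat C^o 0 (theta_partial a) \oo eventually_filter).
exists j.+1 => // n /= jn; rewrite /theta_partial.
by rewrite (big_cat_nat (n := j.+1)) //= big_nat_recr //= h mulr0 mul0r.
Qed.

Lemma theta1 : theta 1 p = 0.
Proof. by apply: (@theta_eq0_factor _ 0); rewrite expr0 mulr1 subrr mul0r. Qed.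

(** The zeros are the integral powers of p.  The equation a p^i = p^j expresses
    this without negative exponents; for p = 0 the only zero is 1. *)
Lemma theta_eq0P a : a != 0 ->
  theta a p = 0 <-> a = 1 \/ p != 0 /\ exists i j, a * p ^+ i = p ^+ j.
Proof.
move=> a0; split=> [ta|].
  have [[i h1]|h1] := pselect (exists j, a * p ^+ j = 1).
    have [p0|p0] := eqVneq p 0; last by right; split=> //; exists i, 0%N.
    left; move: h1; rewrite p0; case: i => [|i]; first by rewrite expr0 mulr1.
    by rewrite expr0n mulr0 => /eqP; rewrite eq_sym oner_eq0.
  have [[j h2]|h2] := pselect (exists j, p ^+ j.+1 / a = 1).
    have pa : p ^+ j.+1 = a by rewrite -[RHS]mul1r -h2 divfK.
    have [p0|p0] := eqVneq p 0; last by right; split=> //; exists 0%N, j.+1;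
      rewrite mulr1.
    by move: a0; rewrite -pa p0 expr0n eqxx.
  have : theta a p != 0.
    by apply: theta_neq0 => j; apply/eqP => h; [apply: h1 | apply: h2]; exists j.
  by rewrite ta eqxx.
case=> [->|[p0 [i [j h]]]]; first exact: theta1.
have [ij|ji] := leqP i j.
  have aE : a = p ^+ (j - i) by apply: (mulIf (expf_neq0 i p0)); rewrite h -exprD subnK.
  case E : (j - i)%N aE => [|k] ->; first exact: theta1.
  by apply: (@theta_eq0_factor _ k); rewrite divff ?subrr ?mulr0 // expf_neq0.
apply: (@theta_eq0_factor _ (i - j)).
suff -> : a * p ^+ (i - j) = 1 by rewrite subrr mul0r.
by apply: (mulIf (expf_neq0 j p0)); rewrite mul1r -mulrA -exprD subnK // ltnW.
Qed.

Lemma theta_div_eq0 x y : x != 0 -> y != 0 ->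
  theta x p = 0 -> theta y p = 0 -> theta (x / y) p = 0.
Proof.
move=> x0 y0 /(theta_eq0P x0) hx /(theta_eq0P y0) hy.
apply/theta_eq0P; first by rewrite mulf_neq0 ?invr_eq0.
case: hx hy => [->|[p0 [i [j h]]]] [->|[p0' [k [l h']]]].
- by left; rewrite divr1.
- right; split=> //; exists l, k; rewrite -h'; field.
  by rewrite y0.
- by right; split=> //; exists i, j; rewrite divr1.
- right; split=> //; exists (i + l)%N, (j + k)%N.
  by rewrite !exprD -h -h'; field.
Qed.

Lemma expp_cvg0 a : (fun n => a * p ^+ n) @ \oo --> (0 : C^o).
Proof.
apply: (@ccvg_le _ _ _ (fun n => cmod a * r ^+ n)); last exact: geo_cvg0 cmodp_lt1.
by move=> n; rewrite subr0 cmodM cmodX.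
Qed.

(** The factors of the partial products at a and 1 / a agree up to a shift, which
    leaves the quotient (1 - 1 / a) / (1 - a) = - 1 / a in the limit. *)
Lemma thetaV a : a != 0 -> theta a^-1 p = - (theta a p / a).
Proof.
move=> a0; have [->|a1] := eqVneq a 1; first by rewrite invr1 theta1 mul0r oppr0.
have part n : theta_partial a^-1 n * ((1 - a^-1 * p ^+ n) * (1 - a)) =
    (1 - a^-1) * (1 - a * p ^+ n) * theta_partial a n.
  rewrite /theta_partial !big_split /= invrK.
  have h1 : \prod_(0 <= j < n) (1 - a^-1 * p ^+ j) * (1 - a^-1 * p ^+ n)
          = (1 - a^-1) * \prod_(0 <= j < n) (1 - p ^+ j.+1 / a).
    rewrite -(big_nat_recr n _ (fun j => 1 - a^-1 * p ^+ j)) //=.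
    rewrite big_nat_recl //= expr0 mulr1; congr (_ * _).
    by apply: eq_bigr => j _; rewrite mulrC.
  have h2 : \prod_(0 <= j < n) (1 - a * p ^+ j) * (1 - a * p ^+ n)
          = (1 - a) * \prod_(0 <= j < n) (1 - p ^+ j.+1 * a).
    rewrite -(big_nat_recr n _ (fun j => 1 - a * p ^+ j)) //=.
    rewrite big_nat_recl //= expr0 mulr1; congr (_ * _).
    by apply: eq_bigr => j _; rewrite mulrC.
  move: h1 h2.
  move: (\prod_(0 <= j < n) (1 - a^-1 * p ^+ j)) => X1.
  move: (\prod_(0 <= j < n) (1 - p ^+ j.+1 / a)) => X2.
  move: (\prod_(0 <= j < n) (1 - a * p ^+ j)) => X3.
  move: (\prod_(0 <= j < n) (1 - p ^+ j.+1 * a)) => X4 h1 h2.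
  transitivity ((X1 * (1 - a^-1 * p ^+ n)) * ((1 - a) * X4)); first by ring.
  by rewrite h1 -h2; ring.
have lim1 b : (fun n => 1 - b * p ^+ n) @ \oo --> (1 : C^o).
  rewrite -[X in _ --> X](subr0 (1 : C)).
  exact: ccvgB (@ccvg_cst _ 1) (@expp_cvg0 b).
have L : (fun n => theta_partial a^-1 n * ((1 - a^-1 * p ^+ n) * (1 - a))) @ \oo
    --> (theta a^-1 p * (1 * (1 - a)) : C^o).
  by apply: ccvgM (@theta_cvg _) (ccvgM (@lim1 _) (@ccvg_cst _ _)).
have L' : (fun n => (1 - a^-1) * (1 - a * p ^+ n) * theta_partial a n) @ \oo
    --> ((1 - a^-1) * 1 * theta a p : C^o).
  by apply: ccvgM (ccvgM (@ccvg_cst _ _) (@lim1 _)) (@theta_cvg _).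
move: L; rewrite (_ : (fun n => _)
  = (fun n => (1 - a^-1) * (1 - a * p ^+ n) * theta_partial a n)); last first.
  by apply/funext => n; rewrite part.
move=> L; have := ccvg_unique L L'; rewrite mul1r mulr1 => E.
have a1' : 1 - a != 0 by rewrite subr_eq0 eq_sym.
by apply: (mulIf a1'); rewrite E; field.
Qed.

Lemma theta_lipschitz a b (A B : R) : 0 <= A -> 0 <= B ->
  cmod a <= A -> cmod b <= A -> cmod a^-1 <= B -> cmod b^-1 <= B -> a != 0 -> b != 0 ->
  cmod (theta a p - theta b p) <=
  expR ((A + B + 1) / (1 - r)) * ((cmod (a - b) + cmod (a^-1 - b^-1)) / (1 - r)).
Proof.
move=> A0 B0 aA bA aB bB a0 b0.
apply: (ccvg_cmod_le (ccvgB (@theta_cvg a) (@theta_cvg b))) => n.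
rewrite !theta_partialE; apply: geo_prod_dist.
- exact: cmodp_lt1.
- by rewrite !addr_ge0.
- by rewrite addr_ge0 ?cmod_ge0.
- by move=> j; apply: theta_eps_le.
- by move=> j; apply: theta_eps_le.
move=> j; rewrite /theta_eps !divff //.
rewrite (_ : - (a * p ^+ j) - p ^+ j.+1 / a + 1 * p ^+ (2 * j).+1 -
  (- (b * p ^+ j) - p ^+ j.+1 / b + 1 * p ^+ (2 * j).+1) =
  - ((a - b) * p ^+ j) - p ^+ j.+1 * (a^-1 - b^-1)); last first.
  by move: (p ^+ j) (p ^+ j.+1) (p ^+ (2 * j).+1) => x y z; ring.
apply: le_trans (cmodD _ _) _; rewrite !cmodN !cmodM !cmodX mulrDl; apply: lerD => //.
rewrite mulrC; apply: ler_wpM2l; first exact: cmod_ge0.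
exact: cmodp_exp_le.
Qed.

(** The Lipschitz estimate is uniform for a and 1 / a in bounded sets. *)
Lemma theta_continuous (u : nat -> C) (a : C) : a != 0 -> u @ \oo --> (a : C^o) ->
  (fun n => theta (u n) p) @ \oo --> (theta a p : C^o).
Proof.
move=> a0 ua; have ua' := ccvgV a0 ua.
have [A A0 hA] := ccvg_bounded ua; have [B B0 hB] := ccvg_bounded ua'.
have aA := ccvg_cmod_le ua hA; have aB := ccvg_cmod_le ua' hB.
pose K := expR ((A + B + 1) / (1 - r)).
pose e n := K * ((cmod (u n - a) + cmod ((u n)^-1 - a^-1)) / (1 - r)).
apply: (@ccvg_le_near _ _ _ e).
  have [N _ hN] := ccvg_neq0 a0 ua.
  by exists N => // n /hN /= un; apply: theta_lipschitz.
rewrite -[X in _ --> X](mulr0 K); apply: cvgMr.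
rewrite -[X in _ --> X](mul0r (1 - r)^-1); apply: cvgMl.
rewrite -[X in _ --> X](addr0 (0 : R)); apply: cvgD; exact/ccvgP.
Qed.

(** Scaling factors that tend to 1 and have modulus larger than 1. *)
Definition nudge (n : nat) : C := (1 + n.+1%:R^-1)%:C%C.

Lemma cmod_nudge n : cmod (nudge n) = 1 + n.+1%:R^-1.
Proof. by rewrite cmod_real ger0_norm // addr_ge0 // invr_ge0 ler0n. Qed.

Lemma nudge_neq0 n : nudge n != 0.
Proof. by rewrite -cmod_eq0 cmod_nudge gt_eqF // ltr_wpDr // invr_ge0 ler0n. Qed.

Lemma nudge_cvg : nudge @ \oo --> (1 : C^o).
Proof.
apply: (@ccvg_le _ _ _ (fun n => n.+1%:R^-1)).
  move=> n; rewrite /nudge rmorphD /= addrAC subrr add0r cmod_real.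
  by rewrite ger0_norm // invr_ge0 ler0n.
exact: cvg_harmonic.
Qed.

(** For p nonzero the moduli of the zeros are integral powers of |p|.  If a is a
    zero, then the modulus of the scaled argument lies strictly between two
    consecutive powers as soon as the scaling factor is below 1 / |p|. *)
Lemma theta_nudge_neq0 a k : a != 0 ->
  \forall n \near \oo, theta (a * nudge n ^+ k.+1) p != 0.
Proof.
move=> a0.
have cvg_a : (fun n => a * nudge n ^+ k.+1) @ \oo --> (a : C^o).
  have := ccvgM (@ccvg_cst _ a) (ccvgX (k := k.+1) nudge_cvg).
  by rewrite expr1n mulr1.
have nudge1 n : 1 < cmod (nudge n ^+ k.+1).
  by rewrite cmodX exprn_egt1 // cmod_nudge ltrDl invr_gt0 ltr0n.
have [ta|ta] := eqVneq (theta a p) 0; last first.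
  exact: ccvg_neq0 ta (theta_continuous a0 cvg_a).
have an0 n : a * nudge n ^+ k.+1 != 0 by rewrite mulf_neq0 // expf_neq0 // nudge_neq0.
have [p0|p0] := eqVneq p 0.
  case: ((theta_eq0P a0).1 ta) => [a1|[]]; last by rewrite p0 eqxx.
  exists 0%N => // n _ /=; apply/eqP => /(theta_eq0P (an0 n)) [|[]];
    last by rewrite p0 eqxx.
  rewrite a1 mul1r => h.
  by have := nudge1 n; rewrite h cmod1 ltxx.
have r0 : 0 < r by rewrite lt_neqAle eq_sym cmod_eq0 p0 cmod_ge0.
have /andP[_ r1] := cmodp_lt1.
have [i [j aij]] : exists i j, a * p ^+ i = p ^+ j.
  move/(theta_eq0P a0): ta => [->|[_ //]].
  by exists 0%N, 0%N; rewrite mul1r.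
have small : \forall n \near \oo, cmod (nudge n ^+ k.+1) * r < 1.
  have /ccvgP h := ccvgX (k := k.+1) nudge_cvg.
  have e0 : 0 < r^-1 - 1 by rewrite subr_gt0 invf_gt1.
  have [N _ hN] := (@cvgrPdist_lt R R^o nat \oo eventually_filter _ 0).1 h _ e0.
  exists N => // n /hN /=; rewrite sub0r normrN ger0_norm ?cmod_ge0 // expr1n => hn.
  rewrite -ltr_pdivlMr // mul1r -[nudge n ^+ _](subrK 1).
  by apply: le_lt_trans (cmodD _ _) _; rewrite cmod1 -ltrBrDr.
case: small => N _ hN; exists N => // n /hN /= hn.
apply/eqP => /(theta_eq0P (an0 n)) h.
have [i' [j' aij']] : exists i j, a * nudge n ^+ k.+1 * p ^+ i = p ^+ j.
  by case: h => [->|[_ //]]; exists 0%N, 0%N; rewrite mul1r.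
have E : cmod (nudge n ^+ k.+1) * r ^+ (i' + j) = r ^+ (i + j').
  rewrite -!cmodX -cmodM; congr cmod.
  by rewrite !exprD -aij -aij'; ring.
have [le|lt] := leqP (i' + j) (i + j').
  have : cmod (nudge n ^+ k.+1) = r ^+ (i + j' - (i' + j)).
    by apply: (mulIf (lt0r_neq0 (exprn_gt0 (i' + j) r0))); rewrite E -exprD subnK.
  move=> E'; have := nudge1 n; rewrite E' ltNge exprn_ile1 // ltW //.
have : cmod (nudge n ^+ k.+1) * r ^+ (i' + j - (i + j')) = 1.
  by apply: (mulIf (lt0r_neq0 (exprn_gt0 (i + j') r0)));
    rewrite -mulrA -exprD subnK ?mul1r // ltnW.
case Ed : (i' + j - (i + j'))%N => [|m]; first by move: lt; rewrite -subn_gt0 Ed.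
move=> E'; have : cmod (nudge n ^+ k.+1) * r ^+ m.+1 < 1.
  apply: le_lt_trans hn; apply: ler_wpM2l; first exact: cmod_ge0.
  by rewrite -[leRHS]expr1; apply: cmodp_exp_le.
by rewrite E' ltxx.
Qed.

Lemma theta_nudgeV_neq0 a k : a != 0 ->
  \forall n \near \oo, theta (a / nudge n ^+ k.+1) p != 0.
Proof.
move=> a0; have aV : a^-1 != 0 by rewrite invr_eq0.
have [N _ hN] := @theta_nudge_neq0 a^-1 k aV; exists N => // n /hN /= h.
have nz : a^-1 * nudge n ^+ k.+1 != 0 by rewrite mulf_neq0 // expf_neq0 // nudge_neq0.
rewrite (_ : a / nudge n ^+ k.+1 = (a^-1 * nudge n ^+ k.+1)^-1);
  last by rewrite invfM invrK.
by rewrite thetaV // oppr_eq0 mulf_neq0 // invr_eq0.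
Qed.

End Theta.

(** * The finite triple product *)

Section FiniteTriple.
Variables (K : fieldType) (p : K).
Hypothesis pn1 : forall k, p ^+ k.+1 != 1.

Definition euler (k : nat) : K := \prod_(0 <= j < k) (1 - p ^+ j.+1).

Lemma euler0 : euler 0 = 1. Proof. by rewrite /euler big_geq. Qed.

Lemma eulerS k : euler k.+1 = euler k * (1 - p ^+ k.+1).
Proof. by rewrite /euler big_nat_recr. Qed.

Lemma euler_neq0 k : euler k != 0.
Proof.
rewrite /euler prodf_seq_neq0; apply/allP => j _ /=.
by rewrite subr_eq0 eq_sym pn1.
Qed.

(** The Gaussian binomial coefficient with base p; the value 0 beyond the row
    makes the Pascal rule [gaussSS] hold at its right end. *)
Definition gauss (n k : nat) : K :=
  if (k <= n)%N then euler n / (euler k * euler (n - k)) else 0.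

Lemma gaussn0 n : gauss n 0 = 1.
Proof. by rewrite /gauss leq0n subn0 euler0 mul1r divff // euler_neq0. Qed.

Lemma gauss_out n : gauss n n.+1 = 0. Proof. by rewrite /gauss ltnn. Qed.

Lemma gaussSS n k : gauss n.+1 k.+1 = gauss n k.+1 + p ^+ (n - k) * gauss n k.
Proof.
rewrite /gauss ltnS subSS; case: (ltngtP k n) => [kn|kn|->]; last first.
- rewrite subnn expr0 mul1r add0r euler0 !mulr1.
  by rewrite !divff // euler_neq0.
- by rewrite mulr0 addr0.
have -> : (n - k)%N = (n - k.+1).+1 by rewrite subnSK.
rewrite !eulerS; have [h1 h2] := (euler_neq0 k, euler_neq0 (n - k.+1)).
have f1 : 1 - p ^+ k.+1 != 0 by rewrite subr_eq0 eq_sym.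
have f2 : 1 - p ^+ (n - k.+1).+1 != 0 by rewrite subr_eq0 eq_sym.
have -> : p ^+ n.+1 = p ^+ k.+1 * p ^+ (n - k.+1).+1.
  by rewrite -exprD; congr (_ ^+ _); lia.
by field; rewrite h1 h2 f1 f2.
Qed.

Lemma q_binomial n z : \prod_(0 <= i < n) (1 + z * p ^+ i) =
  \sum_(0 <= k < n.+1) p ^+ 'C(k, 2) * gauss n k * z ^+ k.
Proof.
elim: n => [|n IH].
  by rewrite big_geq // big_nat1 gaussn0 expr0 !mulr1.
rewrite big_nat_recr //= IH mulrDr mulr1.
rewrite [RHS]big_nat_recl // gaussn0 expr0 !mulr1 bin0n expr0.
have S1 : \sum_(0 <= k < n.+1) p ^+ 'C(k, 2) * gauss n k * z ^+ k =
  1 + \sum_(0 <= k < n.+1) p ^+ 'C(k.+1, 2) * gauss n k.+1 * z ^+ k.+1.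
  rewrite big_nat_recl // gaussn0 expr0 !mulr1 bin0n expr0; congr (_ + _).
  by rewrite [RHS]big_nat_recr //= gauss_out mulr0 mul0r addr0.
rewrite {1}S1 -addrA; congr (_ + _).
rewrite mulr_suml -big_split; apply: eq_big_nat => k /andP[_]; rewrite ltnS => kn /=.
rewrite gaussSS binS bin1 exprS exprD.
have -> : p ^+ n = p ^+ k * p ^+ (n - k) by rewrite -exprD subnKC.
by ring.
Qed.

End FiniteTriple.

(** The number n (n - 1) / 2 for an integer n, see [triE]. *)
Definition tri (n : int) : nat :=
  match n with Posz m => 'C(m, 2) | Negz m => 'C(m.+2, 2) end.

Lemma bin2_double m : ('C(m, 2) * 2 = m * m.-1)%N.
Proof. by rewrite -[X in (_ * X)%N]/(2`!) bin_ffact ffactnS ffactn1. Qed.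

Lemma triE n : (tri n)%:Z * 2 = n * (n - 1).
Proof.
case: n => m; rewrite /tri.
  by have := bin2_double m; case: m => [|m] /=; lia.
by have := bin2_double m.+2; rewrite NegzE /=; lia.
Qed.

Definition int_range (M : nat) : seq int := [seq k%:Z - M%:Z | k <- iota 0 (2 * M).+1].

Lemma mem_int_range M n : (n \in int_range M) = (`|n| <= M)%N.
Proof.
apply/mapP/idP => [[k]|nM]; first by rewrite mem_iota => h ->; lia.
by exists (absz (n + M%:Z)); rewrite ?mem_iota; lia.
Qed.

Lemma int_range_uniq M : uniq (int_range M).
Proof. by rewrite map_inj_uniq ?iota_uniq // => i j; lia. Qed.

Section TripleProduct.
Variables (K : fieldType) (p : K).
Hypothesis pn1 : forall k, p ^+ k.+1 != 1.
Hypothesis p0 : p != 0.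

Definition theta_coef (n : int) : K := (-1) ^ n * p ^+ tri n.

(** The [q_binomial] theorem for 2 M factors whose exponents are centred at 0. *)
Lemma finite_triple_product (a : K) M : a != 0 ->
  \prod_(0 <= j < M) ((1 - a * p ^+ j) * (1 - p ^+ j.+1 / a)) =
  \sum_(n <- int_range M) gauss p (2 * M) (absz (n + M%:Z)) * (theta_coef n * a ^ n).
Proof.
move=> a0; rewrite big_map.
have -> : \prod_(0 <= j < M) ((1 - a * p ^+ j) * (1 - p ^+ j.+1 / a)) =
   (\prod_(0 <= j < M) - (a / p ^+ j.+1))^-1 *
   \prod_(0 <= i < 2 * M) (1 + - (a / p ^+ M) * p ^+ i).
  rewrite [X in _ = _ * X](big_cat_nat (n := M)) //=; last by lia.
  have sh (F : nat -> K) : \prod_(M <= i < 2 * M) F i = \prod_(0 <= i < M) F (i + M)%N.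
    by rewrite -{1}[M]add0n big_addn mul2n -addnn addnK.
  rewrite sh.
  rewrite [X in _ = _ * (X * _)]big_nat_rev /= big_split /= mulrC mulrA;
    congr (_ * _); last first.
    apply: eq_bigr => j _; rewrite exprD mulNr; congr (1 - _).
    by field; rewrite expf_neq0.
  rewrite -prodfV -big_split; apply: eq_big_nat => j /andP[_ jM] /=.
  rewrite add0n.
  have -> : p ^+ M = p ^+ (M - j.+1) * p ^+ j.+1 by rewrite -exprD subnK.
  have pj : p ^+ j.+1 != 0 by rewrite expf_neq0.
  have pm : p ^+ (M - j.+1) != 0 by rewrite expf_neq0.
  by field; rewrite oppr_eq0 a0 pj pm.
rewrite q_binomial // mulr_sumr [RHS](_ : _ = \sum_(0 <= k < (2 * M).+1)
  gauss p (2 * M) (absz (k%:Z - M%:Z + M%:Z))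
    * (theta_coef (k%:Z - M%:Z) * a ^ (k%:Z - M%:Z))); last first.
  by rewrite /index_iota subn0.
apply: eq_big_nat => k _.
have -> : absz (k%:Z - M%:Z + M%:Z) = k by lia.
have -> : \prod_(0 <= j < M) - (a / p ^+ j.+1) = (- a) ^+ M / p ^+ 'C(M.+1, 2).
  elim: (M) => [|m IH]; first by rewrite big_geq // bin_small // !expr0 divr1.
  rewrite big_nat_recr //= IH (binS m.+1 1) bin1 exprD [(- a) ^+ m.+1]exprS.
  by field; rewrite !expf_neq0.
(* Completing the square in the exponent of p. *)
have tk : (tri (k%:Z - M%:Z) + M * k = 'C(k, 2) + 'C(M.+1, 2))%N.
  have := triE (k%:Z - M%:Z); have := bin2_double k; have := bin2_double M.+1.
  by case: k => [|k] /=; nia.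
have ptk : p ^+ tri (k%:Z - M%:Z) * (p ^+ M) ^+ k = p ^+ 'C(k, 2) * p ^+ 'C(M.+1, 2).
  by rewrite -exprM -!exprD tk.
have intE (b : K) : b != 0 -> b ^ (k%:Z - M%:Z) = b ^+ k / b ^+ M.
  by move=> b0; rewrite expfzDr // -exprnN.
have N1 : -1 != 0 :> K by rewrite oppr_eq0 oner_eq0.
rewrite /theta_coef !intE // -mulNr expr_div_n ![(- a) ^+ _]exprNn.
have pt0 : p ^+ tri (k%:Z - M%:Z) != 0 by rewrite expf_neq0.
have -> : p ^+ tri (k%:Z - M%:Z) = p ^+ 'C(k, 2) * p ^+ 'C(M.+1, 2) / (p ^+ M) ^+ k.
  by rewrite -ptk mulfK // !expf_neq0.
have aM : a ^+ M != 0 by rewrite expf_neq0.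
have pM : (p ^+ M) ^+ k != 0 by rewrite !expf_neq0.
have pC : p ^+ 'C(M.+1, 2) != 0 by rewrite expf_neq0.
have sM : (-1) ^+ M != 0 :> K by rewrite expf_neq0.
move: aM pM pC sM; move: (a ^+ M) ((p ^+ M) ^+ k) (p ^+ 'C(M.+1, 2)) ((-1) ^+ M : K).
by move=> x y z w x0 y0 z0 w0; field; rewrite x0 y0 z0 w0.
Qed.

End TripleProduct.

(** * The Jacobi triple product *)

Lemma big_int_rangeS (V : nmodType) (F : int -> V) M :
  \sum_(n <- int_range M.+1) F n =
  F (M.+1)%:Z + F (- (M.+1)%:Z) + \sum_(n <- int_range M) F n.
Proof.
rewrite (perm_big [:: M.+1%:Z, - M.+1%:Z & int_range M]).
  by rewrite 2!big_cons; exact: addrA.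
apply: uniq_perm => [||n]; first exact: int_range_uniq.
  rewrite 2!cons_uniq int_range_uniq andbT in_cons !mem_int_range.
  by apply/andP; split; lia.
by rewrite mem_int_range 2!in_cons mem_int_range; lia.
Qed.

Section TripleLimit.
Variable R : realType.
Local Notation C := R[i].

Lemma sum_int_range_geo_le (r : R) M : 0 <= r < 1 ->
  \sum_(n <- int_range M) r ^+ `|n|%N <= 2 / (1 - r).
Proof.
move=> r01; have /andP[r0 r1] := r01.
apply: (@le_trans _ _ (2 * \sum_(0 <= k < M.+1) r ^+ k)); last first.
  by apply: ler_wpM2l => //; apply: geo_sum_le.
elim: M => [|M IH].
  by rewrite big_nat1 expr0 mulr1 /int_range /= big_seq1 /= ler1n.
rewrite big_int_rangeS [in leRHS]big_nat_recr //= mulrDr addrC; apply: lerD => //.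
by rewrite /= mulr2n mulrDl mul1r.
Qed.

(** The ratio of consecutive terms is b r^m, which is eventually below 1. *)
Lemma gaussian_bound (r b : R) : 0 <= r < 1 -> 0 <= b ->
  exists2 B : R, 0 <= B & forall m, r ^+ 'C(m, 2) * b ^+ m <= B.
Proof.
move=> r01 b0; have /andP[r0 r1] := r01.
pose w m := r ^+ 'C(m, 2) * b ^+ m.
have w0 m : 0 <= w m by rewrite mulr_ge0 // exprn_ge0.
have wS m : w m.+1 = w m * (b * r ^+ m).
  by rewrite /w binS bin1 exprD exprS; ring.
have [N _ hN] := (@cvgrPdist_lt R R^o nat \oo eventually_filter _ 0).1
  (@geo_cvg0 R b r r01) _ ltr01.
exists (\sum_(0 <= j < N.+1) w j); first by apply: sumr_ge0.
have le_small m : (m <= N)%N -> w m <= \sum_(0 <= j < N.+1) w j.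
  move=> mN; rewrite (bigD1_seq m) ?mem_index_iota ?iota_uniq //= lerDl.
  by apply: sumr_ge0.
move=> m; rewrite -/(w m); have [mN|/ltnW Nm] := leqP m N; first exact: le_small.
apply: le_trans (le_small N (leqnn N)).
rewrite -(subnKC Nm); elim: (m - N)%N => [|k IH]; first by rewrite addn0.
rewrite addnS wS; apply: le_trans IH; rewrite -[leRHS]mulr1; apply: ler_wpM2l => //.
have /= := hN (N + k)%N (leq_addr k N); rewrite sub0r normrN => h.
exact: le_trans (ler_norm _) (ltW h).
Qed.

Lemma cmodXz (z : C) (n : int) : cmod (z ^ n) = cmod z ^ n.
Proof. by case: n => m; rewrite /exprz ?cmodV cmodX. Qed.

Variable p : C.
Hypothesis p_lt1 : `|p| < 1.
Hypothesis p0 : p != 0.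
Let r := cmod p.
Let r01 : 0 <= r < 1 := cmodp_lt1 p_lt1.

Lemma cmodp_gt0 : 0 < r.
Proof. by rewrite lt_neqAle eq_sym cmod_eq0 p0 cmod_ge0. Qed.

Lemma expp_neq1 k : p ^+ k.+1 != 1.
Proof.
apply/eqP => h; have : cmod (p ^+ k.+1) < 1.
  by rewrite cmodX; case/andP: r01 => r0 r1; rewrite exprn_ilt1.
by rewrite h cmod1 ltxx.
Qed.

(** One constant G serves all the bounds, which lets [triple_product] multiply
    them; the rate is that of the first missing factor. *)
Lemma euler_cvg : exists2 l : C, l != 0 &
  exists2 G : R, 0 <= G & (euler p @ \oo --> (l : C^o)) /\
  (forall k, cmod (euler p k) <= G) /\
  (forall k, (cmod (euler p k))^-1 <= G) /\ cmod l <= G /\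
  forall k, cmod (euler p k - l) <= G * r ^+ k.
Proof.
have zB j : cmod (- p ^+ j.+1) <= 1 * r ^+ j.
  by rewrite cmodN cmodX mul1r -/r; exact: (cmodp_exp_le p_lt1).
have [l hl] := geo_prod_cvg r01 ler01 zB.
have nz j : 1 + - p ^+ j.+1 != 0 by rewrite subr_eq0 eq_sym expp_neq1.
have l0 := geo_prod_cvg_neq0 r01 ler01 zB nz hl.
have {}hl : euler p @ \oo --> (l : C^o) by [].
have [G1 G10 hG1] := ccvg_bounded hl.
have [G2 G20 hG2] := ccvg_bounded (ccvgV l0 hl).
have lG1 := ccvg_cmod_le hl hG1.
have /andP[r0 r1] := r01.
have r1' : 0 < 1 - r by rewrite subr_gt0.
have rate k : cmod (euler p k - l) <= G1 / (1 - r) * r ^+ k.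
  rewrite cmodB.
  apply: (ccvg_cmod_le_from (N0 := k) (ccvgB hl (@ccvg_cst _ (euler p k)))) => n kn.
  have -> : euler p n - euler p k = \sum_(k <= j < n) (- (euler p j * p ^+ j.+1)).
    rewrite -(telescope_sumr (euler p) kn); apply: eq_bigr => j _.
    by rewrite eulerS; ring.
  apply: le_trans (cmod_sum _ _ _) _.
  apply: (@le_trans _ _ (\sum_(k <= j < n) G1 * r ^+ j)).
    apply: ler_sum => j _; rewrite cmodN cmodM cmodX; apply: ler_pM => //;
      rewrite ?cmod_ge0 //.
      by rewrite exprn_ge0.
    exact: (cmodp_exp_le p_lt1).
  rewrite -mulr_sumr -mulrA; apply: ler_wpM2l => //.
  rewrite -{1}[k]add0n big_addn mulrC.
  under eq_bigr do rewrite addnC exprD.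
  rewrite -mulr_sumr; apply: ler_wpM2l; first exact: exprn_ge0.
  exact: geo_sum_le.
have rV : 0 <= G1 / (1 - r) by rewrite divr_ge0 // ltW.
exists l => //; exists (G1 + G2 + G1 / (1 - r)); first by rewrite !addr_ge0.
split=> //; split; [|split; [|split]].
- by move=> k; apply: le_trans (hG1 k) _; rewrite -addrA lerDl addr_ge0.
- by move=> k; rewrite -cmodV; apply: le_trans (hG2 k) _; rewrite addrAC lerDr addr_ge0.
- by apply: le_trans lG1 _; rewrite -addrA lerDl addr_ge0.
move=> k; apply: le_trans (rate k) _; apply: ler_wpM2r; first exact: exprn_ge0.
by rewrite lerDr addr_ge0.
Qed.

(** The Gaussian decay of the coefficients beats the growth of a^n with a
    geometric factor to spare.  The factor r^2, rather than r, pays both for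
    the approximation error in [triple_product] and for the truncation of the
    double series in [tail_sum_cvg0]. *)
Lemma theta_coef_bound a : a != 0 -> exists2 B : R, 0 <= B &
  forall n, cmod (theta_coef p n * a ^ n) <= B * (r ^+ 2) ^+ `|n|%N.
Proof.
move=> a0; pose al := cmod a + cmod a^-1.
have al0 : 0 <= al by rewrite addr_ge0 ?cmod_ge0.
have r20 : 0 < r ^+ 2 by rewrite exprn_gt0 // cmodp_gt0.
have [|B B0 hB] := @gaussian_bound r (al / r ^+ 2) r01; first by rewrite divr_ge0 // ltW.
exists B => // n; apply: (@le_trans _ _ (r ^+ 'C(`|n|%N, 2) * al ^+ `|n|%N)); last first.
  by have := hB `|n|%N; rewrite expr_div_n mulrA ler_pdivrMr //; apply: exprn_gt0.
rewrite /theta_coef !cmodM !cmodXz cmodN cmod1 exp1rz mul1r cmodX.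
apply: ler_pM; rewrite ?exprn_ge0 ?exprz_ge0 ?cmod_ge0 //.
  apply: (cmodp_exp_le p_lt1); case: n => m //=.
  by rewrite [in leqRHS]binS leq_addr.
case: n => m; rewrite /exprz /=.
  by apply: lerXn2r; rewrite ?nnegrE ?cmod_ge0 // lerDl cmod_ge0.
rewrite -exprVn -cmodV.
by apply: lerXn2r; rewrite ?nnegrE ?cmod_ge0 // lerDr cmod_ge0.
Qed.

(** The passage to the limit in [finite_triple_product].  The Gaussian binomials
    tend to 1 / l, where l is the limit of [euler p], at the rate r^(M - |n|);
    against coefficients of size r^(2 |n|) the total error is of order r^M. *)
Lemma triple_product : exists2 kap : C, kap != 0 & forall a, a != 0 ->
  (fun M => \sum_(n <- int_range M) theta_coef p n * a ^ n) @ \oo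
    --> (kap * theta a p : C^o).
Proof.
have [l l0 [G G0 [hl [hG [hGV [lG hrate]]]]]] := euler_cvg.
exists l; first exact: l0.
move=> a a0; have [B B0 hB] := theta_coef_bound a0.
have /andP[r0 r1] := r01.
have e0 k : euler p k != 0 by apply: euler_neq0 expp_neq1 _.
(* Gaussian binomials are close to the inverse Euler product away from the
   ends of their row. *)
have gauss_rate M n : (`|n|%N <= M)%N ->
    cmod (1 - l * gauss p (2 * M) (absz (n + M%:Z))) <= 3 * G ^+ 4 * r ^+ (M - `|n|%N).
  move=> nM; rewrite /gauss; have -> : (absz (n + M%:Z)%R <= 2 * M)%N by lia.
  set i := absz (n + M%:Z); set j := (2 * M - i)%N; set s := (M - `|n|%N)%N.
  have [si sj s2] : [/\ s <= i, s <= j & s <= 2 * M]%N by rewrite /s /i /j; split; lia.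
  have small k : (s <= k)%N -> cmod (euler p k - l) <= G * r ^+ s.
    by move=> sk; apply: le_trans (hrate k) _; apply: ler_wpM2l => //;
      apply: (cmodp_exp_le p_lt1).
  rewrite (_ : 1 - _ = ((l * (l - euler p (2 * M)) + (euler p j - l) * l
      + euler p j * (euler p i - l))) * ((euler p i)^-1 * (euler p j)^-1)); last first.
    by field; rewrite !e0.
  rewrite !cmodM !cmodV.
  have GG : 0 <= G * (G * r ^+ s) by rewrite !mulr_ge0 // exprn_ge0.
  rewrite (_ : 3 * G ^+ 4 * r ^+ s = (3 * (G * (G * r ^+ s))) * (G * G)); last by ring.
  apply: ler_pM; rewrite ?cmod_ge0 ?mulr_ge0 ?invr_ge0 ?cmod_ge0 //; last first.
    by apply: ler_pM; rewrite ?invr_ge0 ?cmod_ge0.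
  rewrite (_ : 3 * (G * (G * r ^+ s)) =
    G * (G * r ^+ s) + G * (G * r ^+ s) + G * (G * r ^+ s)); last by ring.
  apply: le_trans (cmodD _ _) _; apply: lerD; last first.
    by rewrite cmodM; apply: ler_pM; rewrite ?cmod_ge0 ?small.
  apply: le_trans (cmodD _ _) _; rewrite !cmodM; apply: lerD.
    by apply: ler_pM; rewrite ?cmod_ge0 // cmodB small.
  by rewrite mulrC; apply: ler_pM; rewrite ?cmod_ge0 ?small.
pose err M := \sum_(n <- int_range M)
  (1 - l * gauss p (2 * M) (absz (n + M%:Z))) * (theta_coef p n * a ^ n).
have err0 : err @ \oo --> (0 : C^o).
  pose D := 3 * G ^+ 4 * B * (2 / (1 - r)).
  apply: (@ccvg_le _ _ _ (fun M => D * r ^+ M)); last exact: geo_cvg0.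
  move=> M; rewrite subr0; apply: le_trans (cmod_sum _ _ _) _.
  apply: (@le_trans _ _ (\sum_(n <- int_range M) 3 * G ^+ 4 * B * r ^+ M * r ^+ `|n|%N)).
    rewrite big_seq [leRHS]big_seq; apply: ler_sum => n; rewrite mem_int_range => nM.
    rewrite cmodM.
    rewrite (_ : _ * r ^+ `|n|%N = (3 * G ^+ 4 * r ^+ (M - `|n|%N))
      * (B * (r ^+ 2) ^+ `|n|%N)).
      by apply: ler_pM; rewrite ?cmod_ge0 ?gauss_rate.
    rewrite -{1}(subnK nM) exprD -exprM mul2n -addnn exprD; ring.
  rewrite -mulr_sumr /D [leRHS]mulrAC; apply: ler_wpM2l; last exact: sum_int_range_geo_le.
  by rewrite !mulr_ge0 // exprn_ge0.
have := ccvgD (ccvgM (@ccvg_cst _ l) (@theta_cvg _ _ p_lt1 a)) err0.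
rewrite addr0; suff -> : (fun M => l * theta_partial p a M + err M) =
  (fun M => \sum_(n <- int_range M) theta_coef p n * a ^ n) by [].
apply/funext => M; rewrite /theta_partial finite_triple_product //; last exact: expp_neq1.
by rewrite mulr_sumr -big_split; apply: eq_bigr => n _ /=; ring.
Qed.

End TripleLimit.

(** * The three-term relation *)

Definition int_square (M : nat) : seq (int * int) :=
  [seq (m, n) | m <- int_range M, n <- int_range M].

(** The index pairs (m, n) = (u + v, u - v) and (u + v, u - v + 1), which are
    those with m + n even and odd, for u and v in a bounded range. *)
Definition diamond (L : nat) : seq (int * int) :=
  [seq (u + v, u - v) | u <- int_range L, v <- int_range L] ++
  [seq (u + v, u - v + 1) | u <- int_range L, v <- int_range L].

Lemma mem_int_square M k : (k \in int_square M) = (`|k.1|%N <= M)%N && (`|k.2|%N <= M)%N.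
Proof.
apply/allpairsP/idP => [[[m n] /= [hm hn ->]]|/andP[h1 h2]].
  by move: hm hn; rewrite !mem_int_range /= => -> ->.
by exists k; split; rewrite ?mem_int_range //; case: k {h1 h2}.
Qed.

Lemma int_square_uniq M : uniq (int_square M).
Proof.
by apply: allpairs_uniq; rewrite ?int_range_uniq // => -[a b] [c d] _ _ /=.
Qed.

Lemma diamond_uniq L : uniq (diamond L).
Proof.
rewrite cat_uniq; apply/and3P; split.
- apply: allpairs_uniq; rewrite ?int_range_uniq // => -[a b] [c d] _ _ /= [h1 h2].
  by congr (_, _); lia.
- apply/hasPn => k /allpairsP[[u v] [_ _ ->]]; apply/negP.
  by case/allpairsP => -[u' v'] [_ _ []] /=; lia.
- apply: allpairs_uniq; rewrite ?int_range_uniq // => -[a b] [c d] _ _ /= [h1 h2].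
  by congr (_, _); lia.
Qed.

Lemma diamond_sub L : {subset diamond L <= int_square (2 * L).+1}.
Proof.
move=> k; rewrite mem_cat => /orP[] /allpairsP[[u v] /= []];
  rewrite !mem_int_range => hu hv ->.
  by rewrite mem_int_square /=; apply/andP; split; lia.
by rewrite mem_int_square /=; apply/andP; split; lia.
Qed.

Lemma notin_diamond L k : k \notin diamond L -> (2 * L < `|k.1| + `|k.2|)%N.
Proof.
case: k => m n /= h; rewrite ltnNge; apply/negP => mnL; move/negP: h; apply.
rewrite mem_cat; apply/orP.
have w0 : 0 <= modz (m + n) 2 by apply: modz_ge0.
have w2 : modz (m + n) 2 < 2 by apply: ltz_pmod.
have := divz_eq (m + n) 2; set u := divz _ _ => e.
have [e0|e1] : modz (m + n) 2 = 0 \/ modz (m + n) 2 = 1 by lia.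
- left; apply/allpairsP; exists (u, m - u).
  by split; rewrite ?mem_int_range /=; try lia; congr (_, _); lia.
- right; apply/allpairsP; exists (u, m - u).
  by split; rewrite ?mem_int_range /=; try lia; congr (_, _); lia.
Qed.

Section DiamondTerms.
Variables (K : fieldType) (p x y : K).
Hypotheses (p0 : p != 0) (x0 : x != 0) (y0 : y != 0).

Lemma tri_even (u v : int) :
  (tri (u + v) + tri (u - v))%N%:Z = (2 * tri u)%N%:Z + (2 * tri v)%N%:Z + v.
Proof.
have := triE (u + v); have := triE (u - v).
by have := triE u; have := triE v; lia.
Qed.

Lemma tri_odd (u v : int) :
  (tri (u + v) + tri (u - v + 1))%N%:Z = (2 * tri u)%N%:Z + u + (2 * tri v)%N%:Z.
Proof.
have := triE (u + v); have := triE (u - v + 1).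
by have := triE u; have := triE v; lia.
Qed.

Lemma sign_sqr (n : int) : (-1) ^ n * (-1) ^ n = 1 :> K.
Proof. by rewrite -expfzMl mulrNN mulr1 exp1rz. Qed.

(** For m = u + v and n = u - v the exponents satisfy
    m (m - 1) / 2 + n (n - 1) / 2 = u (u - 1) + v^2, so that the product splits
    into a function of u and a function of v. *)
Lemma theta_coef_even u v :
  theta_coef p (u + v) * (x * y) ^ (u + v) * (theta_coef p (u - v) * (x / y) ^ (u - v))
  = theta_coef (p ^+ 2) u * (- x ^+ 2) ^ u
    * (theta_coef (p ^+ 2) v * (- (p * y ^+ 2)) ^ v).
Proof.
have m1 : -1 != 0 :> K by rewrite oppr_eq0 oner_eq0.
rewrite /theta_coef.
have e1 : p ^+ tri (u + v) * p ^+ tri (u - v) = (p ^+ 2) ^+ tri u * (p ^+ 2) ^+ tri v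
  * p ^ v.
  by rewrite -exprD -!exprM !exprnP -!expfzDr // tri_even.
have -> : - x ^+ 2 = -1 * x ^+ 2 by rewrite mulN1r.
have -> : - (p * y ^+ 2) = -1 * (p * y ^+ 2) by rewrite mulN1r.
rewrite !expfzMl !exprz_inv -!invr_expz !expfzDr // -!invr_expz.
transitivity (p ^+ tri (u + v) * p ^+ tri (u - v) * ((-1) ^ u * (-1) ^ u)
  * (x ^ u * x ^ u * (y ^ v * y ^ v)) * ((-1) ^ v * (-1) ^ v)).
  by rewrite (sign_sqr v) mulr1; field; rewrite !expfz_neq0.
by rewrite e1; ring.
Qed.

(** For m = u + v and n = u - v + 1 the exponents satisfy
    m (m - 1) / 2 + n (n - 1) / 2 = u^2 + v (v - 1). *)
Lemma theta_coef_odd u v :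
  theta_coef p (u + v) * (x * y) ^ (u + v)
    * (theta_coef p (u - v + 1) * (x / y) ^ (u - v + 1))
  = - (x / y) * (theta_coef (p ^+ 2) u * (- (p * x ^+ 2)) ^ u
    * (theta_coef (p ^+ 2) v * (- y ^+ 2) ^ v)).
Proof.
have m1 : -1 != 0 :> K by rewrite oppr_eq0 oner_eq0.
rewrite /theta_coef.
have e1 : p ^+ tri (u + v) * p ^+ tri (u - v + 1) = (p ^+ 2) ^+ tri u * p ^ u
  * (p ^+ 2) ^+ tri v.
  by rewrite -exprD -!exprM !exprnP -!expfzDr // tri_odd.
have -> : - y ^+ 2 = -1 * y ^+ 2 by rewrite mulN1r.
have -> : - (p * x ^+ 2) = -1 * (p * x ^+ 2) by rewrite mulN1r.
rewrite !expfzMl !exprz_inv -!invr_expz !expfzDr // -!invr_expz !expr1z.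
transitivity (- (x / y) * (p ^+ tri (u + v) * p ^+ tri (u - v + 1))
  * ((-1) ^ u * (-1) ^ u) * (x ^ u * x ^ u * (y ^ v * y ^ v)) * ((-1) ^ v * (-1) ^ v)).
  by rewrite (sign_sqr v) mulr1; field; rewrite ?expfz_neq0 ?y0 ?m1.
by rewrite e1; ring.
Qed.

End DiamondTerms.

Section Weierstrass.
Variable R : realType.
Local Notation C := R[i].
Variable p : C.
Hypothesis p_lt1 : `|p| < 1.

Section NonZero.
Hypothesis p0 : p != 0.
Let r := cmod p.
Let r01 : 0 <= r < 1 := cmodp_lt1 p_lt1.

(** The part of a double series over a square that the diamond leaves out. *)
Definition tail_sum (F : int * int -> C) (L : nat) : C :=
  \sum_(k <- int_square (2 * L).+1 | k \notin diamond L) F k.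

Lemma square_diamond (F : int * int -> C) L :
  \sum_(k <- int_square (2 * L).+1) F k = \sum_(k <- diamond L) F k + tail_sum F L.
Proof.
rewrite /tail_sum (bigID (fun k => k \in diamond L)) /=; congr (_ + _).
rewrite -big_filter; apply: perm_big; apply: uniq_perm.
- by rewrite filter_uniq // int_square_uniq.
- exact: diamond_uniq.
by move=> k; rewrite mem_filter andbC;
  case: (boolP (k \in diamond L)) => [/diamond_sub ->|_]; rewrite ?andbF.
Qed.

(** Outside the diamond |m| + |n| exceeds 2 L, so half of the decay bounds the
    terms by r^L and the other half makes their sum converge. *)
Lemma tail_sum_cvg0 (F : int * int -> C) (B : R) : 0 <= B ->
  (forall k, cmod (F k) <= B * (r ^+ 2) ^+ (`|k.1| + `|k.2|)%N) ->
  tail_sum F @ \oo --> (0 : C^o).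
Proof.
move=> B0 hF; have /andP[r0 r1] := r01.
pose S := 2 / (1 - r).
have S0 : 0 <= S by rewrite divr_ge0 // subr_ge0 ltW.
apply: (@ccvg_le _ _ _ (fun L => B * (S * S) * r ^+ L)); last exact: geo_cvg0.
move=> L; rewrite subr0; apply: le_trans (cmod_sum _ _ _) _.
have small k : k \notin diamond L -> cmod (F k) <= B * r ^+ L
  * (r ^+ `|k.1|%N * r ^+ `|k.2|%N).
  move=> /notin_diamond kL; apply: le_trans (hF k) _.
  have -> : (r ^+ 2) ^+ (`|k.1| + `|k.2|)%N =
      r ^+ (`|k.1| + `|k.2|)%N * (r ^+ `|k.1|%N * r ^+ `|k.2|%N).
    by rewrite -exprM mul2n -addnn !exprD.
  rewrite -mulrA; apply: ler_wpM2l => //; apply: ler_wpM2r.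
    by rewrite mulr_ge0 ?exprn_ge0.
  by apply: (cmodp_exp_le p_lt1); lia.
apply: (@le_trans _ _ (\sum_(k <- int_square (2 * L).+1) B * r ^+ L
  * (r ^+ `|k.1|%N * r ^+ `|k.2|%N))).
  rewrite [leRHS](bigID (fun k => k \notin diamond L)) /= -[leLHS]addr0.
  apply: lerD; first by apply: ler_sum => k; apply: small.
  by apply: sumr_ge0 => k _; rewrite !mulr_ge0 ?exprn_ge0.
rewrite -mulr_sumr big_allpairs /=.
under eq_bigr do rewrite -mulr_sumr.
rewrite -mulr_suml [leRHS]mulrAC; apply: ler_wpM2l.
  by rewrite mulr_ge0 ?exprn_ge0.
by apply: ler_pM; rewrite ?sum_int_range_geo_le //; apply: sumr_ge0 => n _;
  rewrite exprn_ge0.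
Qed.

Lemma norm_sqr_lt1 : `|p ^+ 2| < 1.
Proof. by rewrite normrX exprn_ilt1 ?normr_ge0. Qed.

(** The product of two triple product series, summed first over squares and then
    over diamonds.  Over a diamond the double sum is a combination of products
    of two truncated theta series of nome p^2. *)
Lemma theta_rank_two_neq0 : exists A B : C -> C, forall x y, x != 0 -> y != 0 ->
  theta (x * y) p * theta (x / y) p = A x * B y - x / y * (B x * A y).
Proof.
have pp0 : p ^+ 2 != 0 by rewrite expf_neq0.
have [l l0 hl] := triple_product p_lt1 p0.
have [k k0 hk] := triple_product norm_sqr_lt1 pp0.
exists (fun x => k * theta (- x ^+ 2) (p ^+ 2) / l).
exists (fun x => k * theta (- (p * x ^+ 2)) (p ^+ 2) / l) => x y x0 y0.
pose F (k : int * int) := (theta_coef p k.1 * (x * y) ^ k.1)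
  * (theta_coef p k.2 * (x / y) ^ k.2).
have xy0 : x * y != 0 by rewrite mulf_neq0.
have xVy0 : x / y != 0 by rewrite mulf_neq0 ?invr_eq0.
have [B1 B10 hB1] := theta_coef_bound p_lt1 p0 xy0.
have [B2 B20 hB2] := theta_coef_bound p_lt1 p0 xVy0.
have FB i : cmod (F i) <= (B1 * B2) * (r ^+ 2) ^+ (`|i.1| + `|i.2|)%N.
  rewrite /F cmodM exprD mulrACA; apply: ler_pM; rewrite ?cmod_ge0 //.
have tail := tail_sum_cvg0 (mulr_ge0 B10 B20) FB.
pose S a M : C := \sum_(n <- int_range M) theta_coef p n * a ^ n.
pose T a M : C := \sum_(n <- int_range M) theta_coef (p ^+ 2) n * a ^ n.
have diamondE L : \sum_(i <- diamond L) F i =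
   T (- x ^+ 2) L * T (- (p * y ^+ 2)) L
   - x / y * (T (- (p * x ^+ 2)) L * T (- y ^+ 2) L).
  have prodsum (a b : C) : T a L * T b L = \sum_(u <- int_range L) \sum_(v <- int_range L)
      (theta_coef (p ^+ 2) u * a ^ u) * (theta_coef (p ^+ 2) v * b ^ v).
    rewrite mulr_suml; apply: eq_bigr => u _; exact: mulr_sumr.
  rewrite big_cat !big_allpairs_dep !prodsum /= -[- (x / y * _)]mulNr mulr_sumr;
    congr (_ + _).
    by apply: eq_bigr => u _; apply: eq_bigr => v _; exact: theta_coef_even.
  apply: eq_bigr => u _; rewrite mulr_sumr; apply: eq_bigr => v _.
  exact: theta_coef_odd.
have px0 : - (p * x ^+ 2) != 0 by rewrite oppr_eq0 mulf_neq0 ?expf_neq0.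
have py0 : - (p * y ^+ 2) != 0 by rewrite oppr_eq0 mulf_neq0 ?expf_neq0.
have x20 : - x ^+ 2 != 0 by rewrite oppr_eq0 expf_neq0.
have y20 : - y ^+ 2 != 0 by rewrite oppr_eq0 expf_neq0.
have L1 : (fun L => S (x * y) (2 * L).+1 * S (x / y) (2 * L).+1) @ \oo
    --> (l * theta (x * y) p * (l * theta (x / y) p) : C^o).
  have sub a : a != 0 -> (fun L => S a (2 * L).+1) @ \oo --> (l * theta a p : C^o).
    move=> a0; apply: (@ccvg_subseq _ (fun L => (2 * L).+1) (S a)) (hl a a0) => n.
    by rewrite mul2n -addnn leqW // leq_addr.
  exact: ccvgM (sub _ xy0) (sub _ xVy0).
have L2 := ccvgD (ccvgB (ccvgM (hk _ x20) (hk _ py0))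
   (ccvgM (@ccvg_cst _ (x / y)) (ccvgM (hk _ px0) (hk _ y20)))) tail.
have E : (fun L => S (x * y) (2 * L).+1 * S (x / y) (2 * L).+1) =
  (fun L => T (- x ^+ 2) L * T (- (p * y ^+ 2)) L
     - x / y * (T (- (p * x ^+ 2)) L * T (- y ^+ 2) L) + tail_sum F L).
  apply/funext => L; rewrite -diamondE -square_diamond /int_square big_allpairs_dep.
  by rewrite mulr_suml; apply: eq_bigr => u _; rewrite mulr_sumr.
rewrite E in L1.
have := ccvg_unique L1 L2; rewrite addr0 => H.
apply: (mulfI (mulf_neq0 l0 l0)).
transitivity (l * theta (x * y) p * (l * theta (x / y) p)); first by ring.
by rewrite H; field; rewrite y0 l0.
Qed.

End NonZero.

Lemma theta_rank_two : exists A B : C -> C, forall x y, x != 0 -> y != 0 ->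
  theta (x * y) p * theta (x / y) p = A x * B y - x / y * (B x * A y).
Proof.
have [pz|pnz] := eqVneq p 0; last exact: theta_rank_two_neq0.
have theta_p0 a : a != 0 -> theta a p = 1 - a.
  move=> a0; apply: (ccvg_unique (@theta_cvg _ _ p_lt1 a)).
  apply: (@cvg_near_cst nat C^o (1 - a) (theta_partial p a) \oo eventually_filter).
  exists 1%N => // n /= n1; rewrite /theta_partial (big_cat_nat (n := 1)) //=.
  rewrite big_nat1 expr0 mulr1 pz expr1 mul0r subr0 mulr1 big_nat_cond big1 ?mulr1 //.
  by case=> [|j] /andP[/andP[j1 _] _] //; rewrite !expr0n /= mulr0 mul0r !subr0 mulr1.
(* For p = 0 one has theta a = 1 - a, and
   (1 - x y) (1 - x / y) = 1 + x^2 - (x / y) (1 + y^2). *)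
exists (fun x => 1 + x ^+ 2), (fun=> 1) => x y x0 y0.
by rewrite !theta_p0 ?mulf_neq0 ?invr_eq0 //; field.
Qed.

(** With P = s^2 the pair products are
    theta(z w / s^2) theta(z / w), to which [theta_rank_two] applies at z / s
    and w / s; the three-term relation is then a polynomial identity in the
    values of A and B. *)
Theorem theta_is_theta_like : theta_like (fun a : C => theta a p).
Proof.
split.
- exact: theta1.
- by move=> x; apply: thetaV.
- by move=> x y; apply: theta_div_eq0.
have [A [B AB]] := theta_rank_two.
move=> P x y u v P0 x0 y0 u0 v0.
have sP : sqrtc P ^+ 2 = P by apply: sqr_sqrtc.
have s0 : sqrtc P != 0 by apply: contraNneq P0 => s0; rewrite -sP s0 expr0n.
have pair z w : z != 0 -> w != 0 -> theta (z / w) p * theta (z * w / P) p =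
  A (z / sqrtc P) * B (w / sqrtc P) - z / w * (B (z / sqrtc P) * A (w / sqrtc P)).
  move=> z0 w0.
  have zs : z / sqrtc P != 0 by rewrite mulf_neq0 ?invr_eq0.
  have ws : w / sqrtc P != 0 by rewrite mulf_neq0 ?invr_eq0.
  have := AB _ _ zs ws.
  have -> : z / sqrtc P / (w / sqrtc P) = z / w by field; rewrite s0 w0.
  have -> : z / sqrtc P * (w / sqrtc P) = z * w / P by rewrite -[in RHS]sP; move: s0;
    move: (sqrtc P) => t t0; field.
  by rewrite mulrC.
by rewrite !pair //; field; rewrite ?y0 ?v0 ?u0 ?x0.
Qed.

End Weierstrass.

Local Close Scope classical_set_scope.

(** * Removing genericity by continuity *)

Lemma mulf4_neq0 (K : fieldType) (a b c d : K) :
  a != 0 -> b != 0 -> c != 0 -> d != 0 -> a * b * c * d != 0.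
Proof. by move=> a0 b0 c0 d0; rewrite !mulf_neq0. Qed.

Section Tends.
Variable R : realType.
Local Notation C := R[i].

(** Convergence of complex sequences, kept behind a constructor so that limits of
    large expressions are computed structurally. *)
Variant tends (u : nat -> C) (l : C) : Prop :=
  Tends of (u @ \oo --> (l : C^o))%classic.

Lemma tends_cst (a : C) : tends (fun=> a) a.
Proof. by split; apply: (@ccvg_cst _ a). Qed.

Lemma tendsM (u v : nat -> C) a b :
  tends u a -> tends v b -> tends (fun n => u n * v n) (a * b).
Proof. by case=> ua [vb]; split; exact: ccvgM ua vb. Qed.

Lemma tendsD (u v : nat -> C) a b :
  tends u a -> tends v b -> tends (fun n => u n + v n) (a + b).
Proof. by case=> ua [vb]; split; exact: ccvgD ua vb. Qed.

Lemma tendsV (u : nat -> C) a : tends u a -> a != 0 -> tends (fun n => (u n)^-1) a^-1.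
Proof. by case=> ua a0; split; exact: ccvgV a0 ua. Qed.

Lemma tendsX (u : nat -> C) a k : tends u a -> tends (fun n => u n ^+ k) (a ^+ k).
Proof. by case=> ua; split; exact: (ccvgX (k := k) ua). Qed.

Lemma tends_sum (I : Type) (s : seq I) (P : pred I) (F : I -> nat -> C) (G : I -> C) :
  (forall i, P i -> tends (F i) (G i)) ->
  tends (fun n => \sum_(i <- s | P i) F i n) (\sum_(i <- s | P i) G i).
Proof.
move=> FG; elim: s => [|i s IH].
  rewrite big_nil (_ : (fun n => _) = fun=> 0); first exact: tends_cst.
  by apply/funext => n; rewrite big_nil.
rewrite big_cons; case: ifP => Pi.
  rewrite (_ : (fun n => _) = fun n => F i n + \sum_(j <- s | P j) F j n).
    by apply: tendsD => //; apply: FG.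
  by apply/funext => n; rewrite big_cons Pi.
rewrite (_ : (fun n => _) = fun n => \sum_(j <- s | P j) F j n) //.
by apply/funext => n; rewrite big_cons Pi.
Qed.

Lemma tends_prod (I : Type) (s : seq I) (P : pred I) (F : I -> nat -> C) (G : I -> C) :
  (forall i, P i -> tends (F i) (G i)) ->
  tends (fun n => \prod_(i <- s | P i) F i n) (\prod_(i <- s | P i) G i).
Proof.
move=> FG; elim: s => [|i s IH].
  rewrite big_nil (_ : (fun n => _) = fun=> 1); first exact: tends_cst.
  by apply/funext => n; rewrite big_nil.
rewrite big_cons; case: ifP => Pi.
  rewrite (_ : (fun n => _) = fun n => F i n * \prod_(j <- s | P j) F j n).
    by apply: tendsM => //; apply: FG.
  by apply/funext => n; rewrite big_cons Pi.
rewrite (_ : (fun n => _) = fun n => \prod_(j <- s | P j) F j n) //.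
by apply/funext => n; rewrite big_cons Pi.
Qed.

Lemma tends_near_unique (u v : nat -> C) a b : tends u a -> tends v b ->
  (\forall n \near \oo, u n = v n)%classic -> a = b.
Proof.
move=> ua vb [N _ hN].
have sub w c : tends w c -> tends (fun n => w (n + N)%N) c.
  case=> h; split; apply: (@ccvg_subseq _ (fun n => (n + N)%N) w) h => n.
  exact: leq_addr.
have := sub _ _ ua; rewrite (_ : (fun n => u (n + N)%N) = fun n => v (n + N)%N).
  by case=> h; case: (sub _ _ vb) => h'; exact: ccvg_unique h h'.
by apply/funext => n; apply: (hN (n + N)%N); rewrite /= leq_addl.
Qed.

Lemma near_forall_fin (T : finType) (P : T -> nat -> Prop) :
  (forall t, \forall n \near \oo, P t n)%classic ->
  (\forall n \near \oo, forall t, P t n)%classic.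
Proof.
move=> h; have {}h t : exists N, forall n, (N <= n)%N -> P t n.
  by have [N _ hN] := h t; exists N.
have [N hN] := boolp.choice h; exists (\max_t N t) => // n /= nN t.
by apply: hN; apply: leq_trans nN; apply: leq_bigmax.
Qed.

Lemma near_forall_lt (P : nat -> nat -> Prop) m :
  (forall j, \forall n \near \oo, P j n)%classic ->
  (\forall n \near \oo, forall j, (j < m)%N -> P j n)%classic.
Proof.
move=> h; have [N _ hN] := @near_forall_fin 'I_m (fun j n => P j n) (fun j => h j).
by exists N => // n /hN hn j jm; have := hn (Ordinal jm).
Qed.

Variables (p q : C).
Hypotheses (p_lt1 : `|p| < 1) (q0 : q != 0).
Local Notation th := (fun a : C => theta a p).
Local Notation pch := (poch th q).

Lemma tends_theta (u : nat -> C) a : tends u a -> a != 0 ->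
  tends (fun n => theta (u n) p) (theta a p).
Proof. by case=> ua a0; split; exact: theta_continuous p_lt1 _ _ a0 ua. Qed.

Lemma tends_poch (u : nat -> C) a k : tends u a -> a != 0 ->
  tends (fun n => pch (u n) k) (pch a k).
Proof.
move=> ua a0; rewrite /poch; apply: tends_prod => j _; apply: tends_theta.
  by apply: tendsM => //; apply: tends_cst.
by rewrite mulf_neq0 // expf_neq0.
Qed.

Local Opaque poch theta.

Lemma tends_nudge a k : tends (fun n => a * nudge R n ^+ k) a.
Proof.
rewrite -[X in tends _ X]mulr1 -(expr1n _ k).
apply: tendsM; first exact: tends_cst.
by apply: tendsX; split; apply: nudge_cvg.
Qed.

Lemma near_theta_nudge a k (s : nat -> C) m : a != 0 -> (forall j, s j != 0) ->
  (\forall n \near \oo, forall j, (j < m)%N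
    -> theta (a * nudge R n ^+ k.+1 * s j) p != 0)%classic.
Proof.
move=> a0 s0; apply: near_forall_lt => j.
have as0 : a * s j != 0 by rewrite mulf_neq0.
have [N _ hN] := theta_nudge_neq0 p_lt1 k as0.
by exists N => // n /hN /=; rewrite mulrAC.
Qed.

Section JacksonA.
Variables (n : nat) (e x : 'I_n -> C).
Hypotheses (e0 : forall r, e r != 0) (x0 : forall r, x r != 0).
Let E := \prod_r e r.

(** The conditions of [jacksonA_sum_generic] that do not concern denominators hold
    for g t when t > 1 is close to 1, and both sides are continuous in g. *)
Theorem jacksonA_sum (N m : nat) (g : C) : (m <= N)%N -> g != 0 ->
  (forall j, (0 < j <= m)%N -> theta (q ^+ j) p != 0) ->
  (forall r s j, r != s -> (j <= m)%N -> theta (q ^+ j * x r / x s) p != 0) ->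
  (forall r, pch (g * x r) m != 0) ->
  \sum_(k : {ffun 'I_n -> 'I_N.+1} | (\sum_s k s == m)%N)
     jacksonA_term th q e x g (fun s => k s)
  = q ^+ m * (pch E m / pch q m) * \prod_r (pch (g * x r / e r) m / pch (g * x r) m).
Proof.
move=> mN g0 hq hx hg.
have E0 : E != 0 by apply/prodf_neq0.
have thL := theta_is_theta_like p_lt1.
pose gn i := g * nudge R i ^+ 1.
have tg : tends gn g by apply: tends_nudge.
have gx0 r : g * x r != 0 by rewrite mulf_neq0.
have tgx r (c : C) : tends (fun i => gn i * x r / c) (g * x r / c).
  by apply: tendsM; [apply: tendsM => //|]; apply: tends_cst.
have tgx1 r : tends (fun i => gn i * x r) (g * x r).
  by apply: tendsM => //; apply: tends_cst.
have hgle r k : (k <= m)%N -> pch (g * x r) k != 0.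
  move=> km; apply/poch_neq0P => j jk; have /poch_neq0P := hg r; apply.
  exact: leq_trans km.
have lim1 : tends (fun i => \sum_(k : {ffun 'I_n -> 'I_N.+1} | (\sum_s k s == m)%N)
     jacksonA_term th q e x (gn i) (fun s => k s))
   (\sum_(k : {ffun 'I_n -> 'I_N.+1} | (\sum_s k s == m)%N)
     jacksonA_term th q e x g (fun s => k s)).
  apply: tends_sum => k /eqP km; rewrite /jacksonA_term.
  apply: tendsM; last exact: tends_cst.
  apply: tendsM; first exact: tends_cst.
  apply: tends_prod => r _; apply: tendsM.
    by apply: tends_poch; rewrite ?mulf_neq0 ?invr_eq0.
  apply: tendsV; first exact: tends_poch.
  by apply: hgle; rewrite -km (bigD1 r) //= leq_addr.
have lim2 : tends (fun i => q ^+ m * (pch E m / pch q m) *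
     \prod_r (pch (gn i * x r / e r) m / pch (gn i * x r) m))
   (q ^+ m * (pch E m / pch q m) * \prod_r (pch (g * x r / e r) m / pch (g * x r) m)).
  apply: tendsM; first exact: tends_cst.
  apply: tends_prod => r _; apply: tendsM.
    by apply: tends_poch; rewrite ?mulf_neq0 ?invr_eq0.
  apply: tendsV => //; exact: tends_poch.
apply: (tends_near_unique lim1 lim2).
have near1 r := @near_theta_nudge g 0 (fun j => x r * q ^+ j) m g0
   (fun j => mulf_neq0 (x0 r) (expf_neq0 j q0)).
have near2 r := @near_theta_nudge g 0 (fun j => x r / E * q ^+ j) m.+1 g0
   (fun j => mulf_neq0 (mulf_neq0 (x0 r) (invr_neq0 E0)) (expf_neq0 j q0)).
have [N1 _ h1] := near_forall_fin near1.
have [N2 _ h2] := near_forall_fin near2.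
exists (maxn N1 N2) => // i /=; rewrite geq_max => /andP[/h1 {}h1 /h2 {}h2].
have gi0 : gn i != 0 by rewrite mulf_neq0 // expf_neq0 // nudge_neq0.
apply: (jacksonA_sum_generic thL q0 e0 x0 mN gi0 hq hx).
  by move=> r j jm; have := h1 r j jm; rewrite mulrA.
by move=> r j jm; have := h2 r j jm; rewrite !mulrA.
Qed.

End JacksonA.

Section Bailey.
Lemma near_theta_nudgeV a k (s : nat -> C) m : a != 0 -> (forall j, s j != 0) ->
  (\forall n \near \oo, forall j, (j < m)%N
    -> theta (a / nudge R n ^+ k.+1 * s j) p != 0)%classic.
Proof.
move=> a0 s0; apply: near_forall_lt => j.
have as0 : a * s j != 0 by rewrite mulf_neq0.
have [N _ hN] := theta_nudgeV_neq0 p_lt1 k as0.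
by exists N => // n /hN /=; rewrite mulrAC.
Qed.

Lemma tends_bailey_weight N (an ln : nat -> C) a l E F k :
  tends an a -> tends ln l -> a != 0 -> l != 0 -> E != 0 -> F != 0 -> (k <= N)%N ->
  pch (a * q ^+ N.+1) N != 0 -> pch (a * q / E) N != 0 -> pch (a * q / F) N != 0 ->
  pch (E * F * q ^- N / l) N != 0 ->
  tends (fun i => bailey_weight th q N (an i) (ln i) E F k)
    (bailey_weight th q N a l E F k).
Proof.
move=> ta tl a0 l0 E0 F0 kN h1 h2 h3 h4.
have nle y : pch y N != 0 -> pch y k != 0.
  by move/poch_neq0P => h; apply/poch_neq0P => j jk; apply: h; apply: leq_trans kN.
have [tc tq] : (forall c, tends (fun=> c) c) /\ forall c,
  tends (fun i => an i * c) (a * c).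
  by split=> c; [|apply: tendsM => //]; apply: tends_cst.
have qN0 : q ^+ N != 0 by rewrite expf_neq0.
rewrite /bailey_weight; apply: tendsM.
  apply: tendsM; last exact: tends_cst.
  apply: tendsM; first exact: tends_cst.
  apply: tends_poch; last by rewrite !mulf_neq0 ?invr_eq0 ?mulf_neq0 ?expf_neq0.
  by apply: tendsM => //; apply: tendsM => //; apply: tendsM.
apply: tendsV; last exact: mulf4_neq0 (nle _ h1) (nle _ h2) (nle _ h3) (nle _ h4).
apply: tendsM; last first.
  apply: tends_poch; last by rewrite !mulf_neq0 ?invr_eq0.
  by apply: tendsM => //; apply: tendsV.
apply: tendsM.
  apply: tendsM; apply: tends_poch => //.
  - by rewrite mulf_neq0 ?expf_neq0.
  - by apply: tendsM.
  - by rewrite !mulf_neq0 ?invr_eq0.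
apply: tends_poch; first by apply: tendsM.
by rewrite !mulf_neq0 ?invr_eq0.
Qed.

Lemma tends_wp_base N (an bn cn dn : nat -> C) a b c d k : (k <= N)%N ->
  tends an a -> tends bn b -> tends cn c -> tends dn d ->
  a != 0 -> b != 0 -> c != 0 -> d != 0 -> theta a p != 0 -> pch q N != 0 ->
  pch (a * q / b) N != 0 -> pch (a * q / c) N != 0 -> pch (a * q / d) N != 0 ->
  tends (fun i => wp_base th q (an i) (bn i) (cn i) (dn i) k) (wp_base th q a b c d k).
Proof.
move=> kN ta tb tc td a0 b0 c0 d0 tha qN h1 h2 h3.
have nle y : pch y N != 0 -> pch y k != 0.
  by move/poch_neq0P => h; apply/poch_neq0P => j jk; apply: h; apply: leq_trans kN.
have tcst z : tends (fun=> z) z by apply: tends_cst.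
have quot xn y : tends xn y -> y != 0
  -> tends (fun i => pch (an i * q / xn i) k) (pch (a * q / y) k).
  move=> tx y0; apply: tends_poch; last by rewrite !mulf_neq0 ?invr_eq0.
  by apply: tendsM; [apply: tendsM | apply: tendsV].
rewrite /wp_base; apply: tendsM => //; apply: tendsM.
  apply: tendsM.
    apply: tendsM; last by apply: tendsV => //; apply: tends_theta.
    by apply: tends_theta; [apply: tendsM | rewrite mulf_neq0 ?expf_neq0].
  by do 3!(apply: tendsM; last exact: tends_poch); apply: tends_poch.
apply: tendsV; last exact: mulf4_neq0 (nle _ qN) (nle _ h1) (nle _ h2) (nle _ h3).
by do 3!(apply: tendsM; last exact: quot).
Qed.

Lemma tends_bailey_prefactor N (an ln : nat -> C) a l E F :
  tends an a -> tends ln l -> a != 0 -> l != 0 -> E != 0 -> F != 0 ->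
  pch (a * q / E) N != 0 -> pch (a * q / F) N != 0 -> pch (l * q) N != 0 ->
  pch (l * q / (E * F)) N != 0 ->
  tends (fun i => bailey_prefactor th q N (an i) (ln i) E F)
    (bailey_prefactor th q N a l E F).
Proof.
move=> ta tl a0 l0 E0 F0 h1 h2 h3 h4.
have tcst z : tends (fun=> z) z by apply: tends_cst.
have EF0 : E * F != 0 by rewrite mulf_neq0.
have lin xn y : tends xn y -> y != 0 -> tends (fun i => pch (xn i * q) N) (pch (y * q) N).
  by move=> tx y0; apply: tends_poch; [apply: tendsM | rewrite mulf_neq0].
have quot xn y z : tends xn y -> y != 0 -> z != 0 ->
    tends (fun i => pch (xn i * q / z) N) (pch (y * q / z) N).
  move=> tx y0 z0; apply: tends_poch; last by rewrite !mulf_neq0 ?invr_eq0.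
  by apply: tendsM => //; apply: tendsM.
rewrite /bailey_prefactor; apply: tendsM.
  by do 3!(apply: tendsM; last exact: quot); apply: lin.
apply: tendsV; last exact: mulf4_neq0 h1 h2 h3 h4.
apply: tendsM; last exact: quot.
apply: tendsM; last exact: lin.
by apply: tendsM; apply: quot.
Qed.

(** The parameters a and l are replaced by a t and l t^2, which preserves the
    balancing condition l b c d = q a^2; for t > 1 close to 1 the conditions of
    [elliptic_bailey_generic] hold. *)
Theorem elliptic_bailey N a b c d l E F :
  a != 0 -> b != 0 -> c != 0 -> d != 0 -> l != 0 -> E != 0 -> F != 0 ->
  l * (b * c * d) = q * a ^+ 2 ->
  theta a p != 0 -> theta l p != 0 -> pch q N != 0 ->
  pch (a * q / b) N != 0 -> pch (a * q / c) N != 0 -> pch (a * q / d) N != 0 ->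
  pch (a * q ^+ N.+1) N != 0 -> pch (l * q ^+ N.+1) N != 0 ->
  pch (a * q / E) N != 0 -> pch (a * q / F) N != 0 ->
  pch (l * q / E) N != 0 -> pch (l * q / F) N != 0 ->
  pch (l * q) N != 0 -> pch (l * q / (E * F)) N != 0 ->
  pch (E * F * q ^- N / l) N != 0 -> pch (E * F * q ^- N / a) N != 0 ->
  \sum_(0 <= k < N.+1) wp_base th q a b c d k * bailey_weight th q N a l E F k
  = bailey_prefactor th q N a l E F *
    \sum_(0 <= j < N.+1) wp_base th q l (l * b / a) (l * c / a) (l * d / a) j
       * bailey_weight th q N l a E F j.
Proof.
move=> a0 b0 c0 d0 l0 E0 F0 lE tha thl qN bN cN dN aN lN aE aF lEN lF lq lqEF EFl EFa.
have thL := theta_is_theta_like p_lt1.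
pose an i := a * nudge R i ^+ 1; pose ln i := l * nudge R i ^+ 2.
have ta : tends an a by apply: tends_nudge.
have tl : tends ln l by apply: tends_nudge.
have tc z : tends (fun=> z) z by apply: tends_cst.
have lx x : x != 0 -> l * x / a != 0 by move=> x0; rewrite !mulf_neq0 ?invr_eq0.
have lqx x : x != 0 -> l * q / (l * x / a) = a * q / x.
  by move=> x0; field; rewrite a0 x0 l0.
have tlx x : tends (fun i => ln i * x / an i) (l * x / a).
  by apply: tendsM; [apply: tendsM | apply: tendsV].
have lim1 : tends
   (fun i => \sum_(0 <= k < N.+1) wp_base th q (an i) b c d k
     * bailey_weight th q N (an i) (ln i) E F k)
   (\sum_(0 <= k < N.+1) wp_base th q a b c d k * bailey_weight th q N a l E F k).
  rewrite [X in tends _ X]big_nat; rewrite (_ : (fun i => _) = fun i =>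
    \sum_(0 <= k < N.+1 | (0 <= k < N.+1)%N) wp_base th q (an i) b c d k
      * bailey_weight th q N (an i) (ln i) E F k).
    apply: tends_sum => k /andP[_ kN]; apply: tendsM.
      exact: (tends_wp_base (N := N)).
    exact: tends_bailey_weight.
  by apply/funext => i; apply: big_nat.
have lim2 : tends
   (fun i => bailey_prefactor th q N (an i) (ln i) E F *
    \sum_(0 <= j < N.+1) wp_base th q (ln i) (ln i * b / an i) (ln i * c / an i)
      (ln i * d / an i) j
       * bailey_weight th q N (ln i) (an i) E F j)
   (bailey_prefactor th q N a l E F *
    \sum_(0 <= j < N.+1) wp_base th q l (l * b / a) (l * c / a) (l * d / a) j
       * bailey_weight th q N l a E F j).
  apply: tendsM; first exact: tends_bailey_prefactor.
  rewrite [X in tends _ X]big_nat; rewrite (_ : (fun i => _) = fun i =>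
    \sum_(0 <= j < N.+1 | (0 <= j < N.+1)%N) wp_base th q (ln i) (ln i * b / an i)
      (ln i * c / an i) (ln i * d / an i) j
       * bailey_weight th q N (ln i) (an i) E F j).
    apply: tends_sum => k /andP[_ kN]; apply: tendsM.
      by apply: (tends_wp_base (N := N)); rewrite ?lx ?lqx.
    exact: tends_bailey_weight.
  by apply/funext => i; apply: big_nat.
apply: (tends_near_unique lim1 lim2).
have qX j : q ^+ j != 0 by rewrite expf_neq0.
have qV j : q ^- j != 0 by rewrite invr_eq0.
have EF0 : E * F != 0 by rewrite mulf_neq0.
have near_poch A k y : A != 0 -> y != 0 ->
    (\forall i \near \oo, pch (A * nudge R i ^+ k.+1 * y) N != 0)%classic.
  move=> A0 y0; have [N0 _ hN] := @near_theta_nudge A k (fun j => y * q ^+ j) N A0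
    (fun j => mulf_neq0 y0 (qX j)).
  exists N0 => // i /hN /= h; apply/poch_neq0P => j jN.
  by rewrite -[A * _ * y * _]mulrA; apply: h.
have near_up A k y M : A != 0 -> y != 0 -> (\forall i \near \oo, forall j, (j <= M)%N ->
    theta (A * nudge R i ^+ k.+1 * (y * q ^+ j)) p != 0)%classic.
  by move=> A0 y0; exact: (@near_theta_nudge A k (fun j => y * q ^+ j) M.+1 A0
    (fun j => mulf_neq0 y0 (qX j))).
have near_dn A k y M : A != 0 -> y != 0 -> (\forall i \near \oo, forall j, (j <= M)%N ->
    theta (A * nudge R i ^+ k.+1 * (y / q ^+ j)) p != 0)%classic.
  by move=> A0 y0; exact: (@near_theta_nudge A k (fun j => y / q ^+ j) M.+1 A0
    (fun j => mulf_neq0 y0 (qV j))).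
have lVa0 : l / a != 0 by rewrite mulf_neq0 ?invr_eq0.
have lV0 : E * F / l != 0 by rewrite mulf_neq0 ?invr_eq0.
have aV0 : E * F / a != 0 by rewrite mulf_neq0 ?invr_eq0.
have yq y : y != 0 -> q / y != 0 by move=> y0; rewrite mulf_neq0 ?invr_eq0.
have n1 := near_poch a 0%N _ a0 (yq _ b0).
have n2 := near_poch a 0%N _ a0 (yq _ c0).
have n3 := near_poch a 0%N _ a0 (yq _ d0).
have n4 := near_poch a 0%N _ a0 (yq _ E0).
have n5 := near_poch a 0%N _ a0 (yq _ F0).
have n6 := near_poch l 1%N _ l0 (yq _ E0).
have n7 := near_poch l 1%N _ l0 (yq _ F0).
have n8 := near_up a 0%N 1 (2 * N)%N a0 (oner_neq0 _).
have n9 := near_up l 1%N 1 (2 * N)%N l0 (oner_neq0 _).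
have n10 := near_up (l / a) 0%N q N lVa0 q0.
have n11 := near_dn (l / a) 0%N q N lVa0 q0.
have n12 := @near_theta_nudgeV (E * F / l) 1 (fun j => q ^+ j) N.+1 lV0 qX.
have n13 := @near_theta_nudgeV (E * F / l) 1 (fun j => q ^- j) N.+1 lV0 qV.
have n14 := @near_theta_nudgeV (E * F / a) 0 (fun j => q ^- N * q ^+ j) N aV0
  (fun j => mulf_neq0 (qV N) (qX j)).
have [N0 _ H] := filterI n1
  (filterI n2 (filterI n3 (filterI n4 (filterI n5 (filterI n6 (filterI n7
  (filterI n8 (filterI n9 (filterI n10
    (filterI n11 (filterI n12 (filterI n13 n14)))))))))))).
exists N0; first by [].
move=> i /H /= [h1 [h2 [h3 [h4 [h5 [h6 [h7 [h8 [h9 [h10 [h11 [h12 [h13 h14]]]]]]]]]]]]].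
have ti : nudge R i != 0 by apply: nudge_neq0.
have an0 : an i != 0 by rewrite mulf_neq0 // expf_neq0.
have ln0 : ln i != 0 by rewrite mulf_neq0 // expf_neq0.
have lE' : ln i * (b * c * d) = q * an i ^+ 2.
  by rewrite /ln mulrAC lE /an; ring.
have ratio y : ln i * q / an i * y = l / a * nudge R i ^+ 1 * (q * y).
  by rewrite /ln /an; move: (nudge R i) ti => t t0; field; rewrite a0 t0.
have ratioV y : E * F / ln i * y = E * F / l / nudge R i ^+ 2 * y.
  by rewrite /ln; move: (nudge R i) ti => t t0; field; rewrite l0 t0.
apply: (elliptic_bailey_generic thL q0 an0 b0 c0 d0 ln0 E0 F0 lE' qN).
- rewrite -[an i * q / b]mulrA; exact: h1.
- rewrite -[an i * q / c]mulrA; exact: h2.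
- rewrite -[an i * q / d]mulrA; exact: h3.
- move=> j jN; rewrite -[q ^+ j]mul1r; exact: h8.
- move=> j jN; rewrite -[q ^+ j]mul1r; exact: h9.
- rewrite -[an i * q / E]mulrA; exact: h4.
- rewrite -[an i * q / F]mulrA; exact: h5.
- rewrite -[ln i * q / E]mulrA; exact: h6.
- rewrite -[ln i * q / F]mulrA; exact: h7.
- move=> j jN; rewrite ratio; exact: h10.
- move=> j jN; rewrite ratio; exact: h11.
- move=> j jN; rewrite ratioV; exact: h12.
- move=> j jN; rewrite ratioV; exact: h13.
apply/poch_neq0P => j jN.
have -> : E * F * q ^- N / an i * q ^+ j = E * F / a / nudge R i ^+ 1 * (q ^- N * q ^+ j).
  by rewrite /an; move: (nudge R i) ti => t t0; field; rewrite a0 t0 qX.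
exact: h14.
Qed.

End Bailey.

End Tends.

(** * Collapsing the multiple sums *)

Lemma sum_by_weight (V : nmodType) n N (f : multi n N -> V) :
  \sum_(k : multi n N | (mweight k <= N)%N) f k =
  \sum_(0 <= K < N.+1) \sum_(k : multi n N | mweight k == K) f k.
Proof.
rewrite (partition_big (fun k => inord (mweight k) : 'I_N.+1) xpredT) //= big_mkord.
apply: eq_bigr => K _; apply: eq_bigl => k.
apply/andP/eqP => [[kN /eqP <-]|->]; first by rewrite inordK.
by rewrite -ltnS ltn_ord inord_val eqxx.
Qed.

Section QPochs.
Variables (R : realType) (p q : R[i]).

Lemma qpochs3 x y z k :
  qpochs [:: x; y; z] q p k = qpoch x q p k * qpoch y q p k * qpoch z q p k.
Proof. by rewrite /qpochs !big_cons big_nil mulr1 !mulrA. Qed.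

Lemma qpochs4 x y z w k : qpochs [:: x; y; z; w] q p k =
  qpoch x q p k * qpoch y q p k * qpoch z q p k * qpoch w q p k.
Proof. by rewrite /qpochs !big_cons big_nil mulr1 !mulrA. Qed.

Lemma qpochs3_neq0 x y z k : qpochs [:: x; y; z] q p k != 0 ->
  [/\ qpoch x q p k != 0, qpoch y q p k != 0 & qpoch z q p k != 0].
Proof.
by rewrite qpochs3 !mulf_eq0 !negb_or -!andbA => /and3P.
Qed.

Lemma qpochs4_neq0 x y z w k : qpochs [:: x; y; z; w] q p k != 0 ->
  [/\ qpoch x q p k != 0, qpoch y q p k != 0, qpoch z q p k != 0 & qpoch w q p k != 0].
Proof.
by rewrite qpochs4 !mulf_eq0 !negb_or -!andbA => /and4P.
Qed.

End QPochs.

Section Collapse.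
Variables (R : realType) (p q : R[i]).
Hypotheses (p_lt1 : `|p| < 1) (q0 : q != 0).
Variables (n N : nat) (e x : 'I_n -> R[i]) (g : R[i]).
Hypotheses (n_ge1 : (1 <= n)%N) (g0 : g != 0).
Hypotheses (e0 : forall r, e r != 0) (x0 : forall r, x r != 0).
Hypothesis (den_x : forall r s : 'I_n, (r < s)%N -> theta (x r / x s) p != 0).
Hypothesis (den_qx : forall (r s : 'I_n) (k : nat), (k <= N)%N ->
     qpoch (q * x r / x s) q p k != 0).
Hypothesis (den_gx : forall (r : 'I_n) (k : nat), (k <= N)%N
  -> qpoch (g * x r) q p k != 0).
Hypothesis (den_gxe : forall (r : 'I_n) (k : nat), (k <= N)%N ->
     qpoch (g * x r / e r) q p k != 0).

Lemma qpochE a k : qpoch a q p k = poch (fun a => theta a p) q a k.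
Proof. by []. Qed.

Lemma qpoch_q_neq0 k : (k <= N)%N -> qpoch q q p k != 0.
Proof.
move=> kN; have := den_qx (Ordinal n_ge1) (Ordinal n_ge1) kN.
by rewrite mulfK.
Qed.

(** W1, W2 and W3 stand for the factors that depend on the weight only.  The
    remaining factors form the Jackson term up to a product over r that
    depends on the weight as well, and that product is inverse to the one in
    the value of the Jackson sum. *)
Lemma multisum_collapse E (W1 W2 W3 : nat -> R[i]) : E = \prod_r e r ->
  \sum_(k : multi n N | (mweight k <= N)%N)
    ((\prod_(r < n) \prod_(s < n | (r < s)%N)
        (theta (q ^ ((k r)%:Z - (k s)%:Z) * x r / x s) p / theta (x r / x s) p))
   * (\prod_(r < n) \prod_(s < n)
        (qpoch (e s * x r / x s) q p (k r) / qpoch (q * x r / x s) q p (k r)))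
   * W1 (mweight k) * W2 (mweight k) * W3 (mweight k)
   * (\prod_(r < n)
        ((qpoch (g * x r / E) q p (k r) * qpoch (g * x r) q p (mweight k))
         / (qpoch (g * x r) q p (k r) * qpoch (g * x r / e r) q p (mweight k))))
   * q ^+ (\sum_(r < n) r.+1 * k r)%N)
  = \sum_(0 <= K < N.+1) q ^+ K * (qpoch E q p K / qpoch q q p K) * (W1 K * W2 K * W3 K).
Proof.
move=> ->.
have thL := theta_is_theta_like p_lt1.
rewrite sum_by_weight; apply: eq_big_nat => m /andP[_]; rewrite ltnS => mN.
have hq j : (0 < j <= m)%N -> theta (q ^+ j) p != 0.
  case: j => // j /andP[_ jm].
  have := qpoch_q_neq0 (leqnn N); rewrite qpochE => /poch_neq0P h.
  by rewrite exprS; apply: h; apply: leq_trans jm mN.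
have hx r s j : r != s -> (j <= m)%N -> theta (q ^+ j * x r / x s) p != 0.
  move=> rs; case: j => [_|j jm].
    rewrite expr0 mul1r; case: (ltngtP r s) => [/den_x //|sr|/ord_inj rs'].
      by apply: (th_swap_neq0 thL) => //; apply: den_x.
    by rewrite rs' eqxx in rs.
  have := den_qx r s (leqnn N); rewrite qpochE => /poch_neq0P h.
  have := h j (leq_trans jm mN).
  by congr (theta _ p != 0); rewrite exprS; ring.
have hg r := den_gx r mN.
transitivity (\sum_(k : multi n N | mweight k == m)
   jacksonA_term (fun a => theta a p) q e x g (fun s => k s)
   * (W1 m * W2 m * W3 m * \prod_(r < n) (qpoch (g * x r) q p m
     / qpoch (g * x r / e r) q p m))).
  apply: eq_bigr => k /eqP km; rewrite /jacksonA_term km.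
  have -> : \prod_(r < n)
        ((qpoch (g * x r / \prod_r e r) q p (k r) * qpoch (g * x r) q p m)
         / (qpoch (g * x r) q p (k r) * qpoch (g * x r / e r) q p m)) =
     \prod_(r < n) (qpoch (g * x r / \prod_r e r) q p (k r) / qpoch (g * x r) q p (k r))
     * \prod_(r < n) (qpoch (g * x r) q p m / qpoch (g * x r / e r) q p m).
    by rewrite -big_split; apply: eq_bigr => r _ /=; rewrite mulf_div.
  have reorder (V B w1 w2 w3 P P' Q : R[i]) :
      V * B * w1 * w2 * w3 * (P * P') * Q = V * B * P * Q * (w1 * w2 * w3 * P').
    by ring.
  exact: reorder.
rewrite -mulr_suml (jacksonA_sum p_lt1 q0 e0 x0 mN g0 hq hx hg).
have -> : \prod_r (qpoch (g * x r) q p m / qpoch (g * x r / e r) q p m) =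
    (\prod_r (qpoch (g * x r / e r) q p m / qpoch (g * x r) q p m))^-1.
  by rewrite -prodfV; apply: eq_bigr => r _; rewrite invf_div.
set D := \prod_r (qpoch (g * x r / e r) q p m / qpoch (g * x r) q p m).
have D0 : D != 0.
  apply/prodf_neq0 => r _; apply: mulf_neq0; first exact: den_gxe.
  by rewrite invr_eq0; exact: den_gx.
have cancel (X w : R[i]) : X * D * (w / D) = X * w by field.
exact: cancel.
Qed.

End Collapse.

Theorem theorem11p6 (R : realType) (n m N : nat)
  (q p a b c d g h : R[i])
  (e x : 'I_n -> R[i]) (f y : 'I_m -> R[i])
  (lambda E F : R[i])
  (n_ge1 : (1 <= n)%N) (m_ge1 : (1 <= m)%N)
  (q_neq0 : q != 0) (p_lt1 : `|p| < 1)
  (a_neq0 : a != 0) (b_neq0 : b != 0) (c_neq0 : c != 0) (d_neq0 : d != 0)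
  (g_neq0 : g != 0) (h_neq0 : h != 0)
  (e_neq0 : forall r, e r != 0) (x_neq0 : forall r, x r != 0)
  (f_neq0 : forall r, f r != 0) (y_neq0 : forall r, y r != 0)
  (lambdaE : lambda = q * a ^+ 2 / (b * c * d))
  (EE : E = \prod_(r < n) e r) (FE : F = \prod_(r < m) f r)
  (* no denominator in the left-hand sum vanishes *)
  (denL_x : forall r s : 'I_n, (r < s)%N -> theta (x r / x s) p != 0)
  (denL_qx : forall (r s : 'I_n) (k : nat), (k <= N)%N ->
     qpoch (q * x r / x s) q p k != 0)
  (denL_a : theta a p != 0)
  (denL_1 : forall k : nat, (k <= N)%N ->
     qpochs [:: a * q ^+ N.+1; a * q / b; a * q / c; a * q / d] q p k != 0)
  (denL_2 : forall k : nat, (k <= N)%N ->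
     qpochs [:: a * q / E; a * q / F; E * F * q ^- N / lambda] q p k != 0)
  (denL_gx : forall (r : 'I_n) (k : nat), (k <= N)%N ->
     qpoch (g * x r) q p k != 0)
  (denL_gxe : forall (r : 'I_n) (k : nat), (k <= N)%N ->
     qpoch (g * x r / e r) q p k != 0)
  (* nor in the prefactor of the right-hand side *)
  (denR_0 :
     qpochs [:: a * q / E; a * q / F; lambda * q; lambda * q / (E * F)] q p N
       != 0)
  (* nor in the right-hand sum *)
  (denR_y : forall r s : 'I_m, (r < s)%N -> theta (y r / y s) p != 0)
  (denR_qy : forall (r s : 'I_m) (j : nat), (j <= N)%N ->
     qpoch (q * y r / y s) q p j != 0)
  (denR_lambda : theta lambda p != 0)
  (denR_1 : forall j : nat, (j <= N)%N ->
     qpochs [:: lambda * q ^+ N.+1; a * q / b; a * q / c; a * q / d] q p j != 0)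
  (denR_2 : forall j : nat, (j <= N)%N ->
     qpochs [:: lambda * q / E; lambda * q / F; E * F * q ^- N / a] q p j != 0)
  (denR_hy : forall (r : 'I_m) (j : nat), (j <= N)%N ->
     qpoch (h * y r) q p j != 0)
  (denR_hyf : forall (r : 'I_m) (j : nat), (j <= N)%N ->
     qpoch (h * y r / f r) q p j != 0) :
  \sum_(k : multi n N | (mweight k <= N)%N)
    ((\prod_(r < n) \prod_(s < n | (r < s)%N)
        (theta (q ^ ((k r)%:Z - (k s)%:Z) * x r / x s) p / theta (x r / x s) p))
   * (\prod_(r < n) \prod_(s < n)
        (qpoch (e s * x r / x s) q p (k r) / qpoch (q * x r / x s) q p (k r)))
   * (theta (a * q ^+ (2 * mweight k)) p / theta a p)
   * (qpochs [:: a; b; c; d] q p (mweight k)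
      / qpochs [:: a * q ^+ N.+1; a * q / b; a * q / c; a * q / d] q p (mweight k))
   * (qpochs [:: F; lambda * a * q ^+ N.+1 / (E * F); q ^- N] q p (mweight k)
      / qpochs [:: a * q / E; a * q / F; E * F * q ^- N / lambda] q p (mweight k))
   * (\prod_(r < n)
        ((qpoch (g * x r / E) q p (k r) * qpoch (g * x r) q p (mweight k))
         / (qpoch (g * x r) q p (k r) * qpoch (g * x r / e r) q p (mweight k))))
   * q ^+ (\sum_(r < n) r.+1 * k r)%N)
  =
  qpochs [:: a * q; a * q / (E * F); lambda * q / E; lambda * q / F] q p N
  / qpochs [:: a * q / E; a * q / F; lambda * q; lambda * q / (E * F)] q p N
  * \sum_(j : multi m N | (mweight j <= N)%N)
    ((\prod_(r < m) \prod_(s < m | (r < s)%N)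
        (theta (q ^ ((j r)%:Z - (j s)%:Z) * y r / y s) p / theta (y r / y s) p))
   * (\prod_(r < m) \prod_(s < m)
        (qpoch (f s * y r / y s) q p (j r) / qpoch (q * y r / y s) q p (j r)))
   * (theta (lambda * q ^+ (2 * mweight j)) p / theta lambda p)
   * (qpochs [:: lambda; lambda * b / a; lambda * c / a; lambda * d / a]
        q p (mweight j)
      / qpochs [:: lambda * q ^+ N.+1; a * q / b; a * q / c; a * q / d]
          q p (mweight j))
   * (qpochs [:: E; lambda * a * q ^+ N.+1 / (E * F); q ^- N] q p (mweight j)
      / qpochs [:: lambda * q / E; lambda * q / F; E * F * q ^- N / a]
          q p (mweight j))
   * (\prod_(r < m)
        ((qpoch (h * y r / F) q p (j r) * qpoch (h * y r) q p (mweight j))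
         / (qpoch (h * y r) q p (j r) * qpoch (h * y r / f r) q p (mweight j))))
   * q ^+ (\sum_(r < m) r.+1 * j r)%N).
Proof.
(* The condition on q x_r / x_s at r = s. *)
have qN0 : qpoch q q p N != 0.
  by have := denL_qx (Ordinal n_ge1) (Ordinal n_ge1) N (leqnn N); rewrite mulfK //.
have E0 : E != 0 by rewrite EE; apply/prodf_neq0.
have F0 : F != 0 by rewrite FE; apply/prodf_neq0.
have bcd0 : b * c * d != 0 by rewrite !mulf_neq0.
have l0 : lambda != 0 by rewrite lambdaE !mulf_neq0 ?invr_eq0 ?expf_neq0.
have lE : lambda * (b * c * d) = q * a ^+ 2 by rewrite lambdaE divfK.
have HL := multisum_collapse p_lt1 q_neq0 n_ge1 g_neq0 e_neq0 x_neq0 denL_x denL_qx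
  denL_gx denL_gxe
  (fun K => theta (a * q ^+ (2 * K)) p / theta a p)
  (fun K => qpochs [:: a; b; c; d] q p K
      / qpochs [:: a * q ^+ N.+1; a * q / b; a * q / c; a * q / d] q p K)
  (fun K => qpochs [:: F; lambda * a * q ^+ N.+1 / (E * F); q ^- N] q p K
      / qpochs [:: a * q / E; a * q / F; E * F * q ^- N / lambda] q p K) EE.
have HR := multisum_collapse p_lt1 q_neq0 m_ge1 h_neq0 f_neq0 y_neq0 denR_y denR_qy
  denR_hy denR_hyf
  (fun K => theta (lambda * q ^+ (2 * K)) p / theta lambda p)
  (fun K => qpochs [:: lambda; lambda * b / a; lambda * c / a; lambda * d / a] q p K
      / qpochs [:: lambda * q ^+ N.+1; a * q / b; a * q / c; a * q / d] q p K)
  (fun K => qpochs [:: E; lambda * a * q ^+ N.+1 / (E * F); q ^- N] q p K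
      / qpochs [:: lambda * q / E; lambda * q / F; E * F * q ^- N / a] q p K) FE.
cbv beta in HL, HR.
rewrite HL HR.
have [aN bN cN dN] := qpochs4_neq0 (denL_1 N (leqnn N)).
have [aE aF EFl] := qpochs3_neq0 (denL_2 N (leqnn N)).
have [_ _ lq lqEF] := qpochs4_neq0 denR_0.
have [lN _ _ _] := qpochs4_neq0 (denR_1 N (leqnn N)).
have [lqE lqF EFa] := qpochs3_neq0 (denR_2 N (leqnn N)).
have lquot z : z != 0 -> lambda * q / (lambda * z / a) = a * q / z.
  by move=> z0; field; rewrite a_neq0 z0 l0.
have B := elliptic_bailey p_lt1 q_neq0 a_neq0 b_neq0 c_neq0 d_neq0 l0 E0 F0 lE
  denL_a denR_lambda qN0 bN cN dN aN lN aE aF lqE lqF lq lqEF EFl EFa.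
have prefE : bailey_prefactor (fun z => theta z p) q N a lambda E F =
  qpochs [:: a * q; a * q / (E * F); lambda * q / E; lambda * q / F] q p N
  / qpochs [:: a * q / E; a * q / F; lambda * q; lambda * q / (E * F)] q p N.
  by rewrite !qpochs4.
rewrite -prefE.
have shape (qK e' i T A1 A2 A3 A4 X Y Z V F' G M U1 U2 U3 : R[i]) :
    qK * (e' / i) * (T * (A1 * A2 * A3 * A4 / (X * Y * Z * V))
      * (F' * G * M / (U1 * U2 * U3)))
    = T * (A1 * A2 * A3 * A4) / (i * Y * Z * V) * qK
      * (e' * F' * G * M / (X * U1 * U2 * U3)).
  by rewrite !invfM; ring.
transitivity (\sum_(0 <= k < N.+1) wp_base (fun z => theta z p) q a b c d k
    * bailey_weight (fun z => theta z p) q N a lambda E F k).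
  by apply: eq_bigr => K _; rewrite !qpochs4 !qpochs3; exact: shape.
rewrite B; congr (_ * _); apply: eq_bigr => K _; rewrite !qpochs4 !qpochs3.
rewrite /wp_base /bailey_weight !lquot //.
by rewrite (mulrC a lambda) (mulrC (poch _ _ E K)); symmetry; exact: shape.
Qed.
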